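(* Let $m,n\ge0$, $r,s\ge0$ be integers, $\delta:=m-n$ and $\mathfrak g:=\mathfrak{gl}_{m|n}(\mathbb C)$. The algebra homomorphism $$\Psi^{m,n}_{r,s}:B_{r,s}(\delta)\to\operatorname{End}_{\mathfrak g}(V^{\otimes r}\otimes W^{\otimes s})^{\mathrm{op}}$$ is surjective. It is injective if and only if $r+s<(m+1)(n+1)$.
   Context: **Walled Brauer algebra.** $B_{r,s}(\delta)$ is the associative $\mathbb C$-algebra with basis the isotopy classes of walled Brauer diagrams: diagrams in a rectangle with $r+s$ vertices on the top edge and $r+s$ on the bottom edge, each numbered $1,\dots,r+s$ from left to right, with a vertical wall separating vertices $1,\dots,r$ from $r+1,\dots,r+s$; each vertex is connected to exactly one other by a curve inside the rectangle (so a diagram is a perfect matching of the $2(r+s)$ vertices). Curves joining different edges (vertical strands) must have both endpoints on the same side of the wall; curves joining two vertices on the same edge (horizontal strands) must have endpoints on opposite sides. The product $\sigma\tau$ is computed by putting $\sigma$ under $\tau$, removing the $t$ internal circles, and multiplying the resulting diagram by $\delta^t$. **Lie superalgebra and mixed tensor space.** $V$ is the vector superspace with homogeneous basis $v_1,\dots,v_{m+n}$, $|v_i|=|i|$, where $|i|:=0\in\mathbb Z_2$ for $1\le i\le m$ and $|i|:=1$ for $m+1\le i\le m+n$. $\mathfrak g=\mathfrak{gl}_{m|n}(\mathbb C)=\operatorname{End}(V)$ with superbracket $[x,y]=xy-(-1)^{|x||y|}yx$. $W:=V^*$ with basis $w_1,\dots,w_{m+n}$ dual to the $v_i$ and action $(xw)(v)=-(-1)^{|x||w|}w(xv)$.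 Tensor products of supermodules carry the usual sign-rule action. For a $\mathfrak g$-supermodule $M$, $\operatorname{End}_{\mathfrak g}(M)$ is the space of all (not necessarily homogeneous) linear endomorphisms $f$ that supercommute with $\mathfrak g$: $x(f(m))=(-1)^{|x||f|}f(xm)$ for homogeneous components. **The map $\Psi$.** Let $I=\{1,\dots,m+n\}$. For $\mathbf i\in I^{r+s}$ write $v_{\mathbf i^{\mathrm L}}\otimes w_{\mathbf i^{\mathrm R}}:=v_{i_1}\otimes\cdots\otimes v_{i_r}\otimes w_{i_{r+1}}\otimes\cdots\otimes w_{i_{r+s}}$. For a walled Brauer diagram $\sigma$ and $\mathbf i,\mathbf j\in I^{r+s}$, colour the bottom vertices of $\sigma$ by $i_1,\dots,i_{r+s}$ and the top vertices by $j_1,\dots,j_{r+s}$. Set $\mathrm{wt}({}_{\mathbf i}\sigma_{\mathbf j})=0$ unless the two ends of every strand have the same colour, in which case $\mathrm{wt}({}_{\mathbf i}\sigma_{\mathbf j})=\prod_c(-1)^{|c|}\prod_h(-1)^{|h|}$, where $c$ runs over the crossings between two different strands, with $|c|=|i||j|$ if the strands have colours $i,j$, and $h$ runs over the horizontal strands with endpoints on the bottom edge, with $|h|=|k|$ for a strand of colour $k$. Then $(v_{\mathbf i^{\mathrm L}}\otimes w_{\mathbf i^{\mathrm R}})\cdot\sigma=\sum_{\mathbf j\in I^{r+s}}\mathrm{wt}({}_{\mathbf i}\sigma_{\mathbf j})\,v_{\mathbf j^{\mathrm L}}\otimes w_{\mathbf j^{\mathrm R}}$ is a well-defined right action of $B_{r,s}(\delta)$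 on $V^{\otimes r}\otimes W^{\otimes s}$ commuting with $\mathfrak g$, and $\Psi^{m,n}_{r,s}$ is the induced homomorphism. *)

(* Defs.v *)
From HB Require Import structures.
From mathcomp Require Import all_boot all_order all_algebra.
From mathcomp Require Import reals complex.

Set Implicit Arguments.
Unset Strict Implicit.
Unset Printing Implicit Defensive.

Import Order.TTheory GRing.Theory Num.Theory.

Local Open Scope ring_scope.

(* The vector space with basis a finite type I is {ffun I -> F^o}. *)
Section FreeSpace.
Variables (F : fieldType) (I : finType).

Definition basis_vec (i : I) : {ffun I -> F^o} := [ffun j => (j == i)%:R].

Definition lin_ext_fun (U : vectType F) (g : I -> U) (u : {ffun I -> F^o}) : U :=
  \sum_i u i *: g i.

Fact lin_ext_fun_is_linear (U : vectType F) (g : I -> U) :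
  linear (lin_ext_fun g).
Proof.
move=> a u v; rewrite /lin_ext_fun scaler_sumr -big_split /=.
by apply: eq_bigr => i _; rewrite !ffunE scalerDl scalerA.
Qed.

HB.instance Definition _ (U : vectType F) (g : I -> U) :=
  GRing.isLinear.Build F {ffun I -> F^o} U *:%R (lin_ext_fun g)
    (lin_ext_fun_is_linear g).

Definition lin_ext (U : vectType F) (g : I -> U) : 'Hom({ffun I -> F^o}, U) :=
  linfun (lin_ext_fun g).

Lemma lin_ext_basis (U : vectType F) (g : I -> U) (i : I) :
  lin_ext g (basis_vec i) = g i.
Proof.
rewrite lfunE /= /lin_ext_fun (bigD1 i) //= ffunE eqxx scale1r big1 ?addr0 //.
by move=> j ji; rewrite ffunE (negPf ji) scale0r.
Qed.

End FreeSpace.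

(* Walled Brauer diagrams.  A vertex is a pair (edge, position), the edge being
   false for bottom and true for top; positions are counted from 0, and the wall
   separates the positions < r from those >= r.  Since a diagram only matters up
   to isotopy, it is given by the map sending a vertex to the other end of its
   strand. *)
Section Diagrams.
Variables r s : nat.

Definition vertex : Type := (bool * 'I_(r + s))%type.

Definition same_edge (v w : vertex) : bool := v.1 == w.1.

Definition same_side (v w : vertex) : bool := (v.2 < r)%N == (w.2 < r)%N.

Definition is_walled_brauer (d : {ffun vertex -> vertex}) : bool :=
  [forall v, [&& d v != v, d (d v) == v &
     if same_edge v (d v) then ~~ same_side v (d v) else same_side v (d v)]].

Definition diagram : Type := {d : {ffun vertex -> vertex} | is_walled_brauer d}.

Definition strand (d : diagram) : vertex -> vertex := fun v => val d v.

Definition id_fun : {ffun vertex -> vertex} := [ffun v => (~~ v.1, v.2)].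

Fact id_fun_walled : is_walled_brauer id_fun.
Proof.
apply/forallP => -[e i]; rewrite /same_edge /same_side !ffunE /= negbK eqxx.
by rewrite eqxx xpair_eqE; case: e.
Qed.

Definition id_diagram : diagram := exist _ id_fun id_fun_walled.

(* Stacking d1 under d2 gives a graph on three rows of r + s points: row 0 is
   the bottom of d1, row 1 is the top of d1 glued to the bottom of d2, and row 2
   is the top of d2. *)
Definition row_point : Type := ('I_3 * 'I_(r + s))%type.

Definition lower_point (v : vertex) : row_point := (inord v.1, v.2).

Definition upper_point (v : vertex) : row_point := (inord v.1.+1, v.2).

Definition outer_point (v : vertex) : row_point :=
  (if v.1 then inord 2 else inord 0, v.2).

Definition stack_rel (d1 d2 : diagram) : rel row_point := fun x y =>
  [exists v, (x == lower_point v) && (y == lower_point (strand d1 v))]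
  || [exists v, (x == upper_point v) && (y == upper_point (strand d2 v))].

(* Each component of the stacked graph is either an internal circle or a path
   joining two outer points, so exactly one diagram d satisfies this. *)
Definition is_stack (d1 d2 d : diagram) : bool :=
  [forall v, connect (stack_rel d1 d2) (outer_point v)
                     (outer_point (strand d v))].

Definition internal_circles (d1 d2 : diagram) : nat :=
  n_comp (stack_rel d1 d2)
    [pred x : row_point | [forall y : row_point,
       connect (stack_rel d1 d2) x y ==> (y.1 == inord 1)]].

(* Position of a vertex along the boundary of the rectangle, counterclockwise
   from the bottom left corner. *)
Definition boundary_pos (v : vertex) : nat :=
  if v.1 then ((r + s).*2 - v.2.+1)%N else v.2.

(* The strands through v and w cross, where v and w are the first ends of their
   strands along the boundary and v comes before w.  Two strands with interleaved
   ends cross once in a drawing with minimal crossings, and an odd number of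
   times in any drawing; other strands cross an even number of times. *)
Definition crossing (d : diagram) (v w : vertex) : bool :=
  [&& (boundary_pos v < boundary_pos w)%N,
      (boundary_pos w < boundary_pos (strand d v))%N &
      (boundary_pos (strand d v) < boundary_pos (strand d w))%N].

(* v is the left end of a horizontal strand on the bottom edge. *)
Definition bottom_cap (d : diagram) (v : vertex) : bool :=
  [&& ~~ v.1, ~~ (strand d v).1 & (v.2 < (strand d v).2)%N].

End Diagrams.

Section WalledBrauerAlgebra.
Variables (F : fieldType) (r s : nat) (delta : F).

Definition wb_alg : Type := {ffun diagram r s -> F^o}.

Definition wb_one : wb_alg := basis_vec F (id_diagram r s).

(* Bilinear extension of d1 * d2 = delta ^+ t *: d, where d is the diagram
   obtained by stacking d1 under d2 and removing t circles. *)
Definition wb_mul (a b : wb_alg) : wb_alg :=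
  \sum_d1 \sum_d2 \sum_(d | is_stack d1 d2 d)
     (a d1 * b d2 * delta ^+ internal_circles d1 d2) *: basis_vec F d.

End WalledBrauerAlgebra.

Section MixedTensorSpace.
Variables (F : fieldType) (m n r s : nat).

Definition parity (i : 'I_(m + n)) : bool := (m <= i)%N.

(* Operators on V are matrices acting on columns; gl_homog e x says that x is
   homogeneous of parity e. *)
Definition gl_homog (e : bool) (x : 'M[F]_(m + n)) : Prop :=
  forall i j, x i j != 0 -> parity i (+) parity j = e.

Definition gl_actV (x : 'M[F]_(m + n)) (v : 'cV[F]_(m + n)) : 'cV[F]_(m + n) :=
  x *m v.

(* The dual W of V consists of rows, w being the form v |-> w *m v, so that
   (x w)(v) = - (-1) ^ (|x||w|) w (x v); here e = |x| and f = |w|. *)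
Definition gl_actW (e f : bool) (x : 'M[F]_(m + n)) (w : 'rV[F]_(m + n)) :
  'rV[F]_(m + n) := - ((-1) ^+ (e && f) *: (w *m x)).

Definition multi_index : Type := {ffun 'I_(r + s) -> 'I_(m + n)}.

Definition mi_parity (i : multi_index) : bool := odd (\sum_p parity (i p)).

Definition mi_set (i : multi_index) (p : 'I_(r + s)) (k : 'I_(m + n)) :
  multi_index := [ffun q => if q == p then k else i q].

(* V^(r) (x) W^(s), the basis vector of index i being
   v_{i_1} (x) ... (x) v_{i_r} (x) w_{i_{r+1}} (x) ... (x) w_{i_{r+s}}. *)
Definition mixed_tensor : Type := {ffun multi_index -> F^o}.

(* Coefficient of the k-th basis vector in x applied to the j-th one, in the
   tensor factor at position p, for x homogeneous of parity e. *)
Definition gl_coef (e : bool) (x : 'M[F]_(m + n)) (p : 'I_(r + s))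
    (k j : 'I_(m + n)) : F :=
  if (p < r)%N then gl_actV x (delta_mx j 0) k 0
  else gl_actW e (parity j) x (delta_mx 0 j) 0 k.

(* Sign-rule action on tensors of x homogeneous of parity e. *)
Definition gl_act (e : bool) (x : 'M[F]_(m + n)) : 'End(mixed_tensor) :=
  lin_ext (fun i : multi_index =>
    \sum_(p < r + s)
      (-1) ^+ (e * \sum_(q < r + s | (q < p)%N) parity (i q))%N *:
      \sum_k gl_coef e x p k (i p) *: basis_vec F (mi_set i p k)
    : mixed_tensor).

Definition end_homog (e : bool) (f : 'End(mixed_tensor)) : Prop :=
  forall i j : multi_index,
    f (basis_vec F j) i != 0 -> mi_parity i (+) mi_parity j = e.

(* f belongs to End_g: h false and h true are its homogeneous components. *)
Definition supercommutes (f : 'End(mixed_tensor)) : Prop :=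
  exists h : bool -> 'End(mixed_tensor),
    [/\ f = h false + h true,
        forall e, end_homog e (h e) &
        forall (e e' : bool) (x : 'M[F]_(m + n)) (u : mixed_tensor),
          gl_homog e x ->
          gl_act e x (h e' u) = (-1) ^+ (e && e') *: h e' (gl_act e x u)].

Definition colour (i j : multi_index) (v : vertex r s) : 'I_(m + n) :=
  if v.1 then j v.2 else i v.2.

Definition wt (i : multi_index) (d : diagram r s) (j : multi_index) : F :=
  let c := colour i j in
  if [forall v, c v == c (strand d v)] then
    (\prod_(vw : vertex r s * vertex r s | crossing d vw.1 vw.2)
       (-1) ^+ (parity (c vw.1) && parity (c vw.2)))
    * \prod_(v : vertex r s | bottom_cap d v) (-1) ^+ parity (c v)
  else 0.

Definition diagram_act (d : diagram r s) : 'End(mixed_tensor) :=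
  lin_ext (fun i : multi_index =>
    \sum_(j : multi_index) wt i d j *: basis_vec F j : mixed_tensor).

Definition Psi : 'Hom(wb_alg F r s, 'End(mixed_tensor)) := lin_ext diagram_act.

End MixedTensorSpace.

(* Main.v *)
From HB Require Import structures.
Require Import Defs.
From mathcomp Require Import all_boot all_order all_fingroup all_algebra.
From mathcomp Require Import boolp reals complex.
From mathcomp Require Import zify.

Set Implicit Arguments.
Unset Strict Implicit.
Unset Printing Implicit Defensive.

Import Order.TTheory GRing.Theory Num.Theory.

Local Open Scope ring_scope.

(** Orient the strands of a walled Brauer diagram along the arrows of V: up on the
    left of the wall and down on its right.  A diagram is then a permutation of
    the [k = r + s] positions, and bending the right of the picture back turns the
    mixed tensor space into the tensor power of order [k] of V.  On the level of
    matrix coefficients this only multiplies by a sign that depends on the colours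
    of the boundary and not on the diagram: by [wt_signed_perm] the weight of a
    diagram is, up to that sign, the coefficient of the permutation acting on the
    tensor power with odd vectors anticommuting.  By [bent_commutator] the same
    sign turns the commutator with an element of the Lie superalgebra into the
    commutator on the tensor power.  The theorem is thus reduced to the symmetric
    group, except for the multiplicativity.

    Image.  If [f] commutes with the matrix units of the superalgebra, then it
    commutes with the operators that apply given matrix units to [l] distinct
    positions, summed over the choices of the positions; this follows by
    induction on [l], as multiplication by one more unit gives the sum for
    [l + 1] and sums for lists of length [l].  For [l = k] these operators are, up
    to signs, the averages of the matrix units of the tensor power over the
    symmetric group.  Maschke's projection onto
    the span of the signed permutations is made of such averages, so that it fixes
    [f] ([commutant_span]).  Operators of odd degree are excluded by weights.

    Kernel.  A relation between the signed permutations is a function [u] on the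
    symmetric group that is killed by symmetrising over even colours and
    antisymmetrising over odd colours, for every colouring.  If [w] is symmetric on
    [X], antisymmetric on [Z] and can be enlarged to no vector symmetric on one
    more point of [Z] or antisymmetric on one more point of [X], then adding up
    these conditions gives [(#|X| + #|Z|) w = 0] ([enlarge_both0]).  With this, a
    greedy choice of the colour classes shows that a nonzero translation-invariant
    space on fewer than [(m + 1)(n + 1)] points has a nonzero vector that is
    symmetric for a colouring with [m] even and [n] odd colours
    ([hook_colouring]), which excludes relations.  For [(m + 1)(n + 1)] points or
    more the same argument, run in the opposite direction on the module of the
    Young symmetrizer of a rectangle, shows that no such vector exists there
    ([no_hook_colouring]), and the Young symmetrizer is a relation.

    Multiplicativity.  Stacking two diagrams amounts to a partial supertrace of a
    permutation of the strands of both.  If the contracted points are the last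
    ones, they can be removed one after the other ([contract]): joining the two
    strands at the last point is multiplication by a transposition, whose sign is
    the sign of the colour, and a strand that closes up contributes
    [m - n].  That the remaining permutation and the number of circles are those
    given by the components of the stacked graph is seen by counting colourings
    for [n = 0], where no signs occur. *)

(** * Inversions of coloured permutations *)

Section Inversions.
Variable X : finType.
Implicit Types (f g : X -> nat) (h : X -> X -> bool) (o : X -> bool).
Implicit Types (s t : {perm X}).

(** The rank [f] only fixes the order in which the points of a pair are passed to
    [h]. *)
Definition pair_parity f h : bool :=
  \big[addb/false]_(xy : X * X | (f xy.1 < f xy.2)%N) h xy.1 xy.2.

Lemma pair_parityD f h h' :
  pair_parity f (fun x y => h x y (+) h' x y)
  = pair_parity f h (+) pair_parity f h'.
Proof. by rewrite /pair_parity big_split. Qed.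

Lemma eq_pair_parity f h h' :
  (forall x y, (f x < f y)%N -> h x y = h' x y) ->
  pair_parity f h = pair_parity f h'.
Proof. by move=> e; apply: eq_bigr => -[x y] /= /e. Qed.

(** A symmetric property has as many pairs in one order as in another one: the
    pairs ordered differently by [f] and [g] are exchanged by the flip. *)
Lemma pair_parity_rank f g h :
  injective f -> injective g -> (forall x y, h x y = h y x) ->
  pair_parity f h = pair_parity g h.
Proof.
move=> fi gi hC; rewrite /pair_parity.
rewrite (bigID (fun xy : X * X => g xy.1 < g xy.2)%N) /=.
rewrite [RHS](bigID (fun xy : X * X => f xy.1 < f xy.2)%N) /=.
congr addb; first by apply: eq_bigl => -[x y]; rewrite andbC.
rewrite (reindex_inj (h := fun xy : X * X => (xy.2, xy.1))); last first.
  by move=> [x y] [x' y'] [-> ->].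
apply: eq_big => [[x y] | [x y] _] /=; last exact: hC.
rewrite -!leqNgt !ltn_neqAle !(inj_eq fi, inj_eq gi) [y == x]eq_sym.
by case: (x == y); rewrite // andbC.
Qed.

Lemma pair_parity_perm f h s :
  pair_parity (fun x => f (s x)) (fun x y => h (s x) (s y)) = pair_parity f h.
Proof.
rewrite /pair_parity [RHS](reindex_inj (h := fun xy : X * X => (s xy.1, s xy.2))) //.
by move=> [x y] [x' y'] [] /perm_inj -> /perm_inj ->.
Qed.

(** The sign picked up when [s] permutes letters of which those selected by [o]
    anticommute. *)
Definition inv_parity f o s : bool :=
  pair_parity f (fun x y => [&& o x, o y & (f (s y) < f (s x))%N]).

Lemma eq_inv_parity f o o' s : o =1 o' -> inv_parity f o s = inv_parity f o' s.
Proof. by move=> e; apply: eq_pair_parity => x y _; rewrite !e. Qed.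

Lemma inv_parity1 f o : inv_parity f o 1%g = false.
Proof.
rewrite /inv_parity /pair_parity big1 // => -[x y] /= xy.
by rewrite !perm1 [(f y < _)%N]ltnNge (ltnW xy) !andbF.
Qed.

(** Inversions form a cocycle: that a pair is reordered by [t * s] is decided by
    whether [t] reorders it and whether [s] reorders its image, and the latter
    is a symmetric property, so that the images may be listed in any order. *)
Lemma inv_parityM f o s t : injective f ->
  inv_parity f o (t * s)
  = inv_parity f o t (+) inv_parity f (fun x => o (t^-1%g x)) s.
Proof.
move=> fi; pose o' := fun x => o (t^-1%g x).
pose dis u v := [&& o' u, o' v & (f v < f u)%N (+) (f (s v) < f (s u))%N].
have disC u v : dis u v = dis v u.
  rewrite /dis andbCA; congr andb; congr andb.
  case: (eqVneq u v) => [-> // | uv].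
  have suv : s u != s v by rewrite (inj_eq perm_inj).
  have := inj_eq fi u v; have := inj_eq fi (s u) (s v).
  rewrite (negPf uv) (negPf suv).
  by case: (ltngtP (f u)); case: (ltngtP (f (s u))).
transitivity (inv_parity f o t (+) pair_parity f (fun x y => dis (t x) (t y))).
  rewrite -pair_parityD; apply: eq_pair_parity => x y _.
  by rewrite /dis /o' !permM !permK; case: (o x); case: (o y); rewrite ?addKb.
congr addb.
transitivity (pair_parity (fun x => f (t x)) (fun x y => dis (t x) (t y))).
  by apply: pair_parity_rank => // x y /fi /perm_inj.
rewrite pair_parity_perm; apply: eq_pair_parity => x y xy.
by rewrite /dis [(f y < f x)%N]ltnNge (ltnW xy) addFb.
Qed.

(** In a rank where [x] and [y] come first, a third point [z] is reordered with
    respect to [x] exactly when it is with respect to [y]. *)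
Lemma inv_parity_tperm f o (x y : X) :
  injective f -> x != y -> o x = o y -> inv_parity f o (tperm x y) = o x.
Proof.
move=> fi xy oxy; set t := tperm x y.
have fxy : f x != f y by rewrite (inj_eq fi).
pose h u v := [&& o u, o v & (f v < f u)%N (+) (f (t v) < f (t u))%N].
have hC u v : h u v = h v u.
  rewrite /h andbCA; congr andb; congr andb.
  case: (eqVneq u v) => [-> // | uv].
  have tuv : t u != t v by rewrite (inj_eq perm_inj).
  have := inj_eq fi u v; have := inj_eq fi (t u) (t v).
  rewrite (negPf uv) (negPf tuv).
  by case: (ltngtP (f u)); case: (ltngtP (f (t u))).
pose g u := if u == x then 0%N else if u == y then 1%N else (f u).+2.
have gi : injective g.
  move=> u v; rewrite /g; case: (eqVneq u x) => [-> | ux].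
    by case: (eqVneq v x) => [-> | vx] //; case: eqP.
  case: (eqVneq u y) => [-> | uy].
    case: (eqVneq v x) => [-> | vx] //.
    by case: (eqVneq v y) => [-> | vy].
  case: (eqVneq v x) => [-> | vx] //; case: (eqVneq v y) => [-> | vy] //.
  by case=> /fi.
transitivity (pair_parity g h).
  rewrite -(pair_parity_rank fi gi hC); apply: eq_pair_parity => u v uv.
  by rewrite /h [(f v < f u)%N]ltnNge (ltnW uv) addFb.
rewrite /pair_parity -(pair_big_dep predT (fun u v => g u < g v)%N) /=.
rewrite (bigD1 x) //= [X in _ (+) X](bigD1 y) 1?eq_sym //=.
rewrite [X in _ (+) (_ (+) X)]big1 => [|u /andP[ux uy]]; last first.
  rewrite big1 // => v; rewrite {1}/g (negPf ux) (negPf uy).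
  rewrite /g; case: (eqVneq v x) => // vx; case: (eqVneq v y) => // vy _.
  by rewrite /h /t !tpermD 1?eq_sym // addbb !andbF.
rewrite addbF (bigD1 y) /=; last by rewrite /g eqxx (eq_sym y x) (negPf xy) eqxx.
have -> : h x y = o x.
  rewrite /h /t tpermL tpermR -oxy andbA andbb.
  by case: (o x) => //=; case: ltngtP fxy.
rewrite -addbA [X in _ (+) X](_ : _ = false) ?addbF //.
rewrite [X in X (+) _](eq_bigl (fun u => (u != x) && (u != y))); last first.
  move=> u; rewrite /g eqxx; case: (eqVneq u x) => [-> // | ux].
  by case: eqVneq.
rewrite [X in _ (+) X](eq_bigl (fun u => (u != x) && (u != y))); last first.
  move=> u; rewrite /g eqxx eq_sym (negPf xy).
  by case: (eqVneq u x) => // ux; case: eqVneq.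
rewrite -big_split big1 //= => u /andP[ux uy].
rewrite /h /t tpermL tpermR !tpermD 1?eq_sym // -oxy.
by rewrite [X in [&& _, _ & X] (+) _]addbC addbb.
Qed.

End Inversions.

(** * The signed permutation kernel *)

Section PermKernel.
Variables (F : numFieldType) (X C : finType) (f : X -> nat) (odd_col : C -> bool).
Hypothesis f_inj : injective f.
Implicit Types (a b : X -> C) (s t : {perm X}).

(** Matrix coefficient, between the basis tensors with colours [a] and [b], of
    the permutation [s] of the tensor factors: the factor at [x] moves to [s x],
    odd colours anticommuting. *)
Definition perm_kernel s a b : F :=
  if [forall x, b (s x) == a x]
  then (-1) ^+ inv_parity f (fun x => odd_col (a x)) s else 0.

Lemma eq_perm_kernel s a a' b b' :
  a =1 a' -> b =1 b' -> perm_kernel s a b = perm_kernel s a' b'.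
Proof.
move=> ea eb; rewrite /perm_kernel.
rewrite (eq_inv_parity _ _ (o' := fun x => odd_col (a' x))) => [|x]; last by rewrite ea.
by rewrite (eq_forallb (P2 := fun x => b' (s x) == a' x)) // => x; rewrite ea eb.
Qed.

Lemma perm_kernel_neq0 s a b : (perm_kernel s a b != 0) = [forall x, b (s x) == a x].
Proof. by rewrite /perm_kernel; case: ifP; rewrite ?eqxx // signr_eq0. Qed.

Lemma perm_kernel1 a b : perm_kernel 1 a b = [forall x, b x == a x]%:R.
Proof.
rewrite /perm_kernel inv_parity1 (eq_forallb (P2 := fun x => b x == a x)).
  by case: ifP.
by move=> x; rewrite perm1.
Qed.

Lemma perm_kernelM s t a b :
  perm_kernel (t * s) a b
  = (-1) ^+ inv_parity f (fun x => odd_col (a x)) t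
    * perm_kernel s (fun x => a (t^-1%g x)) b.
Proof.
rewrite /perm_kernel inv_parityM // signr_addb.
have -> : [forall x, b ((t * s)%g x) == a x]
        = [forall x, b (s x) == a (t^-1%g x)].
  apply/forallP/forallP => H x.
    by have := H (t^-1%g x); rewrite permM permKV.
  by have := H (t x); rewrite permM permK.
by case: ifP; rewrite ?mulr0.
Qed.

Lemma perm_kernel_tperm s a b x y : x != y -> a x = a y ->
  perm_kernel (tperm x y * s) a b = (-1) ^+ odd_col (a x) * perm_kernel s a b.
Proof.
move=> xy axy; rewrite perm_kernelM inv_parity_tperm //; last by rewrite axy.
congr (_ * _); apply: eq_perm_kernel => // z; rewrite tpermV.
by case: tpermP => // ->.
Qed.

End PermKernel.

(** * Symmetric and antisymmetric vectors of the group algebra *)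

Lemma leq_card_bound (T : finType) (Z : {set T}) (g : T -> nat) l :
  {in Z, forall x, (g x < l)%N} -> {in Z &, injective g} -> (#|Z| <= l)%N.
Proof.
move=> gl gi; rewrite -[l](size_iota 0) cardE -(size_map g).
apply: uniq_leq_size; last first.
  by move=> i /mapP[x]; rewrite mem_enum => /gl xl ->; rewrite mem_iota.
by rewrite map_inj_in_uniq ?enum_uniq // => x y; rewrite !mem_enum; apply: gi.
Qed.

Section GroupAlgebra.
Variables (F : numFieldType) (T : finType).

Definition gring : Type := {ffun {perm T} -> F^o}.
HB.instance Definition _ := GRing.Lmodule.on gring.

Implicit Types (u v w : gring) (s t : {perm T}) (X Y Z : {set T}) (e : bool).
Implicit Types (x y z p q : T).

(** Translation of functions on the group; translations compose in the reverse
    order. *)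
Definition pact s u : gring := [ffun t => u (s * t)%g].

Lemma pactM s t u : pact s (pact t u) = pact (t * s) u.
Proof. by apply/ffunP => g; rewrite !ffunE mulgA. Qed.

Lemma pactD s u v : pact s (u + v) = pact s u + pact s v.
Proof. by apply/ffunP => g; rewrite !ffunE. Qed.

Lemma pactZ s a u : pact s (a *: u) = a *: pact s u.
Proof. by apply/ffunP => g; rewrite !ffunE. Qed.

Lemma pact_sum s (I : Type) (r : seq I) (P : pred I) (G : I -> gring) :
  pact s (\sum_(i <- r | P i) G i) = \sum_(i <- r | P i) pact s (G i).
Proof.
by apply: (big_morph _ (pactD s)); apply/ffunP => g; rewrite !ffunE.
Qed.

Lemma pact0 s : pact s 0 = 0.
Proof. by apply/ffunP => g; rewrite !ffunE. Qed.

Lemma pact_tpermK p q u : pact (tperm p q) (pact (tperm p q) u) = u.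
Proof. by rewrite pactM tperm2; apply/ffunP => g; rewrite !ffunE mul1g. Qed.

(** Conjugation of transpositions, as a rule for moving them past each other. *)
Lemma pact_tpermJ p q x y u :
  pact (tperm p q) (pact (tperm x y) u)
  = pact (tperm (tperm p q x) (tperm p q y)) (pact (tperm p q) u).
Proof. by rewrite !pactM -tpermJ -conjgC. Qed.

(** Such vectors correspond to homomorphisms from the representation induced by the
    character of the stabiliser of [c] that is the sign on the odd colours and
    trivial on the even ones. *)
Definition colour_sym (C : eqType) (odd : C -> bool) Y (c : T -> C) u :=
  {in Y &, forall x y, x != y -> c x = c y ->
     pact (tperm x y) u = (-1) ^+ odd (c x) *: u}.

Definition set_sym e X u :=
  {in X &, forall x y, x != y -> pact (tperm x y) u = (-1) ^+ e *: u}.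

Definition transp_stable Y (K : gring -> Prop) :=
  [/\ forall u v, K u -> K v -> K (u + v), forall a u, K u -> K (a *: u)
    & forall x y u, x \in Y -> y \in Y -> K u -> K (pact (tperm x y) u)].

(** The (anti)symmetrisation, up to a scalar, of [u] over [z |: X] when [u] is
    already [X]-(anti)symmetric: only one representative of each coset of the
    permutations of [X] is needed. *)
Definition enlarge e X z u : gring :=
  u + (-1) ^+ e *: \sum_(x in X) pact (tperm x z) u.

Lemma enlargeD e X z u v : enlarge e X z (u + v) = enlarge e X z u + enlarge e X z v.
Proof.
rewrite /enlarge addrACA -scalerDr -big_split; congr (_ + _ *: _).
by apply: eq_bigr => x _; rewrite pactD.
Qed.

Lemma enlargeZ e X z a u : enlarge e X z (a *: u) = a *: enlarge e X z u.
Proof.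
rewrite /enlarge scalerDr [in RHS]scalerA [a * _]mulrC -[in RHS]scalerA [in RHS]scaler_sumr.
by congr (_ + _ *: _); apply: eq_bigr => x _; rewrite pactZ.
Qed.

Lemma set_sym0 e u : set_sym e set0 u.
Proof. by move=> x y; rewrite inE. Qed.

Lemma set_symS e X Z u : Z \subset X -> set_sym e X u -> set_sym e Z u.
Proof. by move=> /subsetP ZX H x y /ZX xX /ZX yX; apply: H. Qed.

Lemma set_sym_pact e X p q u : p \notin X -> q \notin X ->
  set_sym e X u -> set_sym e X (pact (tperm p q) u).
Proof.
move=> pX qX H x y xX yX xy.
have D r : r \in X -> tperm p q r = r.
  by move=> rX; rewrite tpermD //; [apply: contraNneq pX | apply: contraNneq qX] => ->.
by rewrite -[x in LHS]D // -[y in LHS]D // -pact_tpermJ H // pactZ.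
Qed.

Lemma enlarge_pact e X z p q u : p \notin X -> q \notin X ->
  pact (tperm p q) (enlarge e X z u)
  = enlarge e X (tperm p q z) (pact (tperm p q) u).
Proof.
move=> pX qX; rewrite /enlarge pactD pactZ pact_sum; congr (_ + _ *: _).
apply: eq_bigr => x xX; rewrite pact_tpermJ tpermD //.
  by apply: contraNneq pX => ->.
by apply: contraNneq qX => ->.
Qed.

Lemma enlarge_stable Y (K : gring -> Prop) e X z u : transp_stable Y K ->
  X \subset Y -> z \in Y -> K u -> K (enlarge e X z u).
Proof.
case=> KD KZ KT /subsetP XY zY Ku; apply: (KD) => //; apply: (KZ).
apply: (big_ind K) => [|v w|x /XY xY]; [|exact: KD|exact: KT].
by rewrite -(scale0r u); apply: KZ.
Qed.

Lemma enlarge_sym e X z u : z \notin X ->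
  set_sym e X u -> set_sym e (z |: X) (enlarge e X z u).
Proof.
move=> zX H.
have neq x : x \in X -> z != x by move=> xX; apply: contraNneq zX => ->.
(* exchanging [x] and [z] exchanges [u] with the summand of [x] *)
have Hz x : x \in X ->
    pact (tperm x z) (enlarge e X z u) = (-1) ^+ e *: enlarge e X z u.
  move=> xX; rewrite /enlarge pactD pactZ pact_sum (bigD1 x) //= pact_tpermK.
  rewrite [in RHS](bigD1 x) //= !scalerDr !scalerA -expr2 sqrr_sign !scale1r.
  rewrite [LHS]addrCA; congr (_ + (_ + _)).
  rewrite scaler_sumr; apply: eq_bigr => y /andP[yX yx].
  rewrite pactM conjgCV tpermV tpermJ tpermR tpermD ?(neq x) // -pactM.
  rewrite [pact (tperm x y) u]H // 1?eq_sym //.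
  by rewrite pactZ scalerA -expr2 sqrr_sign scale1r.
move=> x y /setU1P[-> | xX] /setU1P[-> | yX] xy; first by rewrite eqxx in xy.
- by rewrite tpermC Hz.
- exact: Hz.
rewrite /enlarge pactD pactZ pact_sum H // scalerDr; congr (_ + _).
rewrite scalerA -expr2 sqrr_sign scale1r !scaler_sumr.
rewrite (reindex_inj (h := tperm x y)) /=; last exact: perm_inj.
have inX r : (tperm x y r \in X) = (r \in X).
  by case: tpermP => // ->; rewrite xX yX.
apply: eq_big => // r; rewrite inX => rX.
rewrite pact_tpermJ tpermK tpermD ?(eq_sym _ z) ?neq //.
by rewrite H // pactZ scalerA -expr2 sqrr_sign scale1r.
Qed.

(** If a vector can be extended neither from [X] to a (anti)symmetric vector on
    a larger set meeting [Z] nor from [Z] to one of the other kind on a larger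
    set meeting [X], then the sum of the transpositions between [X] and [Z] acts
    on it by two scalars of opposite signs. *)
Lemma enlarge_both0 e X Z w : (0 < #|X| + #|Z|)%N ->
  {in Z, forall z, enlarge e X z w = 0} ->
  {in X, forall x, enlarge (~~ e) Z x w = 0} -> w = 0.
Proof.
move=> n0 HZ HX.
have : \sum_(z in Z) enlarge e X z w + \sum_(x in X) enlarge (~~ e) Z x w = 0.
  by rewrite !big1 ?addr0.
rewrite /enlarge !big_split /= !sumr_const -!scaler_sumr.
rewrite [X in _ + _ *: X + _]exchange_big /=.
under [X in _ + (_ + _ *: X)]eq_bigr => x _ do
  under eq_bigr => z _ do rewrite tpermC.
rewrite signrN scaleNr addrACA subrr addr0 -mulrnDr -scaler_nat => /eqP.
by rewrite scaler_eq0 pnatr_eq0 addnC; case: (#|_| + _)%N n0 => //= ? _ /eqP.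
Qed.

(** Colours are taken greedily, largest antisymmetric set first.  A symmetric set
    of size [n.+1] disjoint from a maximal antisymmetric one would contradict
    [enlarge_both0], so the bound on symmetric sets decreases. *)
Lemma antisym_colouring n Y (K : gring -> Prop) : transp_stable Y K ->
  (exists2 u, K u & u != 0) ->
  (forall X w, X \subset Y -> #|X| = n.+1 -> K w -> set_sym false X w -> w = 0) ->
  exists w (c : T -> nat), [/\ K w, w != 0, {in Y, forall y, (c y < n)%N}
                             & colour_sym xpredT Y c w].
Proof.
elim: n Y K => [|n IHn] Y K HK [u Ku u0] Hsym.
  exists u, (fun=> 0%N); have Y0 y : y \in Y -> False.
    move=> yY; move/eqP: u0; apply; apply: (Hsym [set y]); rewrite ?cards1 ?sub1set //.
    by move=> x z; rewrite !inE => /eqP-> /eqP->; rewrite eqxx.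
  by split=> // [y /Y0 | y ? /Y0].
pose P k := `[< exists Z w, [/\ Z \subset Y, #|Z| = k, K w, w != 0
                              & set_sym true Z w] >].
have P0 : exists k, P k.
  exists 0%N; apply/asboolP; exists set0, u; rewrite sub0set cards0.
  by split=> //; apply: set_sym0.
have Pmax k : P k -> (k <= #|T|)%N.
  by move=> /asboolP[Z [w [_ <- _ _ _]]]; apply: max_card.
case: (ex_maxnP P0 Pmax) => k /asboolP[Z [w [ZY Zk Kw w0 Zw]]] maxk.
pose K' v := K v /\ set_sym true Z v.
have [KD KZ KT] := HK.
have HK' : transp_stable (Y :\: Z) K'.
  split=> [v v' [Kv Zv] [Kv' Zv'] | a v [Kv Zv] | x y v].
  - split=> [|p q pZ qZ pq]; first exact: KD.
    by rewrite pactD Zv // Zv' // scalerDr.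
  - split=> [|p q pZ qZ pq]; first exact: KZ.
    by rewrite pactZ Zv // !scalerA mulrC.
  move=> /setDP[xY xZ] /setDP[yY yZ] [Kv Zv]; split; first exact: KT.
  exact: set_sym_pact.
have [|X v XY Xn [Kv Zv] Xv|v [c [[Kv Zv] v0 cn cv]]] := IHn _ _ HK'.
- by exists w.
- have XYs := subset_trans XY (subsetDl _ _).
  have XZ x : x \in X -> (x \in Y) && (x \notin Z).
    by move/(subsetP XY); rewrite inE andbC.
  apply: (enlarge_both0 (e := false) (X := X) (Z := Z)); first by rewrite Xn.
    move=> z zZ; have zX : z \notin X by apply: contraL zZ => /XZ/andP[].
    apply: (Hsym (z |: X)); last exact: enlarge_sym.
    - by rewrite subUset sub1set (subsetP ZY).
    - by rewrite cardsU1 zX Xn.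
    by apply: (enlarge_stable _ HK) => //; apply: (subsetP ZY).
  move=> x /XZ/andP[xY xZ]; apply/eqP; apply: contraT => ne0.
  have /maxk : P k.+1.
    apply/asboolP; exists (x |: Z), (enlarge true Z x v); split=> //.
    - by rewrite subUset sub1set xY.
    - by rewrite cardsU1 xZ Zk.
    - exact: (enlarge_stable _ HK).
    exact: enlarge_sym.
  by rewrite ltnn.
exists v, (fun y => if y \in Z then n else c y); split=> //.
  move=> y yY; case: ifPn => yZ //; apply: ltnW; apply: cn.
  by rewrite inE yZ.
have cnn y : y \in Y -> y \notin Z -> c y != n.
  by move=> yY yZ; rewrite neq_ltn cn // inE yZ.
move=> x y xY yY xy; case: ifPn => xZ; case: ifPn => yZ.
- by move=> _; apply: Zv.
- by move/eqP; rewrite eq_sym (negPf (cnn _ yY yZ)).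
- by move/eqP; rewrite (negPf (cnn _ xY xZ)).
by apply: cv => //; rewrite inE ?xZ ?yZ.
Qed.

(** [(false, l)] is the [l]-th even colour, [(true, l)] the [l]-th odd one. *)
Definition hook_colour m n (c : bool * nat) := (c.2 < if c.1 then n else m)%N.

(** A symmetric set of size [n.+1] may be given an even colour, which lowers both
    [m] and the bound on the number of points; without such a set odd colours
    are enough. *)
Lemma hook_colouring m n Y (K : gring -> Prop) : transp_stable Y K ->
  (exists2 u, K u & u != 0) -> (#|Y| < m.+1 * n.+1)%N ->
  exists w (c : T -> bool * nat), [/\ K w, w != 0,
     {in Y, forall y, hook_colour m n (c y)} & colour_sym fst Y c w].
Proof.
elim: m Y K => [|m IHm] Y K HK K0 Ysize; last first.
  have [[X [w [XY Xn Kw Xw w0]]]|noX] := pselect (exists X w,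
    [/\ X \subset Y, #|X| = n.+1, K w, set_sym false X w & w != 0]).
    pose K' v := K v /\ set_sym false X v.
    have [KD KZ KT] := HK.
    have HK' : transp_stable (Y :\: X) K'.
      split=> [v v' [Kv Zv] [Kv' Zv'] | a v [Kv Zv] | x y v].
      - split=> [|p q pZ qZ pq]; first exact: KD.
        by rewrite pactD Zv // Zv' // scalerDr.
      - split=> [|p q pZ qZ pq]; first exact: KZ.
        by rewrite pactZ Zv // !scalerA mulrC.
      move=> /setDP[xY xZ] /setDP[yY yZ] [Kv Zv]; split; first exact: KT.
      exact: set_sym_pact.
    have [||v [c [[Kv Xv] v0 cn cv]]] := IHm _ _ HK'.
    - by exists w.
    - by rewrite cardsD (setIidPr XY) Xn; move: Ysize; lia.
    exists v, (fun y => if y \in X then (false, m) else c y); split=> //.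
      move=> y yY; rewrite /hook_colour; case: ifPn => yX //=.
      have := cn y; rewrite inE yX yY /hook_colour => /(_ isT).
      by case: (c y) => [[] l] //= /ltnW.
    have cnn y : y \in Y -> y \notin X -> c y != (false, m).
      move=> yY yX; have := cn y; rewrite inE yX yY /hook_colour => /(_ isT).
      by case: (c y) => [[] l] //=; rewrite xpair_eqE /= neq_ltn => ->.
    move=> x y xY yY xy; case: ifPn => xX; case: ifPn => yX.
    - by move=> _; apply: Xv.
    - by move/eqP; rewrite eq_sym (negPf (cnn _ yY yX)).
    - by move/eqP; rewrite (negPf (cnn _ xY xX)).
    by apply: cv => //; rewrite inE ?xX ?yX.
  have [|w [c [Kw w0 cn cw]]] := antisym_colouring HK K0 (n := n).
    move=> X w XY Xn Kw Xw; apply/eqP; apply: contra_notT noX => w0.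
    by exists X, w.
  by exists w, (fun y => (true, c y)); split=> // x y xY yY xy [/cw]; apply.
have [|w [c [Kw w0 cn cw]]] := antisym_colouring HK K0 (n := n).
  move=> X w /subset_leq_card XY Xn; move: XY; rewrite Xn.
  by rewrite mul1n in Ysize; rewrite leqNgt Ysize.
by exists w, (fun y => (true, c y)); split=> // x y xY yY xy [/cw]; apply.
Qed.

(** Let [X] be the colour class of the last even colour, chosen as large as
    possible: then [w] cannot be enlarged from [X].  By [enlarge_both0] the
    vectors with that property have no antisymmetric set of size [m.+1] outside
    [X], while [X] has at most [n.+1] points. *)
Lemma no_hook_colouring m n Y (K : gring -> Prop) : transp_stable Y K ->
  (forall Z w, Z \subset Y -> #|Z| = m.+2 -> K w -> set_sym true Z w -> w = 0) ->
  (forall X w, X \subset Y -> #|X| = n.+2 -> K w -> set_sym false X w -> w = 0) ->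
  (m.+1 * n.+1 <= #|Y|)%N ->
  forall w (c : T -> bool * nat), K w ->
    {in Y, forall y, hook_colour m n (c y)} -> colour_sym fst Y c w -> w = 0.
Proof.
elim: m Y K => [|m IHm] Y K HK Hanti Hsym Ysize w c Kw cmn cw.
  apply/eqP; apply: contraT => w0.
  have c1 : {in Y, forall y, (c y).1}.
    by move=> y /cmn; rewrite /hook_colour; case: (c y).1.
  have cinj : {in Y &, injective c}.
    move=> x y xY yY cxy; apply/eqP; apply: contraNT w0 => xy.
    apply/eqP; apply: (Hanti [set x; y]); rewrite ?cards2 ?xy //.
      by apply/subsetP => z; rewrite !inE => /orP[] /eqP->.
    have Hxy : pact (tperm x y) w = (-1) ^+ true *: w by rewrite cw // c1.
    by move=> p q; rewrite !inE => /orP[]/eqP-> /orP[]/eqP->;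
       rewrite ?eqxx // => _; rewrite // tpermC.
  suff : (#|Y| <= n)%N by move: Ysize; lia.
  apply: (leq_card_bound (g := fun y => (c y).2)) => [y yY | x y xY yY cxy].
    by have := cmn y yY; rewrite /hook_colour c1.
  apply: cinj => //; apply/eqP; move: (c1 x xY) (c1 y yY) cxy.
  by case: (c x) (c y) => [a l] [b l'] /= -> -> ->; rewrite eqxx.
pose X := [set y in Y | c y == (false, m)].
move: {2}#|Y :\: X| (erefl #|Y :\: X|) => d; rewrite /X {X}.
elim/ltn_ind: d w c Kw cmn cw => d IHd w c Kw cmn cw.
set X := [set y in Y | c y == (false, m)] => Yd.
have XY : X \subset Y by apply/subsetP => x; rewrite inE => /andP[].
have Xw : set_sym false X w.
  by move=> x y; rewrite !inE => /andP[xY /eqP cx] /andP[yY /eqP cy] xy;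
     rewrite cw // cx ?cy.
have [KD KZ KT] := HK.
have [allz|] := boolP [forall z in Y :\: X, enlarge false X z w == 0]; last first.
  (* the class [X] grows by one point *)
  case/forall_inPn => z /setDP[zY zX] ne0; exfalso; move/eqP: ne0; apply.
  pose c' y := if y == z then (false, m) else c y.
  have cz : c z != (false, m) by move: zX; rewrite inE zY.
  have X' : [set y in Y | c' y == (false, m)] = z |: X.
    apply/setP => y; rewrite !inE /c'; case: (eqVneq y z) => [-> | _] //=.
    by rewrite zY eqxx.
  apply: (IHd #|Y :\: (z |: X)| _ _ c'); last by rewrite X'.
  - rewrite -Yd; apply: proper_card; apply/properP; split.
      by apply: setDS; apply: subsetUr.
    by exists z; rewrite !inE ?eqxx // zY (negPf cz).
  - exact: (enlarge_stable _ HK).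
  - move=> y yY; rewrite /c'; case: (eqVneq y z) => [_ | _]; last exact: cmn.
    by rewrite /hook_colour /=.
  move=> x y xY yY xy cxy.
  have [cx|cx] := eqVneq (c' x) (false, m).
    rewrite cx; apply: (enlarge_sym zX) => //; rewrite -X' inE.
      by rewrite xY cx eqxx.
    by rewrite yY -cxy cx eqxx.
  have xz : x != z by apply: contraNneq cx => ->; rewrite /c' eqxx.
  have yz : y != z by apply: contraNneq cx => yz; rewrite cxy /c' yz eqxx.
  move: cx cxy; rewrite /c' (negPf xz) (negPf yz) => cx cxy.
  have xX : x \notin X by rewrite inE xY.
  have yX : y \notin X by rewrite inE yY -cxy.
  by rewrite enlarge_pact // tpermD // cw // enlargeZ.
have {}allz : {in Y :\: X, forall z, enlarge false X z w = 0}.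
  by move=> z zYX; apply/eqP; move/forall_inP: allz; apply.
have Xn : (#|X| <= n.+1)%N \/ w = 0.
  rewrite leqNgt; case: ltnP => Xn; [right | by left].
  have [Z ZX Zn] : exists2 Z : {set T}, Z \subset X & #|Z| = n.+2.
    have /card_gt0P[Z] : (0 < #|[set Z : {set T} | Z \subset X & #|Z| == n.+2]|)%N.
      by rewrite cards_draws bin_gt0.
    by rewrite inE => /andP[ZX /eqP Zn]; exists Z.
  by apply: (Hsym Z) => //; [apply: subset_trans XY | apply: set_symS Xw].
case: Xn => [Xn | //].
pose K' v := [/\ K v, set_sym false X v
                & {in Y :\: X, forall z, enlarge false X z v = 0}].
apply: (IHm (Y :\: X) K' _ _ _ _ w c) => //.
- split=> [v v' [Kv Xv v0] [Kv' Xv' v0'] | a v [Kv Xv v0] | x y v].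
  + split=> [|p q pX qX pq | z zYX]; first exact: KD.
      by rewrite pactD Xv // Xv' // scalerDr.
    by rewrite enlargeD v0 // v0' // addr0.
  + split=> [|p q pX qX pq | z zYX]; first exact: KZ.
      by rewrite pactZ Xv // !scalerA mulrC.
    by rewrite enlargeZ v0 // scaler0.
  move=> /setDP[xY xX] /setDP[yY yX] [Kv Xv v0].
  split; [exact: KT | exact: set_sym_pact |] => z zYX.
  rewrite -[z](tpermK x y) -enlarge_pact // v0 ?pact0 //.
  by case: tpermP => // _; rewrite inE ?xX ?yX.
- move=> Z v ZYX Zm [Kv Xv v0] Zv.
  have ZY := subset_trans ZYX (subsetDl _ _).
  apply: (enlarge_both0 (e := false) (X := X) (Z := Z)).
  + by rewrite Zm addnS.
  + by move=> z /(subsetP ZYX); apply: v0.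
  move=> x xX; have xZ : x \notin Z.
    by apply: contraL xX => /(subsetP ZYX); rewrite inE => /andP[].
  apply: (Hanti (x |: Z)); last exact: enlarge_sym.
  + by rewrite subUset sub1set ZY (subsetP XY).
  + by rewrite cardsU1 xZ Zm.
  by apply: (enlarge_stable _ HK) => //; apply: (subsetP XY).
- move=> Z v ZYX Zn [Kv _ _]; apply: Hsym => //.
  exact: subset_trans ZYX (subsetDl _ _).
- by rewrite cardsD (setIidPr XY); move: Xn Ysize; lia.
- move=> y /setDP[yY yX]; have := cmn y yY; rewrite /hook_colour.
  move: yX; rewrite inE yY /=; case: (c y) => [[] l] //=.
  by rewrite xpair_eqE /= ltnS [(l <= m)%N]leq_eqVlt => /negPf->.
by move=> x y /setDP[xY _] /setDP[yY _]; apply: cw.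
Qed.

End GroupAlgebra.

(** * Linear relations between signed permutations *)

(** A function invariant under the transpositions preserving [c] is invariant
    under all permutations preserving [c], as they move one point at a time to
    its place. *)
Lemma tperm_invariant (T : finType) (C : eqType) (c : T -> C) (V : Type)
    (g : {perm T} -> V) :
  (forall x y s, x != y -> c x = c y -> g (tperm x y * s)%g = g s) ->
  forall t s : {perm T}, (forall x, c (t x) = c x) -> g (t * s)%g = g s.
Proof.
move=> gt t; move: {2}#|[set x | t x != x]| (leqnn #|[set x | t x != x]|) => d.
elim: d t => [|d IHd] t.
  rewrite leqn0 cards_eq0 => /eqP t1 s _; congr g.
  suff -> : t = 1%g by rewrite mul1g.
  apply/permP => x; rewrite perm1; apply/eqP.
  by have := in_set0 x; rewrite -t1 inE => /negbFE.
move=> td s ct; have [t1|] := eqVneq [set x | t x != x] set0.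
  by apply: IHd => //; rewrite t1 cards0.
case/set0Pn => x; rewrite inE => tx.
rewrite -[t](mulgK (tperm x (t x))) tpermV -mulgA IHd.
- by apply: gt; rewrite 1?eq_sym // ct.
- rewrite -ltnS; apply: leq_trans td; apply: proper_card; apply/properP; split.
    apply/subsetP => y; rewrite !inE permM; apply: contraNneq => ty.
    rewrite ty tpermD //; first by apply: contraNneq tx => ->; rewrite ty.
    by apply: contraNneq tx => txy; rewrite -(inj_eq (@perm_inj _ t)) txy ty.
  by exists x; rewrite !inE ?permM ?tpermR ?eqxx.
move=> y; rewrite permM; case: tpermP => [ty | ty | _ _]; last exact: ct.
  by rewrite ct -ty ct.
by move/perm_inj: ty => ->.
Qed.

Lemma perm_on_mulr (T : finType) (Y : {set T}) (s t : {perm T}) :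
  perm_on Y t -> perm_on Y (s * t)%g = perm_on Y s.
Proof.
move=> Yt; apply/idP/idP => Ys; last exact: perm_onM.
by rewrite -[s](mulgK t) perm_onM // perm_onV.
Qed.

Lemma perm_on_mull (T : finType) (Y : {set T}) (s t : {perm T}) :
  perm_on Y t -> perm_on Y (t * s)%g = perm_on Y s.
Proof.
move=> Yt; apply/idP/idP => Ys; last exact: perm_onM.
by rewrite -[s](mulKg t) perm_onM // perm_onV.
Qed.

Lemma perm_on_tperm (T : finType) (Y : {set T}) (x y : T) :
  x \in Y -> y \in Y -> perm_on Y (tperm x y).
Proof.
move=> xY yY; apply/subsetP => z; rewrite inE; case: tpermP => [->|->|] //.
by rewrite eqxx.
Qed.

(** The elements [w * y] of the group algebra, [y] being a Young symmetrizer: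
    what is antisymmetric over the columns is symmetrised over the rows. *)
Section YoungModule.
Variables (F : numFieldType) (T : finType) (C : eqType) (Y : {set T}).
Variables (row col : T -> C).

Let gr := gring F T.
Implicit Types (u w : gr) (s t : {perm T}).

Definition row_perm s := [forall x, row (s x) == row x].

Definition young_module u : Prop := exists w,
  [/\ forall s, ~~ perm_on Y s -> w s = 0,
      forall s x y, x != y -> col x = col y -> w (s * tperm x y)%g = - w s
    & forall s, u s = \sum_(t | row_perm t) w (s * t)%g].

Hypothesis row_on : forall s, row_perm s -> perm_on Y s.

Lemma young_module_supp u s : young_module u -> ~~ perm_on Y s -> u s = 0.
Proof.
case=> w [w0 _ ->] Ys; apply: big1 => t /row_on Yt; apply: w0.
by rewrite perm_on_mulr.
Qed.

Lemma young_moduleD u v : young_module u -> young_module v -> young_module (u + v).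
Proof.
case=> [w [w0 wc wr]] [w' [w0' wc' wr']]; exists (w + w'); split.
- by move=> s Ys; rewrite ffunE w0 // w0' // addr0.
- by move=> s x y xy cxy; rewrite !ffunE wc // wc' // opprD.
by move=> s; rewrite ffunE wr wr' -big_split; apply: eq_bigr => t _; rewrite ffunE.
Qed.

Lemma young_moduleZ a u : young_module u -> young_module (a *: u).
Proof.
case=> [w [w0 wc wr]]; exists (a *: w); split.
- by move=> s Ys; rewrite ffunE w0 // scaler0.
- by move=> s x y xy cxy; rewrite !ffunE wc // scalerN.
by move=> s; rewrite ffunE wr scaler_sumr; apply: eq_bigr => t _; rewrite ffunE.
Qed.

Lemma young_module_pact s u :
  perm_on Y s -> young_module u -> young_module (pact s u).
Proof.
move=> Ys [w [w0 wc wr]]; exists (pact s w); split.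
- by move=> t Yt; rewrite ffunE w0 // perm_on_mull.
- by move=> t x y xy cxy; rewrite !ffunE mulgA wc.
by move=> t; rewrite ffunE wr; apply: eq_bigr => r _; rewrite ffunE mulgA.
Qed.

Lemma young_module_stable : transp_stable Y young_module.
Proof.
split=> [u v | a u | x y u xY yY]; [exact: young_moduleD | exact: young_moduleZ |].
by apply: young_module_pact; apply: perm_on_tperm.
Qed.

Lemma young_module_row u s x y : young_module u -> row x = row y ->
  u (s * tperm x y)%g = u s.
Proof.
case=> w [_ _ wr] rxy; rewrite !wr.
rewrite (reindex_inj (mulgI (tperm x y))) /=; apply: eq_big => t.
  apply/forallP/forallP => H z; have := H (tperm x y z); rewrite ?permM ?tpermK.
    by move=> /eqP->; case: tpermP => [->|->|]; rewrite ?rxy.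
  by move=> /eqP->; case: tpermP => [->|->|]; rewrite ?rxy.
by move=> _; rewrite mulgA -[(s * _ * _)%g]mulgA tperm2 mulg1.
Qed.

Variables (nrows ncols : nat) (rown coln : T -> nat).
Hypothesis rown_lt : {in Y, forall x, (rown x < nrows)%N}.
Hypothesis coln_lt : {in Y, forall x, (coln x < ncols)%N}.
Hypothesis rownP : {in Y &, forall x y, rown x = rown y -> row x = row y}.
Hypothesis colnP : {in Y &, forall x y, coln x = coln y -> col x = col y}.

(** Two points of a large set are sent to the same row. *)
Lemma young_module_antisym (Z : {set T}) u : Z \subset Y -> (nrows < #|Z|)%N ->
  young_module u -> set_sym true Z u -> u = 0.
Proof.
move=> /subsetP ZY Zn Hu Zu; apply/ffunP => s; rewrite [RHS]ffunE.
have [Ys|nYs] := boolP (perm_on Y s); last exact: young_module_supp.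
have sY x : x \in Z -> s x \in Y by move/ZY; rewrite perm_closed.
have [inj|] := boolP [forall x in Z, forall y in Z,
    (rown (s x) == rown (s y)) ==> (x == y)].
  suff : (#|Z| <= nrows)%N by rewrite leqNgt Zn.
  apply: (leq_card_bound (g := fun x => rown (s x))) => [x /sY /rown_lt // |].
  move=> x y xZ yZ /eqP exy; apply/eqP.
  by move/forall_inP: inj => /(_ x xZ)/forall_inP/(_ y yZ)/implyP; apply.
case/forall_inPn => x xZ /forall_inPn[y yZ]; rewrite negb_imply => /andP[/eqP exy xy].
have : (pact (tperm x y) u) s = - u s by rewrite Zu // scaleN1r ffunE.
rewrite ffunE conjgC tpermJ young_module_row //; last by apply: rownP; rewrite ?sY.
by move/eqP; rewrite -subr_eq0 opprK -mulr2n mulrn_eq0 => /eqP.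
Qed.

(** Two points of a large set are sent to the same column; since symmetrising
    over the rows comes after, the sum over all the permutations of the set has
    to be taken. *)
Lemma young_module_sym (Z : {set T}) u : Z \subset Y -> (ncols < #|Z|)%N ->
  young_module u -> set_sym false Z u -> u = 0.
Proof.
move=> /subsetP ZY Zn Hu Zu; apply/ffunP => s; rewrite [RHS]ffunE.
have [Ys|nYs] := boolP (perm_on Y s); last exact: young_module_supp.
have Hsum : \sum_(t | perm_on Z t) u (t * s)%g = u s *+ #|[pred t | perm_on Z t]|.
  rewrite -sumr_const; apply: eq_big => // t Zt.
  pose c x := if x \in Z then None else Some x.
  have cZ x y : x != y -> c x = c y -> (x \in Z) && (y \in Z).
    rewrite /c; case: ifP => _; case: ifP => // _ xy [] exy.
    by rewrite exy eqxx in xy.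
  apply: (tperm_invariant (c := c)) => [x y r xy /cZ|x].
    move=> /(_ xy)/andP[xZ yZ].
    have : (pact (tperm x y) u) r = u r by rewrite Zu // scale1r.
    by rewrite ffunE.
  rewrite /c (perm_closed _ Zt); case: ifPn => // xZ.
  by rewrite (out_perm Zt).
have [w [w0 wc wr]] := Hu.
suff : u s *+ #|[pred t | perm_on Z t]| = 0.
  move/eqP; rewrite mulrn_eq0 => /orP[|/eqP //]; rewrite -leqn0 leqNgt.
  by case/negP; apply/card_gt0P; exists 1%g; rewrite inE perm_on1.
rewrite -Hsum (eq_bigr _ (fun t _ => wr _)) exchange_big big1 //= => r Rr.
have {Rr}/row_on Yr := Rr; pose s' := (s * r)%g.
have Ys' : perm_on Y s' by rewrite perm_onM.
have sY x : x \in Z -> s' x \in Y by move/ZY; rewrite perm_closed.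
have [inj|] := boolP [forall x in Z, forall y in Z,
    (coln (s' x) == coln (s' y)) ==> (x == y)].
  suff : (#|Z| <= ncols)%N by rewrite leqNgt Zn.
  apply: (leq_card_bound (g := fun x => coln (s' x))) => [x /sY /coln_lt // |].
  move=> x y xZ yZ /eqP exy; apply/eqP.
  by move/forall_inP: inj => /(_ x xZ)/forall_inP/(_ y yZ)/implyP; apply.
case/forall_inPn => x xZ /forall_inPn[y yZ]; rewrite negb_imply => /andP[/eqP exy xy].
set S := \sum_(t | _) _; suff : S = - S.
  by move/eqP; rewrite -subr_eq0 opprK -mulr2n mulrn_eq0 => /eqP.
rewrite {1}/S (reindex_inj (mulIg (tperm x y))) /= -sumrN.
apply: eq_big => t; first by rewrite perm_on_mulr // perm_on_tperm.
move=> _; rewrite -!mulgA -/s' [(tperm x y * s')%g]conjgC tpermJ mulgA wc //.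
  by rewrite (inj_eq perm_inj).
by apply: colnP; rewrite ?sY.
Qed.

(** The Young symmetrizer itself, whose coefficient at 1 is 1. *)
Lemma young_module_nz :
  (forall s, [forall x, col (s x) == col x] -> perm_on Y s) ->
  (forall s, row_perm s -> [forall x, col (s x) == col x] -> s = 1%g) ->
  exists2 u, young_module u & u != 0.
Proof.
move=> col_on row_col; pose colp s := [forall x, col (s x) == col x].
pose w : gr := [ffun s => if colp s then (-1) ^+ odd_perm s else 0].
pose u : gr := [ffun s => \sum_(t | row_perm t) w (s * t)%g].
exists u.
  exists w; split=> [s | s x y xy cxy | s]; last by rewrite ffunE.
    by rewrite ffunE; case: ifP => // /col_on->.
  rewrite !ffunE odd_permM odd_tperm xy addbT signrN.
  have -> : colp (s * tperm x y)%g = colp s.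
    apply: eq_forallb => z; rewrite permM.
    by case: tpermP => [->|->|] //; rewrite cxy.
  by case: ifP; rewrite ?oppr0.
apply/eqP => /ffunP/(_ 1%g); rewrite !ffunE (bigD1 1%g) /=; last first.
  by apply/forallP => x; rewrite perm1.
rewrite mul1g ffunE ifT ?odd_perm1; last by apply/forallP => x; rewrite perm1.
rewrite big1 ?addr0 => [|s /andP[/row_col rs s1]].
  by move/eqP; rewrite oner_eq0.
by rewrite mul1g ffunE; case: ifP => // /rs s1'; rewrite s1' eqxx in s1.
Qed.

End YoungModule.

Section ColourRelations.
Variables (F : numFieldType) (m n k : nat).
Let T := 'I_k.
Let C := 'I_(m + n).
Implicit Types (a b : T -> C) (s t : {perm T}) (u : gring F T).

Definition signed_perm s a b : F :=
  perm_kernel F (@nat_of_ord k) (@parity m n) s a b.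

Lemma signed_permM s t a b :
  signed_perm (t * s) a b
  = (-1) ^+ inv_parity (@nat_of_ord k) (fun x => parity (a x)) t
    * signed_perm s (fun x => a (t^-1%g x)) b.
Proof. exact: (perm_kernelM _ _ (@ord_inj k)). Qed.

Lemma signed_perm_tperm s a b x y : x != y -> a x = a y ->
  signed_perm (tperm x y * s) a b = (-1) ^+ parity (a x) * signed_perm s a b.
Proof. exact: (perm_kernel_tperm _ _ (@ord_inj k)). Qed.

Lemma signed_perm_neq0 s a b : (signed_perm s a b != 0) = [forall x, b (s x) == a x].
Proof. exact: perm_kernel_neq0. Qed.

Definition perm_relation u := forall a b, \sum_s u s * signed_perm s a b = 0.

Lemma perm_relation_stable : transp_stable [set: T] perm_relation.
Proof.
split=> [u v Ku Kv a b | c u Ku a b | x y u _ _ Ku a b].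
- under eq_bigr => s _ do rewrite ffunE mulrDl.
  by rewrite big_split /= Ku Kv addr0.
- under eq_bigr => s _ do rewrite ffunE -mulrA.
  by rewrite -mulr_sumr Ku mulr0.
rewrite (reindex_inj (mulgI (tperm x y))) /=.
under eq_bigr => s _ do rewrite ffunE mulgA tperm2 mul1g signed_permM mulrCA.
by rewrite -mulr_sumr [X in _ * X]Ku mulr0.
Qed.

(** By [hook_colouring] a nonzero relation could be replaced by one that is
    symmetric for a colouring [a].  Then all the nonzero terms of its value at [a]
    and a suitable permutation of [a] are equal. *)
Lemma perm_relation0 : (k < m.+1 * n.+1)%N ->
  forall u, perm_relation u -> u = 0.
Proof.
move=> kmn u Ku; apply/eqP; apply: contraT => u0.
have [||w [c [Kw w0 cmn cw]]] := hook_colouring perm_relation_stable (m := m) (n := n).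
- by exists u.
- by rewrite cardsT card_ord.
have /fin_all_exists[a aP] (x : T) : exists i : C,
    parity i = (c x).1 /\ nat_of_ord i = ((if (c x).1 then m else 0) + (c x).2)%N.
  have := cmn x (in_setT x); rewrite /hook_colour; case: (c x) => -[] l /= ln.
    by exists (rshift m (Ordinal ln)); rewrite /parity /= leq_addr.
  by exists (lshift n (Ordinal ln)); rewrite /parity /= leqNgt ln.
have ac x y : a x = a y -> c x = c y.
  move=> axy; have [px ex] := aP x; have [py ey] := aP y.
  move: ex ey; rewrite -px -py axy => -> /addnI.
  by move: px py; rewrite axy; case: (c x) (c y) => [? ?] [? ?] /= <- <- ->.
have /existsP[s0 ws0] : [exists s, w s != 0].
  apply: contraNT w0 => /existsPn w0; apply/eqP/ffunP => s; rewrite ffunE.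
  by apply/eqP; rewrite -[_ == _]negbK w0.
pose b x := a (s0^-1%g x).
pose G s := w s * signed_perm s a b.
have Gt x y s : x != y -> a x = a y -> G (tperm x y * s)%g = G s.
  move=> xy axy; rewrite /G signed_perm_tperm //.
  have : pact (tperm x y) w s = (-1) ^+ parity (a x) * w s.
    by rewrite cw ?inE //; [rewrite !ffunE (aP x).1 | exact: ac].
  by rewrite ffunE => ->; rewrite mulrACA -expr2 sqrr_sign mul1r.
have Gs0 : G s0 != 0.
  rewrite mulf_neq0 // perm_kernel_neq0.
  by apply/forallP => x; rewrite /b permK.
have Gconst s : G s != 0 -> G s = G s0.
  rewrite /G mulf_eq0 negb_or perm_kernel_neq0 => /andP[_ /forallP ab].
  rewrite -[s](mulgKV s0) -/(G _); apply: (tperm_invariant (c := a)) => // x.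
  by rewrite permM; apply: (eqP (ab x)).
have : \sum_s G s = G s0 *+ #|[pred s | G s != 0]|.
  rewrite -sumr_const [LHS](bigID (fun s => G s != 0)) /= [X in _ + X]big1 ?addr0.
    by apply: eq_bigr => s; apply: Gconst.
  by move=> s /negPn/eqP.
rewrite [LHS]Kw => /esym/eqP; rewrite mulrn_eq0 (negPf Gs0) orbF.
by move=> /eqP/card0_eq/(_ s0); rewrite !inE Gs0.
Qed.

(** The relation is the Young symmetrizer of a rectangle with [m.+1] rows and
    [n.+1] columns.  In its module no vector is symmetric on [n.+2] points or
    antisymmetric on [m.+2] points, so by [no_hook_colouring] the sum over the
    permutations preserving a colouring vanishes. *)
Lemma perm_relation_nz : (m.+1 * n.+1 <= k)%N ->
  exists2 u, perm_relation u & u != 0.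
Proof.
move=> kmn; pose N := (m.+1 * n.+1)%N.
pose Y := [set x : T | (x < N)%N].
(* the points outside the rectangle are alone in their row and column *)
pose row (x : T) : bool * nat :=
  if (x < N)%N then (true, x %/ n.+1)%N else (false, nat_of_ord x).
pose col (x : T) : bool * nat :=
  if (x < N)%N then (true, x %% n.+1)%N else (false, nat_of_ord x).
have onY (g : T -> bool * nat) : (forall x, x \notin Y -> g x = (false, nat_of_ord x)) ->
    (forall x, x \in Y -> (g x).1) -> forall s, [forall x, g (s x) == g x] -> perm_on Y s.
  move=> gN gY s /forallP gs; apply/subsetP => x; rewrite inE; apply: contraNT => xY.
  have := gs x; rewrite (gN x xY); have [/gY|/gN->] := boolP (s x \in Y).
    by case: (g (s x)) => ? ? /= ->.
  by rewrite xpair_eqE.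
have row_on s : row_perm row s -> perm_on Y s.
  by apply: onY => x; rewrite inE /row; case: ifP.
have col_on s : [forall x, col (s x) == col x] -> perm_on Y s.
  by apply: onY => x; rewrite inE /col; case: ifP.
have inY x : x \in Y -> (x < N)%N by rewrite inE.
have rowP : {in Y &, forall x y : T, (x %/ n.+1 = y %/ n.+1)%N -> row x = row y}.
  by move=> x y /inY xN /inY yN; rewrite /row xN yN => ->.
have colP : {in Y &, forall x y : T, (x %% n.+1 = y %% n.+1)%N -> col x = col y}.
  by move=> x y /inY xN /inY yN; rewrite /col xN yN => ->.
have rowlt : {in Y, forall x : T, (x %/ n.+1 < m.+1)%N}.
  by move=> x /inY; rewrite ltn_divLR.
have collt : {in Y, forall x : T, (x %% n.+1 < n.+1)%N} by move=> x _; rewrite ltn_mod.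
have [||u Ku u0] := young_module_nz F (Y := Y) (row := row) (col := col).
- exact: col_on.
- move=> s sr sc; apply/permP => x; rewrite perm1; apply/val_inj => /=.
  move/forallP/(_ x): sr; move/forallP/(_ x): sc; rewrite /row /col.
  case: ifP => _; case: ifP => _; rewrite !xpair_eqE //= => /eqP ec /eqP er.
    by rewrite (divn_eq (s x) n.+1) er ec -divn_eq.
  exact: er.
exists u => // a b.
pose stab t := perm_on Y t && [forall x, a (t x) == a x].
pose sg t : F := (-1) ^+ inv_parity (@nat_of_ord k) (fun x => parity (a x)) t.
have stabV t : stab t -> forall x, a (t^-1%g x) = a x.
  by case/andP=> _ /forallP H x; rewrite -(eqP (H _)) permKV.
have K0 : young_module (F := F) Y row col 0.
  by rewrite -(scale0r u); apply: young_moduleZ.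
pose S := \sum_(t | stab t) sg t *: pact t u.
have KS : young_module Y row col S.
  apply: (big_ind (young_module (F := F) Y row col)) => // [v v'| t /andP[Yt _]].
    exact: young_moduleD.
  by apply: young_moduleZ; apply: young_module_pact.
have S0 : S = 0.
  pose c x : bool * nat := (parity (a x), if parity (a x) then a x - m else a x)%N.
  have ca x y : c x = c y -> a x = a y.
    case=> pxy; rewrite pxy; case: ifP => // py exy; apply: val_inj.
      by rewrite /= -(subnK (m := m) (n := a x)) ?exy ?subnK // -/(parity _) pxy.
    exact: exy.
  apply: (no_hook_colouring (m := m) (n := n)
           (young_module_stable F Y row col) _ _ _ KS (c := c))
    => [Z v ZY Zm|Z v ZY Zn| |x _|].
  - by apply: (young_module_antisym row_on rowlt rowP) => //; rewrite Zm.
  - by apply: (young_module_sym row_on collt colP) => //; rewrite Zn.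
  - rewrite (_ : #|Y| = N) // -sum1_card (eq_bigl (fun x : T => (x < N)%N)).
      by rewrite -(big_ord_widen k (fun=> 1%N)) // sum1_card card_ord.
    by move=> x; rewrite inE.
  - rewrite /hook_colour /c /=; have := ltn_ord (a x).
    by rewrite /parity; case: (leqP m (a x)) => // ma; rewrite ltn_subLR.
  move=> x y xY yY xy /ca axy; rewrite /S pact_sum scaler_sumr.
  rewrite (reindex_inj (mulIg (tperm x y))) /=; apply: eq_big => t.
    rewrite /stab perm_on_mulr ?perm_on_tperm //; congr andb.
    by apply: eq_forallb => z; rewrite permM; case: tpermP => // ->; rewrite axy.
  move=> st; have {}st : stab t.
    move: st; rewrite /stab perm_on_mulr ?perm_on_tperm //.
    case: (perm_on Y t) => //= /forallP H; apply/forallP => z; have := H z.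
    by rewrite permM; case: tpermP => // ->; rewrite axy.
  rewrite pactZ pactM -mulgA tperm2 mulg1 scalerA; congr (_ *: _).
  rewrite /sg inv_parityM; last exact: ord_inj.
  rewrite signr_addb mulrC; congr (_ * _ ^+ _).
  by rewrite (inv_parity_tperm (@ord_inj k) xy) !stabV // axy.
have [/existsP[s0 /andP[Ys0 /forallP ab]]|/existsPn noS] :=
    boolP [exists s, perm_on Y s && [forall x, b (s x) == a x]]; last first.
  apply: big1 => s _; apply/eqP; rewrite mulf_eq0; have := noS s; rewrite negb_and.
  case/orP => [/(young_module_supp row_on Ku)-> | ]; first by rewrite eqxx.
  by rewrite -signed_perm_neq0 negbK => ->; rewrite orbT.
have {}ab x : b x = a (s0^-1%g x) by rewrite -(eqP (ab _)) permKV.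
transitivity (S s0 * signed_perm s0 a b); last by rewrite S0 ffunE mul0r.
rewrite (reindex_inj (mulIg s0)) /= (bigID stab) /= [X in _ + X]big1 ?addr0; last first.
  move=> t; rewrite negb_and; have [Yt|Yt _] := boolP (perm_on Y t); last first.
    by rewrite (young_module_supp row_on Ku) ?mul0r // perm_on_mulr.
  case/forallPn => x tx; apply/eqP; rewrite mulf_eq0 -[X in _ || X]negbK.
  rewrite signed_perm_neq0; apply/orP; right; apply/forallPn; exists x.
  by rewrite permM ab permK.
rewrite /S sum_ffunE mulr_suml; apply: eq_bigr => t st.
rewrite !ffunE signed_permM.
rewrite -/(sg t) mulrCA mulrA; congr (_ * _).
by apply: eq_perm_kernel => // x; rewrite stabV.
Qed.

End ColourRelations.

(** * Operators on the tensor space and the double centraliser *)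

(** Each pair that counts contains [p], so it is determined by its other point. *)
Lemma pair_parity_star (X : finType) (f : X -> nat) (h : X -> X -> bool) p :
  injective f -> (forall x y, h x y = h y x) -> h p p = false ->
  (forall x y, x != p -> y != p -> h x y = false) ->
  pair_parity f h = \big[addb/false]_x h p x.
Proof.
move=> fi hC hp h0; rewrite /pair_parity.
rewrite -(pair_big_dep predT (fun x y => f x < f y)%N) /= (bigD1 p) //=.
rewrite [RHS](bigID (fun x => f p < f x)%N) /=; congr addb.
rewrite [RHS](bigID (fun x => x != p)) /= [X in _ (+) X]big1 ?addbF; last first.
  by move=> x /andP[_ /negPn/eqP->].
rewrite [LHS](bigID (fun x => f x < f p)%N) /= [X in _ (+) X]big1 ?addbF.
  apply: eq_big => [x | x /andP[xp xfp]].
    rewrite -leqNgt [in RHS]leq_eqVlt (inj_eq fi).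
    by case: eqVneq => _; rewrite ?andbF ?andbT.
  rewrite (bigD1 p) //= big1 ?addbF; first exact: hC.
  by move=> y /andP[_ yp]; apply: h0.
move=> x /andP[xp xfp]; apply: big1 => y xy; apply: h0 => //.
by apply: contraNneq xfp => <-.
Qed.

(** Selecting or not the point [p] changes the parity of the inversions by the
    parity of the selected points exchanged with [p]. *)
Lemma inv_parity_flip (X : finType) (f : X -> nat) (o o' : X -> bool) (s : {perm X}) p :
  injective f -> (forall x, x != p -> o' x = o x) -> o' p = ~~ o p ->
  inv_parity f o' s = inv_parity f o s (+)
    \big[addb/false]_(x | x != p) (o x && ((f x < f p)%N (+) (f (s x) < f (s p))%N)).
Proof.
move=> fi oo op; pose dis x y := (f y < f x)%N (+) (f (s y) < f (s x))%N.
have disC x y : dis x y = dis y x.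
  rewrite /dis; case: (eqVneq x y) => [-> // | xy].
  have sxy : s x != s y by rewrite (inj_eq perm_inj).
  have := inj_eq fi x y; have := inj_eq fi (s x) (s y).
  by rewrite (negPf xy) (negPf sxy); case: (ltngtP (f x)); case: (ltngtP (f (s x))).
have disE q : inv_parity f q s = pair_parity f (fun x y => [&& q x, q y & dis x y]).
  apply: eq_pair_parity => x y xy.
  by rewrite /dis [(f y < f x)%N]ltnNge (ltnW xy) addFb.
rewrite !disE.
apply: (can_inj (addKb (pair_parity f (fun x y => [&& o x, o y & dis x y])))).
rewrite addKb -pair_parityD.
rewrite (@pair_parity_star _ _ _ p fi) => [|x y||x y xp yp].
- rewrite (bigD1 p) //= /dis !ltnn !andbF addFb; apply: eq_bigr => x xp.
  by rewrite (oo x xp) op; case: (o p); case: (o x); rewrite //= ?addbF.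
- by rewrite disC !andbA [o y && _]andbC [o' y && _]andbC.
- by rewrite /dis !ltnn !andbF.
by rewrite !oo // addbb.
Qed.

Section FreeSpaceTheory.
Variables (F : fieldType) (I : finType).

Lemma ffun_basis (u : {ffun I -> F^o}) : u = \sum_i u i *: basis_vec F i.
Proof.
apply/ffunP => j; rewrite sum_ffunE (bigD1 j) //= !ffunE eqxx big1 => [|i ij].
  by rewrite addr0 [RHS]mulr1.
by rewrite !ffunE eq_sym (negPf ij) [LHS]mulr0.
Qed.

Lemma basis_ext (U : vectType F) (f g : 'Hom({ffun I -> F^o}, U)) :
  (forall i, f (basis_vec F i) = g (basis_vec F i)) -> f =1 g.
Proof.
move=> fg u; rewrite [u]ffun_basis !linear_sum; apply: eq_bigr => i _.
by rewrite !linearZ /= fg.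
Qed.

End FreeSpaceTheory.

Section TensorOperators.
Variables (F : numFieldType) (m n k : nat).
Local Notation C := 'I_(m + n).
Local Notation par := (@parity m n).
Local Notation col := {ffun 'I_k -> C}.
Local Notation tens := {ffun col -> F^o}.
Local Notation e_ := (basis_vec F).
Implicit Types (a b c : col) (s t : {perm 'I_k}) (u v : C * C) (p q : 'I_k).
Implicit Types (w : tens).

Definition inv_col a s := inv_parity (@nat_of_ord k) (fun x => par (a x)) s.

Definition move_col a s : col := [ffun x => a (s^-1%g x)].

Definition rho s : 'End(tens) :=
  lin_ext (fun a => (-1) ^+ inv_col a s *: e_ (move_col a s)).

Lemma rho_basis s a : rho s (e_ a) = (-1) ^+ inv_col a s *: e_ (move_col a s).
Proof. exact: lin_ext_basis. Qed.

Lemma rhoM s t w : rho (t * s)%g w = rho s (rho t w).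
Proof.
rewrite -comp_lfunE; move: w; apply: basis_ext => a.
rewrite comp_lfunE !rho_basis linearZ /= rho_basis scalerA -signr_addb.
congr (_ ^+ _ *: e_ _).
  rewrite /inv_col inv_parityM; last exact: ord_inj.
  by congr addb; apply: eq_inv_parity => x; rewrite ffunE.
by apply/ffunP => x; rewrite !ffunE invMg permM.
Qed.

Lemma rho1 w : rho 1%g w = w.
Proof.
rewrite -[RHS]id_lfunE; move: w; apply: basis_ext => a.
rewrite rho_basis id_lfunE /inv_col inv_parity1 expr0 scale1r.
by congr e_; apply/ffunP => x; rewrite ffunE invg1 perm1.
Qed.

Lemma rho_coef s a b : rho s (e_ a) b = signed_perm F s a b.
Proof.
rewrite rho_basis !ffunE /signed_perm /perm_kernel; case: ifPn => [/forallP ab|].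
  rewrite (_ : b == _) ?[LHS]mulr1 //; apply/eqP/ffunP => x; rewrite ffunE.
  by rewrite -[x in LHS](permKV s) (eqP (ab _)).
rewrite -[_ == _]negbK => /forallPn[x bx].
case: eqP => [bE | _]; last by rewrite [LHS]mulr0.
by move: bx; rewrite bE ffunE permK eqxx.
Qed.

Definition set_col a p i : col := [ffun x => if x == p then i else a x].

(** Parity of the colours passed by an operator acting on the factor [p]. *)
Definition string a p := \big[addb/false]_(q : 'I_k | (q < p)%N) par (a q).

Definition unit_parity u := par u.1 (+) par u.2.

(** The matrix unit [u] acting on the tensor factor [p], with its sign rule. *)
Definition unit_op u p : 'End(tens) :=
  lin_ext (fun a => if a p == u.2
    then (-1) ^+ (unit_parity u && string a p) *: e_ (set_col a p u.1) else 0).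

Lemma unit_op_basis u p a : unit_op u p (e_ a) = if a p == u.2
  then (-1) ^+ (unit_parity u && string a p) *: e_ (set_col a p u.1) else 0.
Proof. exact: lin_ext_basis. Qed.

Lemma string_set a p q i :
  string (set_col a q i) p = string a p (+) ((q < p)%N && (par i (+) par (a q))).
Proof.
rewrite /string; have [qp|qp] := ltnP q p; last first.
  rewrite addbF; apply: eq_bigr => x xp; rewrite ffunE; case: eqP => // xq.
  by move: xp; rewrite xq ltnNge qp.
rewrite (bigD1 q) //= [in RHS](bigD1 q) //= ffunE eqxx.
rewrite (eq_bigr (fun x : 'I_k => par (a x))) => [|x /andP[_ /negPf xq]].
  by case: (par i); case: (par (a q)); case: (\big[_/_]_(_ | _) _).
by rewrite ffunE xq.
Qed.

Lemma unit_op_same u v p w :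
  unit_op u p (unit_op v p w) = if u.2 == v.1 then unit_op (u.1, v.2) p w else 0.
Proof.
suff : (unit_op u p \o unit_op v p)%VF =1
       (if u.2 == v.1 then unit_op (u.1, v.2) p else 0%VF).
  by move=> /(_ w); rewrite comp_lfunE => ->; case: ifP; rewrite ?zero_lfunE.
apply: basis_ext => a; rewrite comp_lfunE unit_op_basis.
case: eqP => [ap|ap]; last first.
  rewrite linear0; case: ifP => _; rewrite ?zero_lfunE // unit_op_basis /=.
  by case: eqP.
rewrite linearZ /= unit_op_basis ffunE eqxx eq_sym.
case: eqP => [uv|]; last by rewrite scaler0 zero_lfunE.
rewrite unit_op_basis /= ap eqxx scalerA -signr_addb string_set ltnn addbF.
congr (_ ^+ _ *: e_ _); last by apply/ffunP => x; rewrite !ffunE; case: eqP.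
rewrite /unit_parity /= uv; case: (string a p); rewrite ?andbF ?andbT //.
by case: (par u.1); case: (par v.1); case: (par v.2).
Qed.

Lemma unit_op_comm u v p q w : p != q ->
  unit_op u p (unit_op v q w)
  = (-1) ^+ (unit_parity u && unit_parity v) *: unit_op v q (unit_op u p w).
Proof.
move=> pq; have qpF : (q == p) = false by rewrite eq_sym (negPf pq).
suff : (unit_op u p \o unit_op v q)%VF =1
  ((-1) ^+ (unit_parity u && unit_parity v) *: (unit_op v q \o unit_op u p))%VF.
  by move=> /(_ w); rewrite scale_lfunE !comp_lfunE.
apply: basis_ext => a; rewrite scale_lfunE !comp_lfunE !unit_op_basis.
case: eqP => [aq|aq]; case: eqP => [ap|ap]; rewrite ?linear0 ?scaler0 //.
- rewrite !linearZ /= !unit_op_basis !ffunE qpF (negPf pq) ap aq !eqxx.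
  rewrite !scalerA -!signr_addb; congr (_ ^+ _ *: e_ _); last first.
    apply/ffunP => x; rewrite !ffunE; case: eqP => [->|] //.
    by rewrite (negPf pq).
  rewrite !string_set ap aq -!/(unit_parity _).
  have := inj_eq val_inj p q; rewrite (negPf pq) /=.
  case: (unit_parity u); case: (unit_parity v); rewrite ?andbF ?andbT ?addbF //=.
  by case: ltngtP => //= _; case: (string a p); case: (string a q).
- rewrite linearZ /= unit_op_basis ffunE (negPf pq).
  by case: eqP ap => //; rewrite !scaler0.
rewrite linearZ /= unit_op_basis ffunE qpF.
by case: eqP aq => //; rewrite !scaler0.
Qed.

(** Both strings in the signs are sums over the odd factors [x] other than [p];
    they differ for those exchanged with [p] by [s]. *)
Lemma rho_unit_op s u p w : rho s (unit_op u p w) = unit_op u (s p) (rho s w).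
Proof.
rewrite -!comp_lfunE; move: w; apply: basis_ext => a.
rewrite !comp_lfunE unit_op_basis rho_basis linearZ /= unit_op_basis ffunE permK.
case: eqP => [ap|_]; last by rewrite linear0 scaler0.
rewrite linearZ /= rho_basis !scalerA -!signr_addb; congr (_ ^+ _ *: e_ _); last first.
  by apply/ffunP => x; rewrite !ffunE (can2_eq (permKV s) (permK s)).
have Hstr : string (move_col a s) (s p) (+) string a p
   = \big[addb/false]_(x | x != p) (par (a x) && ((x < p)%N (+) (s x < s p)%N)).
  transitivity (\big[addb/false]_x (par (a x) && ((x < p)%N (+) (s x < s p)%N))).
    rewrite [string (move_col _ _) _]big_mkcond [string a p]big_mkcond /=.
    rewrite [X in X (+) _](reindex_inj (@perm_inj _ s)) -big_split /=.
    apply: eq_bigr => x _; rewrite ffunE permK.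
    by case: ifP; case: ifP; case: (par _).
  by rewrite (bigD1 p) //= !ltnn andbF.
have [up|up] := boolP (unit_parity u); last first.
  rewrite !andFb addFb addbF; congr nat_of_bool; apply: eq_inv_parity => x.
  rewrite ffunE.
  case: eqP => // ->; move: up; rewrite ap /unit_parity.
  by case: (par u.1); case: (par u.2).
rewrite !andTb /inv_col (inv_parity_flip (o := fun x => par (a x)) s (p := p)).
- by rewrite -Hstr; case: (string _ _); case: (string _ _); case: (inv_parity _ _ _).
- exact: ord_inj.
- by move=> x xp; rewrite ffunE (negPf xp).
rewrite ffunE eqxx ap; move: up; rewrite /unit_parity.
by case: (par u.1); case: (par u.2).
Qed.

Fixpoint unit_ops (l : seq ((C * C) * 'I_k)) w : tens :=
  if l is (u, p) :: l' then unit_op u p (unit_ops l' w) else w.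

Lemma unit_ops_linear l : linear (unit_ops l).
Proof. by elim: l => // -[u p] l IHl x w w' /=; rewrite IHl linearP. Qed.

HB.instance Definition _ l :=
  GRing.isLinear.Build F tens tens *:%R (unit_ops l) (unit_ops_linear l).

Lemma rho_unit_ops s (us : seq (C * C)) ps w :
  rho s (unit_ops (zip us ps) w) = unit_ops (zip us (map s ps)) (rho s w).
Proof. by elim: us ps => [|u us IH] [|p ps] //=; rewrite rho_unit_op IH. Qed.

(** A further unit acting on one of the positions already used is moved to its
    place and composed there; the outcome does not depend on the positions. *)
Lemma unit_ops_absorb u (us : seq (C * C)) :
  exists L : seq (F * seq (C * C)), (forall l, l \in L -> size l.2 = size us) /\
    forall ps w, uniq ps -> size ps = size us ->
      \sum_(p <- ps) unit_op u p (unit_ops (zip us ps) w)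
      = \sum_(l <- L) l.1 *: unit_ops (zip l.2 ps) w.
Proof.
elim: us => [|v us [L [Lsize HL]]].
  by exists [::]; split=> // -[|] // w _ _; rewrite !big_nil.
exists ((if u.2 == v.1 then 1 else 0, (u.1, v.2) :: us) ::
  [seq ((-1) ^+ (unit_parity u && unit_parity v) * l.1, v :: l.2) | l <- L]).
split=> [l|[|p ps] w //= /andP[pps ups] [psize]].
  by rewrite inE => /orP[/eqP-> // | /mapP[l' l'L ->]] /=; rewrite Lsize.
rewrite !big_cons big_map /= unit_op_same; congr (_ + _).
  by case: ifP; rewrite ?scale1r ?scale0r.
rewrite big_seq (eq_bigr (fun q => (-1) ^+ (unit_parity u && unit_parity v) *:
    unit_op v p (unit_op u q (unit_ops (zip us ps) w)))) => [|q qps]; last first.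
  by rewrite unit_op_comm //; apply: contraNneq pps => <-.
rewrite -big_seq -scaler_sumr -linear_sum HL // linear_sum scaler_sumr.
by apply: eq_bigr => l _; rewrite linearZ scalerA.
Qed.

Section Commutant.
Variable f : 'End(tens).
Hypothesis f_comm : forall u w,
  f (\sum_p unit_op u p w) = \sum_p unit_op u p (f w).

(** In the product of [\sum_p unit_op u p] with the sum for [us], the terms with
    [p] among the used positions are sums for shorter lists of the same kind, and
    the others are the terms sought, each free position giving the same sum. *)
Lemma comm_unit_ops (us : seq (C * C)) (ps : seq 'I_k) w :
  uniq ps -> size ps = size us ->
  f (\sum_s unit_ops (zip us (map (s : {perm 'I_k}) ps)) w)
  = \sum_s unit_ops (zip us (map (s : {perm 'I_k}) ps)) (f w).
Proof.
move: {2}(size us) (erefl (size us)) => d.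
elim: d us ps w => [|d IHd] [|u us] [|p ps] w //= => [_ _ _ | [usd] /andP[pps ups] [psize]].
  by rewrite linear_sum.
have [L [Lsize HL]] := unit_ops_absorb u us.
pose E (vs : seq (C * C)) w' :=
  \sum_(s : {perm 'I_k}) unit_ops (zip vs (map s ps)) w'.
pose E' w' := \sum_(s : {perm 'I_k}) unit_op u (s p) (unit_ops (zip us (map s ps)) w').
pose N := #|[pred q | q \notin ps]|.
have key w' : E' w' *+ N
    = \sum_q unit_op u q (E us w') - \sum_(l <- L) l.1 *: E l.2 w'.
  apply/eqP; rewrite eq_sym subr_eq; apply/eqP.
  under eq_bigr => q _ do rewrite linear_sum.
  under [X in _ + X]eq_bigr => l _ do rewrite scaler_sumr.
  rewrite exchange_big [X in _ + X]exchange_big /=.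
  rewrite [X in _ + X](eq_bigr (fun s : {perm 'I_k} =>
      \sum_(q | q \in ps) unit_op u (s q) (unit_ops (zip us (map s ps)) w'))); last first.
    move=> s _; rewrite -HL ?map_inj_uniq ?size_map //; last exact: perm_inj.
    by rewrite big_map big_uniq.
  rewrite -sumr_const [X in _ = X + _](eq_bigr (fun q => \sum_(s : {perm 'I_k})
      unit_op u (s q) (unit_ops (zip us (map s ps)) w'))); last first.
    move=> q qps; rewrite /E' (reindex_inj (mulgI (tperm q p))) /=.
    apply: eq_bigr => s _; rewrite permM tpermR; congr (unit_op _ _ (unit_ops (zip _ _) _)).
    apply/eq_in_map => x xps; rewrite permM tpermD //.
      by apply: contraTneq xps => <-.
    by apply: contraTneq xps => <-.
  rewrite [X in _ = X + _]exchange_big -big_split; apply: eq_bigr => s _ /=.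
  rewrite (reindex_inj (@perm_inj _ s)) /= (bigID (fun q => q \in ps)) /=.
  by rewrite addrC.
have N0 : N%:R != 0 :> F.
  by rewrite pnatr_eq0 -lt0n; apply/card_gt0P; exists p.
apply: (scalerI N0); rewrite !scaler_nat -linearMn -/(E' w) -/(E' (f w)) !key.
rewrite linearB /= f_comm; congr (_ - _).
  by apply: eq_bigr => q _; congr (unit_op _ _ _); apply: IHd.
rewrite linear_sum big_seq [RHS]big_seq; apply: eq_bigr => l /Lsize lsize.
by rewrite linearZ; congr (_ *: _); apply: IHd; rewrite ?lsize.
Qed.

(** On all the positions at once, the units [(a p, b p)] give the matrix unit
    from [b] to [a]. *)
Lemma unit_ops_basis a b ps c : uniq ps ->
  exists eta : bool, unit_ops (zip [seq (a p, b p) | p <- ps] ps) (e_ c)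
  = if all (fun p => c p == b p) ps
    then (-1) ^+ eta *: e_ [ffun x => if x \in ps then a x else c x] else 0.
Proof.
elim: ps => [|p ps IH] /=.
  exists false; rewrite expr0 scale1r; congr e_; apply/ffunP => x.
  by rewrite ffunE.
case/andP=> pps /IH[eta ->]; case: ifP => _; last first.
  by exists false; rewrite linear0 andbF.
rewrite andbT linearZ /= unit_op_basis ffunE (negPf pps) /=.
case: eqP => _; last by exists false; rewrite scaler0.
eexists; rewrite scalerA -signr_addb; congr (_ *: e_ _).
by apply/ffunP => x; rewrite !ffunE inE; case: eqP => [->|].
Qed.

Definition matrix_unit a b w : tens := w b *: e_ a.

Lemma matrix_unitP a b : exists eta : bool, forall w,
  matrix_unit a b w = (-1) ^+ eta *:
    unit_ops (zip [seq (a p, b p) | p <- enum 'I_k] (enum 'I_k)) w.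
Proof.
have [eta Heta] := unit_ops_basis a b b (enum_uniq 'I_k).
exists eta => w; rewrite [w in RHS]ffun_basis linear_sum (bigD1 b) //=.
rewrite linearZ /= Heta; rewrite ifT; last by apply/allP => x _.
rewrite scalerDr scalerA mulrC -scalerA [_ *: (_ *: e_ _)]scalerA -expr2 sqrr_sign.
rewrite scale1r big1 ?scaler0 ?addr0 => [|c cb].
  by congr (_ *: e_ _); apply/ffunP => x; rewrite ffunE mem_enum.
have [eta' Heta'] := unit_ops_basis a b c (enum_uniq 'I_k).
rewrite linearZ /= Heta'; case: ifP; rewrite ?scaler0 // => /allP cbE.
by case/eqP: cb; apply/ffunP => x; apply/eqP/cbE; rewrite mem_enum.
Qed.

Definition average (E : tens -> tens) w : tens := \sum_s rho s (E (rho s^-1%g w)).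

Lemma comm_average_unit a b w :
  f (average (matrix_unit a b) w) = average (matrix_unit a b) (f w).
Proof.
have [eta Heta] := matrix_unitP a b.
suff HE w' : average (matrix_unit a b) w' = (-1) ^+ eta *: \sum_s unit_ops
    (zip [seq (a p, b p) | p <- enum 'I_k] (map (s : {perm 'I_k}) (enum 'I_k))) w'.
  by rewrite !HE linearZ /= comm_unit_ops ?enum_uniq ?size_map.
rewrite scaler_sumr; apply: eq_bigr => s _.
by rewrite Heta linearZ /= rho_unit_ops -rhoM mulVg rho1.
Qed.

Lemma comm_average (E : {linear tens -> tens}) w :
  f (average E w) = average E (f w).
Proof.
suff HE w' : average E w' = \sum_b \sum_a E (e_ b) a *: average (matrix_unit a b) w'.
  rewrite !HE linear_sum; apply: eq_bigr => b _; rewrite linear_sum.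
  by apply: eq_bigr => a _; rewrite linearZ /= comm_average_unit.
transitivity (\sum_s \sum_b \sum_a
    E (e_ b) a *: rho s (matrix_unit a b (rho s^-1%g w'))); last first.
  rewrite exchange_big; apply: eq_bigr => b _; rewrite exchange_big.
  by apply: eq_bigr => a _; rewrite scaler_sumr.
apply: eq_bigr => s _; rewrite {1}[rho s^-1%g w']ffun_basis !linear_sum.
apply: eq_bigr => b _; rewrite !linearZ /= {1}[E (e_ b)]ffun_basis linear_sum.
rewrite scaler_sumr; apply: eq_bigr => a _.
by rewrite /matrix_unit !linearZ /= !scalerA mulrC.
Qed.

End Commutant.

Definition group_rep : 'Hom({ffun {perm 'I_k} -> F^o}, 'End(tens)) := lin_ext rho.

Lemma group_repE (x : {ffun {perm 'I_k} -> F^o}) w :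
  group_rep x w = \sum_s x s *: rho s w.
Proof.
rewrite /group_rep [x in LHS]ffun_basis linear_sum sum_lfunE.
by apply: eq_bigr => s _; rewrite linearZ /= lin_ext_basis scale_lfunE.
Qed.

Lemma rho_comp_image s (A : 'End(tens)) :
  A \in limg group_rep -> (rho s \o A)%VF \in limg group_rep.
Proof.
case/memv_imgP => x _ ->; apply/memv_imgP.
exists (\sum_t x t *: basis_vec F (t * s)%g); first exact: memvf.
apply/lfunP => w; rewrite comp_lfunE group_repE !linear_sum sum_lfunE.
apply: eq_bigr => t _.
by rewrite !linearZ /= lin_ext_basis scale_lfunE rhoM.
Qed.

Lemma rho_image s : rho s \in limg group_rep.
Proof.
apply/memv_imgP; exists (basis_vec F s); first exact: memvf.
by rewrite lin_ext_basis.
Qed.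

Definition column a w : 'End(tens) := lin_ext (fun b => if b == a then w else 0).

Lemma columnE a w w' : column a w w' = w' a *: w.
Proof.
rewrite [w' in LHS]ffun_basis linear_sum (bigD1 a) //= linearZ /= lin_ext_basis.
rewrite eqxx big1 ?addr0 // => b /negPf ba.
by rewrite linearZ /= lin_ext_basis ba scaler0.
Qed.

Lemma sum_column (A : 'End(tens)) : A = \sum_a column a (A (e_ a)).
Proof.
apply/lfunP => w; rewrite {1}[w]ffun_basis linear_sum sum_lfunE.
by apply: eq_bigr => a _; rewrite linearZ columnE.
Qed.

Definition block (P : 'End('End(tens))) a b w : tens := P (column a w) (e_ b).

Lemma block_is_linear P a b : linear (block P a b).
Proof.
move=> x w w'; rewrite /block.
have -> : column a (x *: w + w') = x *: column a w + column a w'.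
  apply/lfunP => w''; rewrite add_lfunE scale_lfunE !columnE scalerDr.
  by rewrite !scalerA mulrC.
by rewrite linearP add_lfunE scale_lfunE.
Qed.

HB.instance Definition _ P a b :=
  GRing.isLinear.Build F tens tens *:%R (block P a b) (block_is_linear P a b).

(** Maschke's trick: a projection onto the operators spanned by the signed
    permutations, averaged over left translations.  It sends [f] to itself,
    because its blocks are averages, which commute with [f], and because it
    fixes the identity. *)
Theorem commutant_span (f : 'End(tens)) :
  (forall u w, f (\sum_p unit_op u p w) = \sum_p unit_op u p (f w)) ->
  exists x, f = group_rep x.
Proof.
move=> fC; pose P0 := projv (limg group_rep); pose N := #|{perm 'I_k}|.
pose P (A : 'End(tens)) := \sum_s (rho s \o P0 (rho s^-1%g \o A))%VF.
have PA A : P A \in limg group_rep.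
  by apply: memv_suml => s _; apply: rho_comp_image; apply: memv_proj.
have P1 : P \1%VF = \1%VF *+ N.
  rewrite /P (eq_bigr (fun=> \1%VF)) ?sumr_const // => s _.
  rewrite comp_lfun1r /P0 projv_id ?rho_image //.
  by apply/lfunP => w; rewrite comp_lfunE -rhoM mulVg rho1 id_lfunE.
have PE A b : P A (e_ b) = \sum_a average (block P0 a b) (A (e_ a)).
  rewrite /P sum_lfunE exchange_big; apply: eq_bigr => s _ /=.
  rewrite comp_lfunE [(rho s^-1%g \o A)%VF]sum_column linear_sum sum_lfunE linear_sum.
  by apply: eq_bigr => a _; rewrite /block comp_lfunE.
have Pf : P f = f *+ N.
  apply/lfunP; apply: basis_ext => b; rewrite PE.
  transitivity (f (P \1%VF (e_ b))); last first.
    by rewrite P1 -scaler_nat -[in RHS]scaler_nat !scale_lfunE linearZ id_lfunE.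
  rewrite PE linear_sum; apply: eq_bigr => a _.
  by rewrite -(comm_average fC) id_lfunE.
have N0 : N%:R != 0 :> F.
  by rewrite pnatr_eq0 -lt0n; apply/card_gt0P; exists 1%g.
have /memv_imgP[x _ fx] : f \in limg group_rep.
  by rewrite -(scalerK N0 f) scaler_nat -Pf memvZ ?PA.
by exists x.
Qed.

End TensorOperators.

(** * Diagrams as permutations *)

Lemma sum_parity (I : finType) (P : pred I) (h : I -> nat) :
  odd (\sum_(i | P i) h i)%N = \big[addb/false]_(i | P i) odd (h i).
Proof. exact: (big_morph odd oddD). Qed.

Lemma prod_sign (F : numFieldType) (I : finType) (P : pred I) (h : I -> bool) :
  \prod_(i | P i) (-1) ^+ h i = (-1) ^+ (\big[addb/false]_(i | P i) h i) :> F.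
Proof.
rewrite (big_morph (fun b : bool => (-1) ^+ b : F) (id1 := 1) (op1 := *%R)) //.
by move=> b c; rewrite signr_addb.
Qed.

(** Parity of the number of pairs in a set of [n] elements, the sign exponent of
    the reversal of [n] anticommuting letters. *)
Definition tri n := odd 'C(n, 2).

Lemma triS p : tri p.+1 = tri p (+) odd p.
Proof. by rewrite /tri binS bin1 oddD. Qed.

Lemma triD p q : tri (p + q) = tri p (+) tri q (+) (odd p && odd q).
Proof.
elim: p => [|p IHp]; first by rewrite add0n /tri addbF.
rewrite addSn !triS IHp oddD oddS.
by case: (tri p); case: (tri q); case: (odd p); case: (odd q).
Qed.

Lemma tri_double t : tri t.*2 = odd t.
Proof. by rewrite -addnn triD addbb addFb andbb. Qed.

Lemma pair_parity_all (X : finType) (f : X -> nat) (h : X -> X -> bool) :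
  injective f -> (forall x, h x x = false) ->
  \big[addb/false]_x \big[addb/false]_y h x y
  = pair_parity f (fun x y => h x y (+) h y x).
Proof.
move=> fi h0; rewrite pair_parityD pair_bigA /=.
rewrite (bigID (fun xy : X * X => f xy.1 < f xy.2)%N) /=; congr addb.
rewrite (bigID (fun xy : X * X => xy.1 == xy.2)) /= big1 ?addFb; last first.
  by move=> [x y] /= /andP[_ /eqP->].
rewrite (reindex_inj (h := fun xy : X * X => (xy.2, xy.1))); last first.
  by move=> [x y] [x' y'] [-> ->].
apply: eq_bigl => -[x y] /=; rewrite -leqNgt [in RHS]ltn_neqAle (inj_eq fi).
by rewrite eq_sym andbC.
Qed.

Lemma pair_parity_tri (X : finType) (f : X -> nat) (o : X -> bool) :
  injective f -> pair_parity f (fun x y => o x && o y) = tri (\sum_x o x)%N.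
Proof.
move=> fi; pose D := (\sum_(xy : X * X | f xy.1 < f xy.2) (o xy.1 && o xy.2))%N.
have -> : pair_parity f (fun x y => o x && o y) = odd D.
  by rewrite /D sum_parity; apply: eq_bigr => xy _; case: (_ && _).
have DC : (\sum_(xy : X * X | f xy.2 < f xy.1) (o xy.1 && o xy.2))%N = D.
  rewrite (reindex_inj (h := fun xy : X * X => (xy.2, xy.1))); last first.
    by move=> [x y] [x' y'] [-> ->].
  by apply: eq_bigr => xy _; rewrite andbC.
have sq : ((\sum_x o x) * (\sum_x o x) = \sum_x o x + D.*2)%N.
  rewrite big_distrl /=; under eq_bigr => x _ do rewrite big_distrr /=.
  rewrite pair_bigA /= (bigID (fun xy : X * X => f xy.1 < f xy.2)%N) /=.
  rewrite [X in (_ + X)%N](bigID (fun xy : X * X => f xy.2 < f xy.1)%N) /=.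
  have E (P : pred (X * X)) : (\sum_(xy | P xy) o xy.1 * o xy.2
                              = \sum_(xy | P xy) (o xy.1 && o xy.2))%N.
    by apply: eq_bigr => xy _; rewrite mulnb.
  rewrite !E -/D (eq_bigl (fun xy : X * X => f xy.2 < f xy.1)%N); last first.
    by move=> xy; case: ltngtP.
  rewrite DC (eq_bigl (fun xy : X * X => xy.1 == xy.2)); last first.
    by move=> [x y] /=; rewrite -(inj_eq fi); case: ltngtP.
  rewrite -(pair_big_dep predT (fun x y => x == y) (fun x y => (o x && o y) : nat)) /=.
  rewrite addnA addnn addnC; congr addn; apply: eq_bigr => x _.
  by rewrite (eq_bigl (pred1 x)) ?big_pred1_eq ?andbb // => y; rewrite eq_sym.
by rewrite /tri bin2 -subn1 mulnBr muln1 sq addKn doubleK.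
Qed.

Section DiagramPerm.
Variables r s : nat.
Local Notation T := 'I_(r + s).
Implicit Types (d : diagram r s) (p q : T).

(** Each strand joins an out-vertex to an in-vertex: in the direction of the
    arrows of [V], strands go up on the left of the wall and down on its
    right. *)
Definition out_vertex p : vertex r s := (~~ (p < r)%N, p).
Definition in_vertex p : vertex r s := ((p < r)%N, p).

Lemma strandK d v : strand d (strand d v) = v.
Proof. by have /forallP/(_ v)/and3P[_ /eqP] := valP d. Qed.

Lemma strand_out d p : strand d (out_vertex p) = in_vertex (strand d (out_vertex p)).2.
Proof.
have /forallP/(_ (out_vertex p))/and3P[_ _] := valP d.
rewrite -/(strand d _); case: (strand d _) => e q.
rewrite /same_edge /same_side /out_vertex /in_vertex /=.
by case: e; case: (p < r)%N; case: (q < r)%N.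
Qed.

Lemma diag_perm_subproof d : injective (fun p => (strand d (out_vertex p)).2).
Proof.
move=> p q pq; have : strand d (out_vertex p) = strand d (out_vertex q).
  by rewrite strand_out pq -strand_out.
by move/(can_inj (strandK d)) => -[].
Qed.

Definition diag_perm d : {perm T} := perm (diag_perm_subproof (d := d)).

Lemma strand_outE d p : strand d (out_vertex p) = in_vertex (diag_perm d p).
Proof. by rewrite permE strand_out. Qed.

Lemma strand_inE d p : strand d (in_vertex (diag_perm d p)) = out_vertex p.
Proof. by rewrite -strand_outE strandK. Qed.

Lemma vertexP (v : vertex r s) : v = out_vertex v.2 \/ v = in_vertex v.2.
Proof.
case: v => e p; rewrite /out_vertex /in_vertex /=.
by case: e; case: (p < r)%N; [right | left | left | right].
Qed.

Definition perm_strand (t : {perm T}) : {ffun vertex r s -> vertex r s} :=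
  [ffun v => if v == out_vertex v.2 then in_vertex (t v.2)
             else out_vertex (t^-1%g v.2)].

Lemma in_neq_out p q : (in_vertex p == out_vertex q) = false.
Proof.
rewrite /in_vertex /out_vertex xpair_eqE /=.
by case: (eqVneq p q) => [-> | _]; [case: (q < r)%N | rewrite andbF].
Qed.

Lemma perm_strand_out t p : perm_strand t (out_vertex p) = in_vertex (t p).
Proof. by rewrite ffunE eqxx. Qed.

Lemma perm_strand_in t p : perm_strand t (in_vertex p) = out_vertex (t^-1%g p).
Proof. by rewrite ffunE in_neq_out. Qed.

Fact perm_strand_walled t : is_walled_brauer (perm_strand t).
Proof.
apply/forallP => v; case: (vertexP v) => ->; rewrite ?perm_strand_out ?perm_strand_in.
  rewrite in_neq_out /= permK eqxx /= /same_edge /same_side /=.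
  by case: (_ < r)%N; case: (_ < r)%N.
rewrite perm_strand_out permKV eq_sym in_neq_out eqxx /same_edge /same_side /=.
by case: (_ < r)%N; case: (_ < r)%N.
Qed.

Definition perm_diag t : diagram r s := exist _ (perm_strand t) (perm_strand_walled t).

Lemma perm_diagK : cancel perm_diag diag_perm.
Proof.
by move=> t; apply/permP => p; rewrite permE [strand _ _]perm_strand_out.
Qed.

Lemma diag_permK : cancel diag_perm perm_diag.
Proof.
move=> d; apply: val_inj; apply/ffunP => v.
case: (vertexP v) => ->; rewrite /= ?perm_strand_out ?perm_strand_in.
  by rewrite -strand_outE.
by rewrite -[X in val d (in_vertex X)](permKV (diag_perm d)) -/(strand d _) strand_inE.
Qed.

Definition strand_end d (ep : bool * T) : vertex r s :=
  if ep.1 then in_vertex (diag_perm d ep.2) else out_vertex ep.2.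

Lemma strand_end_bij d : bijective (strand_end d).
Proof.
exists (fun v => if v == out_vertex v.2 then (false, v.2)
                 else (true, (diag_perm d)^-1%g v.2)) => [[[] p] | v].
- by rewrite /strand_end /= in_neq_out permK.
- by rewrite /strand_end /= eqxx.
by case: (vertexP v) => ->; rewrite /strand_end /= ?eqxx ?in_neq_out /= ?permKV.
Qed.

Lemma strand_strand_end d e p : strand d (strand_end d (e, p)) = strand_end d (~~ e, p).
Proof. by case: e; rewrite /strand_end /= ?strand_inE ?strand_outE. Qed.

(** A chord separates the ends of another one exactly when the numbers of its own
    ends that precede them have different parities. *)
Lemma chord_crossing (x x' y y' : nat) :
  x != x' -> y != y' -> x != y -> x != y' -> x' != y -> x' != y' ->
  let cr a a' b b' := [&& a < b, b < a' & a' < b']%N in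
  (cr x x' y y' (+) cr x x' y' y (+) cr x' x y y' (+) cr x' x y' y) (+)
  (cr y y' x x' (+) cr y y' x' x (+) cr y' y x x' (+) cr y' y x' x)
  = ((x < y) (+) (x < y') (+) (x' < y) (+) (x' < y'))%N.
Proof.
move=> xx yy xy xy' x'y x'y' /=.
case: (ltngtP x x') xx => // xx _; case: (ltngtP y y') yy => // yy _;
case: (ltngtP x y) xy => // xy _; case: (ltngtP x y') xy' => // xy' _;
case: (ltngtP x' y) x'y => // x'y _; case: (ltngtP x' y') x'y' => // x'y' _;
rewrite ?andbF ?andbT //=; exfalso; lia.
Qed.

Definition strand_crossing d p q := \big[addb/false]_e \big[addb/false]_e'
  crossing d (strand_end d (e, p)) (strand_end d (e', q)).

Lemma boundary_pos_inj : injective (@boundary_pos r s).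
Proof.
move=> [e p] [e' q]; rewrite /boundary_pos /= => H; have := ltn_ord p; have := ltn_ord q.
move: H; rewrite -addnn; case: e; case: e' => H qk pk;
  by [congr (_, _); apply: ord_inj; lia | exfalso; lia].
Qed.

(** Along the boundary an out-vertex precedes an in-vertex unless both are on the
    right, and positions are read backwards for the out-vertices on the right and
    the in-vertices on the left. *)
Lemma strand_crossingE d p q : (p < q)%N ->
  let S p := (r <= diag_perm d p)%N in let R p := (r <= p)%N in
  strand_crossing d p q (+) strand_crossing d q p
  = (diag_perm d q < diag_perm d p)%N (+) ((R p (+) S p) && (R q (+) S q)).
Proof.
move=> pq S R; have pqn : p != q by rewrite -(inj_eq val_inj) neq_ltn pq.
have bij := bij_inj (strand_end_bij d).
pose pos e x := boundary_pos (strand_end d (e, x)).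
have posN e x e' y : (e, x) != (e', y) -> pos e x != pos e' y.
  by rewrite (inj_eq boundary_pos_inj) (inj_eq bij).
transitivity ((pos false p < pos false q) (+) (pos false p < pos true q)
   (+) (pos true p < pos false q) (+) (pos true p < pos true q))%N.
  rewrite -chord_crossing ?posN ?xpair_eqE ?(negPf pqn) ?andbF //.
  rewrite /strand_crossing !big_bool /crossing !strand_strand_end -!/(pos _ _) /=.
  by do 8!case: [&& _, _ & _].
rewrite /pos /strand_end /boundary_pos /= /R /S.
clear R S pos posN bij pqn.
have : val (diag_perm d p) != val (diag_perm d q).
  by rewrite (inj_eq val_inj) (inj_eq perm_inj) neq_ltn pq.
move: (diag_perm d p) (diag_perm d q) => p' q' p'q'.
have := ltn_ord p; have := ltn_ord q; have := ltn_ord p'; have := ltn_ord q'.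
move: p'q' pq => /=; rewrite -addnn.
move: (nat_of_ord p) (nat_of_ord q) (nat_of_ord p') (nat_of_ord q') => {}p {}q {}p' {}q'.
move: (r + s)%N => k p'q' pq q'k p'k qk pk.
have [pr|pr] := ltnP p r; have [qr|qr] := ltnP q r;
have [p'r|p'r] := ltnP p' r; have [q'r|q'r] := ltnP q' r; rewrite /=;
repeat (match goal with |- context [(?a < ?b)%N] =>
  first [ rewrite (_ : (a < b)%N = true); [|by apply/idP; lia]
        | rewrite (_ : (a < b)%N = false); [|by apply/negbTE; lia]
        | case: (ltnP a b) => ? ] end) => //=; exfalso; lia.
Qed.

End DiagramPerm.

Lemma big_strand_end r s (d : diagram r s) (h : vertex r s -> bool) :
  \big[addb/false]_v h v
  = \big[addb/false]_p \big[addb/false]_e h (strand_end d (e, p)).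
Proof.
rewrite exchange_big pair_bigA /= (reindex _ (onW_bij predT (strand_end_bij d))) /=.
by apply: eq_bigr => -[].
Qed.

Section Weight.
Variables (F : numFieldType) (m n r s : nat).
Local Notation T := 'I_(r + s).
Local Notation col := (multi_index m n r s).
Local Notation par := (@parity m n).
Implicit Types (i j a b : col) (d : diagram r s).

(** Colours [i] left of the wall and [j] right of it.  For bottom colours [i] and
    top colours [j], the out-vertices have the colours [mix i j] and the
    in-vertices the colours [mix j i]. *)
Definition mix i j : col := [ffun p : T => if (p < r)%N then i p else j p].

Lemma mixK i j : mix (mix i j) (mix j i) = i.
Proof. by apply/ffunP => p; rewrite !ffunE; case: (p < r)%N. Qed.

Lemma colour_out i j p : colour i j (out_vertex p) = mix i j p.
Proof. by rewrite ffunE /colour /=; case: (p < r)%N. Qed.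

Lemma colour_in i j p : colour i j (in_vertex p) = mix j i p.
Proof. by rewrite ffunE /colour /=; case: (p < r)%N. Qed.

Definition matching i d j := [forall v, colour i j v == colour i j (strand d v)].

Lemma matchingE i d j :
  matching i d j = [forall p, mix j i (diag_perm d p) == mix i j p].
Proof.
apply/forallP/forallP => [H p | H v].
  rewrite eq_sym; have := H (out_vertex p).
  by rewrite strand_outE colour_out colour_in.
case: (vertexP v) => ->; first by rewrite strand_outE colour_out colour_in eq_sym.
rewrite -{1 2}[v.2](permKV (diag_perm d)) strand_inE colour_out colour_in.
exact: H.
Qed.

Definition odd_right i := (\sum_(p < r + s | r <= p) par (i p))%N.

(** The sign of bending the right of the diagram: it reverses the word of the
    colours on the right of the wall, first bottom, then top. *)
Definition bend i j : bool :=
  odd (odd_right i) (+) tri (odd_right j + odd_right i).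

(** Let [S], [R] tell whether the in- and out-vertex of a strand are on the right.
    By [strand_crossingE] crossings are inversions up to pairs of odd strands
    that turn back ([R != S]); of these, the bottom caps are the ones with
    [S] only. *)
Lemma wt_signed_perm i d j :
  wt F i d j = (-1) ^+ bend i j * signed_perm F (diag_perm d) (mix i j) (mix j i).
Proof.
set t := diag_perm d; set a := mix i j; set b := mix j i.
have colE ep : colour i j (strand_end d ep) = if ep.1 then b (t ep.2) else a ep.2.
  by case: ep => -[] p; rewrite /strand_end /= ?colour_in ?colour_out.
rewrite /wt /signed_perm /perm_kernel.
rewrite -/(matching i d j) matchingE.
case: ifPn => [/forallP ab | _]; last by rewrite mulr0.
pose o p := par (a p).
have oE ep : par (colour i j (strand_end d ep)) = o ep.2.
  by rewrite colE; case: ep => -[] p //=; rewrite (eqP (ab p)).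
pose R (p : T) := (r <= p)%N; pose S p := (r <= t p)%N.
rewrite !prod_sign -!signr_addb; congr (_ ^+ _).
have -> : \big[addb/false]_(vw : vertex r s * vertex r s | crossing d vw.1 vw.2)
      (par (colour i j vw.1) && par (colour i j vw.2))
    = inv_parity (@nat_of_ord (r + s)) o t (+) tri (\sum_p (o p && (R p (+) S p)))%N.
  rewrite -(pair_parity_tri _ (@ord_inj (r + s))) -pair_parityD.
  transitivity (\big[addb/false]_p \big[addb/false]_q
      (o p && o q && strand_crossing d p q)).
    transitivity (\big[addb/false]_v \big[addb/false]_w (crossing d v w &&
        (par (colour i j v) && par (colour i j w)))).
      by rewrite pair_bigA big_mkcond; apply: eq_bigr => -[v w] _; case: ifP.
    rewrite (big_strand_end d); apply: eq_bigr => p _.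
    transitivity (\big[addb/false]_e \big[addb/false]_q \big[addb/false]_e'
        (o p && o q && crossing d (strand_end d (e, p)) (strand_end d (e', q)))).
      apply: eq_bigr => e _; rewrite (big_strand_end d).
      by apply: eq_bigr => q _; apply: eq_bigr => e' _; rewrite !oE andbC.
    rewrite exchange_big; apply: eq_bigr => q _ /=.
    rewrite /strand_crossing big_distrr /=; apply: eq_bigr => e _.
    by rewrite big_distrr.
  rewrite (pair_parity_all (@ord_inj (r + s))) => [|p]; last first.
    rewrite /strand_crossing big1 ?andbF // => e _; rewrite big1 // => e' _.
    rewrite /crossing !strand_strand_end; case: e; case: e' => /=; lia.
  apply: eq_pair_parity => p q pq; rewrite [o q && o p]andbC -andb_addr.
  by rewrite strand_crossingE //; case: (o p); case: (o q); rewrite //= ?andbF ?addbF.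
have -> : \big[addb/false]_(v : vertex r s | bottom_cap d v) par (colour i j v)
    = odd (\sum_p (o p && (~~ R p && S p)))%N.
  rewrite sum_parity big_mkcond (big_strand_end d).
  apply: eq_bigr => p _; rewrite big_bool /= !oE /bottom_cap !strand_strand_end /=.
  rewrite /strand_end /= /R /S -/t.
  have [pr|pr] := ltnP p r; have [tr|tr] := ltnP (t p) r; rewrite /= ?andbF //.
  have pt : (p < t p)%N := leq_trans pr tr.
  by rewrite pt ltnNge (ltnW pt) andbT oddb.
have rightE c : odd_right c = (\sum_p (par (c p) && R p))%N.
  by rewrite /odd_right big_mkcond; apply: eq_bigr => p _; rewrite /R; case: (r <= p)%N;
     rewrite ?andbT ?andbF.
have aE : odd_right j = (\sum_p (o p && R p))%N.
  rewrite rightE; apply: eq_bigr => p _; rewrite /o /a ffunE /R.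
  by case: ltnP => _; rewrite ?andbF.
have bE : odd_right i = (\sum_p (o p && S p))%N.
  rewrite rightE (reindex_inj (@perm_inj _ t)); apply: eq_bigr => p _.
  rewrite /o -(eqP (ab p)) /b ffunE /R /S.
  by case: ltnP => _; rewrite ?andbF.
pose tt := (\sum_p (o p && (R p && S p)))%N.
have capE : (odd_right i = tt + \sum_p (o p && (~~ R p && S p)))%N.
  by rewrite bE -big_split; apply: eq_bigr => p _ /=; case: (o p); case: (R p); case: (S p).
have turnE : (odd_right j + odd_right i = tt.*2 + \sum_p (o p && (R p (+) S p)))%N.
  rewrite aE bE -addnn -!big_split; apply: eq_bigr => p _ /=.
  by case: (o p); case: (R p); case: (S p).
rewrite /bend turnE triD tri_double {1}capE oddD odd_double /= addbF.
rewrite -/(inv_parity _ _ _) -/o; case: (odd tt); case: (inv_parity _ _ _);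
  by case: (tri _); case: (odd _).
Qed.

End Weight.

(** * The action of the Lie superalgebra *)

Section GlAction.
Variables (F : numFieldType) (m n r s : nat).
Local Notation T := 'I_(r + s).
Local Notation C := 'I_(m + n).
Local Notation col := (multi_index m n r s).
Local Notation tens := (mixed_tensor F m n r s).
Local Notation par := (@parity m n).
Local Notation e_ := (basis_vec F).
Implicit Types (i j a b : col) (p q : T) (c : C) (u : C * C) (w : tens) (e : bool).
Implicit Types (f : 'End(tens)).

Definition koszul e i p : F := (-1) ^+ (e && string i p).

Lemma koszul_set e i p c : koszul e (set_col i p c) p = koszul e i p.
Proof. by rewrite /koszul string_set ltnn addbF. Qed.

(** Operators that change the colour of one factor at a time, by the matrix
    [y p] on the factor [p]. *)
Section LocalOperator.
Variables (e : bool) (y : T -> C -> C -> F) (L : 'End(tens)).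
Hypothesis L_basis : forall i, L (e_ i)
  = \sum_p koszul e i p *: \sum_c y p c (i p) *: e_ (set_col i p c).

Lemma local_pre f i j : f (L (e_ i)) j
  = \sum_p \sum_c koszul e i p * y p c (i p) * f (e_ (set_col i p c)) j.
Proof.
rewrite L_basis linear_sum sum_ffunE; apply: eq_bigr => p _.
rewrite linearZ linear_sum /= ffunE sum_ffunE scaler_sumr; apply: eq_bigr => c _.
by rewrite linearZ ffunE -mulrA.
Qed.

Lemma local_post w j : L w j
  = \sum_p \sum_c koszul e j p * y p (j p) c * w (set_col j p c).
Proof.
rewrite [w in LHS]ffun_basis linear_sum sum_ffunE.
transitivity (\sum_i \sum_p (if set_col i p (j p) == j
    then koszul e j p * y p (j p) (i p) * w i else 0)).
  apply: eq_bigr => i _; rewrite linearZ /= L_basis ffunE sum_ffunE scaler_sumr.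
  apply: eq_bigr => p _; rewrite !ffunE sum_ffunE (bigD1 (j p)) //= big1 ?addr0.
    rewrite !ffunE eq_sym; case: eqP => [ij | _]; last by rewrite !(scaler0, mulr0).
    have <- : koszul e i p = koszul e j p by rewrite -[in RHS]ij koszul_set.
    by rewrite [_ *: 1]mulr1 mulrC.
  move=> c cj; rewrite !ffunE; case: eqP => [ij | _]; last by rewrite scaler0.
  by move: cj; rewrite ij ffunE !eqxx.
rewrite exchange_big; apply: eq_bigr => p _ /=.
rewrite -big_mkcond (partition_big (fun i => i p) predT) //=; apply: eq_bigr => c _.
rewrite (big_pred1 (set_col j p c)) => [|i]; first by rewrite ffunE eqxx.
apply/andP/eqP => [[/eqP ij /eqP <-] | ->].
  apply/ffunP => q; rewrite ffunE; have [->|/negPf qp] // := eqVneq q p.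
  by rewrite -ij ffunE qp.
by rewrite ffunE eqxx; split=> //; apply/eqP/ffunP => q; rewrite !ffunE; case: eqP => // ->.
Qed.

End LocalOperator.

Lemma gl_coefE e (x : 'M[F]_(m + n)) p c c' : gl_coef e x p c c'
  = if (p < r)%N then x c c' else - ((-1) ^+ (e && par c') * x c' c).
Proof.
rewrite /gl_coef /gl_actV /gl_actW; case: ifP => _; last first.
  rewrite !mxE (bigD1 c') //= !mxE !eqxx mul1r big1 ?addr0 // => l /negPf lc.
  by rewrite !mxE lc andbF mul0r.
rewrite !mxE (bigD1 c') //= !mxE !eqxx mulr1 big1 ?addr0 // => l /negPf lc.
by rewrite !mxE lc mulr0.
Qed.

Lemma gl_act_basis e x i : gl_act r s e x (e_ i)
  = \sum_p koszul e i p *: \sum_c gl_coef e x p c (i p) *: e_ (set_col i p c).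
Proof.
rewrite /gl_act lin_ext_basis; apply: eq_bigr => p _; congr (_ *: _).
rewrite /koszul -signr_odd oddM oddb sum_parity; congr (_ ^+ (_ && _)).
by apply: eq_bigr => q _; rewrite oddb.
Qed.

Definition gl_unit u : 'M[F]_(m + n) := delta_mx u.1 u.2.

Lemma gl_unitE u c c' : gl_unit u c c' = ((c == u.1) && (c' == u.2))%:R.
Proof. by rewrite mxE. Qed.

(** The terms of the supercommutator with a matrix unit are sorted by the colour
    that is changed, at an out-vertex [p] from [u.2] to [u.1], or at an in-vertex
    in the opposite direction.  A vertex on the right of the wall moves to the
    other side of the commutator, and the sign of the dual action disappears. *)
Definition out_term f e u i j p : F := if mix i j p == u.2 then
  if (p < r)%N then koszul e i p * f (e_ (set_col i p u.1)) j
  else (-1) ^+ (e && par u.1) * koszul e j p * f (e_ i) (set_col j p u.1) else 0.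

Definition in_term f e u i j p : F := if mix j i p == u.1 then
  if (p < r)%N then koszul e j p * f (e_ i) (set_col j p u.2)
  else (-1) ^+ (e && par u.1) * koszul e i p * f (e_ (set_col i p u.2)) j else 0.

Lemma gl_unit_commutator f e u i j :
  f (gl_act r s e (gl_unit u) (e_ i)) j - gl_act r s e (gl_unit u) (f (e_ i)) j
  = \sum_p out_term f e u i j p - \sum_p in_term f e u i j p.
Proof.
rewrite (local_pre (gl_act_basis e _)) (local_post (gl_act_basis e _)).
rewrite -!sumrB; apply: eq_bigr => p _; rewrite /out_term /in_term !ffunE.
have [pr|/negPf pr] := boolP (p < r)%N.
- under eq_bigr => c _ do rewrite gl_coefE pr.
  under [X in _ - X]eq_bigr => c _ do rewrite gl_coefE pr.
  rewrite (bigD1 u.1) //= gl_unitE eqxx big1 ?addr0 => [|c /negPf cu]; last first.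
    by rewrite gl_unitE cu ?andbF /= !(mulr0n, mulr0, mul0r, oppr0).
  rewrite (bigD1 u.2) //= gl_unitE eqxx andbT big1 ?addr0 => [|c /negPf cu]; last first.
    by rewrite gl_unitE cu ?andbF /= !(mulr0n, mulr0, mul0r, oppr0).
  by congr (_ - _); case: eqP; rewrite ?mulr1 ?mulr0 ?mul0r.
under eq_bigr => c _ do rewrite gl_coefE pr.
under [X in _ - X]eq_bigr => c _ do rewrite gl_coefE pr.
rewrite (bigD1 u.2) //= gl_unitE eqxx andbT big1 ?addr0 => [|c /negPf cu]; last first.
  by rewrite gl_unitE cu ?andbF /= !(mulr0n, mulr0, mul0r, oppr0).
rewrite (bigD1 u.1) //= gl_unitE eqxx big1 ?addr0 => [|c /negPf cu]; last first.
  by rewrite gl_unitE cu ?andbF /= !(mulr0n, mulr0, mul0r, oppr0).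
rewrite !mulrN !mulNr opprK addrC; congr (_ - _).
  by case: eqP => _; rewrite ?mulr1 ?mulr0 ?mul0r // [koszul _ _ _ * _]mulrC.
by case: eqP => [->|_]; rewrite ?mulr1 ?mulr0 ?mul0r // [koszul _ _ _ * _]mulrC.
Qed.

(** ** Comparison with the tensor power of [V] *)

Definition par_left i := \big[addb/false]_(p : T | (p < r)%N) par (i p).

Lemma mi_parityE i : mi_parity i = par_left i (+) odd (odd_right i).
Proof.
rewrite /mi_parity /odd_right !sum_parity (bigID (fun p : T => p < r)%N) /=.
congr addb; first by apply: eq_bigr => p _; rewrite oddb.
by apply: eq_bigl => p; rewrite -leqNgt.
Qed.

Lemma string_mix i j p : (r <= p)%N ->
  string (mix i j) p = par_left i (+) par_left j (+) string j p.
Proof.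
move=> rp; rewrite /string (bigID (fun q : T => q < r)%N) /=.
rewrite [X in _ = _ (+) X](bigID (fun q : T => q < r)%N) /=.
have lr (q : T) : (q < p)%N && (q < r)%N = (q < r)%N.
  by apply: andb_idl => qr; apply: leq_trans qr rp.
rewrite !(eq_bigl _ _ lr) -addbA -/(par_left j) addKb; congr addb.
  by apply: eq_bigr => q qr; rewrite ffunE qr.
by apply: eq_bigr => q /andP[_ /negPf qr]; rewrite ffunE qr.
Qed.

Lemma odd_right_set i p c :
  (odd_right (set_col i p c) + (r <= p) * par (i p)
   = odd_right i + (r <= p) * par c)%N.
Proof.
rewrite /odd_right; have [rp|rp] := leqP r p; last first.
  rewrite !mul0n !addn0; apply: eq_bigr => q rq; rewrite ffunE.
  by case: eqP => // qp; move: rp; rewrite ltnNge -qp rq.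
rewrite !mul1n (bigD1 p) //= [in RHS](bigD1 p) //= ffunE eqxx.
rewrite addnC addnA [RHS]addnC addnA [(par (i p) + _)%N]addnC; congr addn.
by apply: eq_bigr => q /andP[_ /negPf qp]; rewrite ffunE qp.
Qed.

Lemma par_left_set i p c : (r <= p)%N -> par_left (set_col i p c) = par_left i.
Proof.
move=> rp; apply: eq_bigr => q qr; rewrite ffunE; case: eqP => // qp.
by move: qr; rewrite qp ltnNge rp.
Qed.

(** The change of the bending sign and the sign of the dual action turn the string
    of the mixed tensor into that of the tensor power; the colours on the left
    enter because the total parity is conserved. *)
Lemma bend_out u i j p : (r <= p)%N -> j p = u.2 -> let e := unit_parity u in
  mi_parity i = mi_parity (set_col j p u.1) ->
  bend i (set_col j p u.1) (+) (e && par u.1) (+) (e && string j p)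
  = bend i j (+) (e && string (mix i j) p).
Proof.
move=> rp jp e; rewrite !mi_parityE par_left_set // string_mix // /bend.
have := odd_right_set j p u.1; rewrite rp !mul1n jp /e /unit_parity.
move: (odd_right j) (odd_right (set_col _ _ _)) (odd_right i) => y y' z.
case: (par u.1); case: (par u.2) => /=; rewrite ?addn0 ?addn1.
- by move=> [->] _; rewrite ?addbF.
- move=> ->; rewrite addSn triS oddD oddS /=.
  case: (par_left i); case: (par_left j); case: (string j p);
    by case: (odd y); case: (odd z); case: (tri _).
- move=> <-; rewrite addSn triS oddD /=.
  case: (par_left i); case: (par_left j); case: (string j p);
    by case: (odd y'); case: (odd z); case: (tri _).
by move=> -> _; rewrite ?addbF.
Qed.

Lemma bend_in u i j p : (r <= p)%N -> i p = u.1 -> let e := unit_parity u in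
  mi_parity (set_col i p u.2) = mi_parity j ->
  bend (set_col i p u.2) j (+) (e && par u.1) (+) (e && string i p)
  = bend i j (+) (e && string (mix j i) p).
Proof.
move=> rp ip e; rewrite !mi_parityE par_left_set // string_mix // /bend.
have := odd_right_set i p u.2; rewrite rp !mul1n ip /e /unit_parity.
move: (odd_right i) (odd_right (set_col _ _ _)) (odd_right j) => y y' z.
case: (par u.1); case: (par u.2) => /=; rewrite ?addn0 ?addn1.
- by move=> [->] _; rewrite ?addbF.
- move=> <-; rewrite addnS triS oddD /=.
  case: (par_left i); case: (par_left j); case: (string i p);
    by case: (odd y'); case: (odd z); case: (tri _).
- move=> ->; rewrite addnS triS oddD oddS /=.
  case: (par_left i); case: (par_left j); case: (string i p);
    by case: (odd y); case: (odd z); case: (tri _).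
by move=> -> _; rewrite ?addbF.
Qed.

(** [h] is [f] with the right of its diagrams bent back, as an operator on a
    tensor power of [V]. *)
Definition bent f (h : 'End(tens)) := forall i j,
  f (e_ i) j = (-1) ^+ bend i j * h (e_ (mix i j)) (mix j i).

Lemma mix_set_out i j p c : mix (set_col (mix i j) p c) (mix j i)
  = if (p < r)%N then set_col i p c else i.
Proof.
apply/ffunP => q; have [pr|pr] := ltnP p r; rewrite !ffunE.
  by have [->|_] := eqVneq q p; rewrite ?pr //; case: (q < r)%N.
by have [->|_] := eqVneq q p; [rewrite ltnNge pr | case: (q < r)%N].
Qed.

Lemma mix_set_in i j p c : mix (mix j i) (set_col (mix i j) p c)
  = if (p < r)%N then j else set_col j p c.
Proof.
apply/ffunP => q; have [pr|pr] := ltnP p r; rewrite !ffunE.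
  by have [->|_] := eqVneq q p; rewrite ?pr //; case: (q < r)%N.
by have [->|_] := eqVneq q p; [rewrite ltnNge pr | case: (q < r)%N].
Qed.

Definition unit_sum u : 'End(tens) := \sum_p unit_op F u p.

Lemma unit_sum_basis u a : unit_sum u (e_ a)
  = \sum_p koszul (unit_parity u) a p *:
      \sum_c ((c == u.1) && (a p == u.2))%:R *: e_ (set_col a p c).
Proof.
rewrite sum_lfunE; apply: eq_bigr => p _; rewrite unit_op_basis.
rewrite (bigD1 u.1) //= eqxx big1 ?addr0 => [|c /negPf->]; last by rewrite scale0r.
by case: eqP; rewrite ?scale1r ?scale0r ?scaler0.
Qed.

Lemma bent_commutator f h u i j : bent f h -> end_homog false f ->
  let e := unit_parity u in
  \sum_p out_term f e u i j p - \sum_p in_term f e u i j p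
  = (-1) ^+ bend i j *
    (h (unit_sum u (e_ (mix i j))) (mix j i) - unit_sum u (h (e_ (mix i j))) (mix j i)).
Proof.
move=> fh f_even e; have f0 i' j' : mi_parity i' != mi_parity j' -> f (e_ i') j' = 0.
  move=> ij; apply/eqP; apply: contraNT ij => /f_even.
  by rewrite addbC; case: (mi_parity i'); case: (mi_parity j').
pose y (p : T) c c' : F := ((c == u.1) && (c' == u.2))%:R.
rewrite (local_pre (y := y) (unit_sum_basis u)) (local_post (y := y) (unit_sum_basis u)).
rewrite /y.
rewrite mulrBr !mulr_sumr; congr (_ - _); apply: eq_bigr => p _.
  rewrite /out_term; have [ap|ap] := eqVneq (mix i j p) u.2; last first.
    by rewrite big1 ?mulr0 // => c _; rewrite andbF mulr0 mul0r.
  rewrite (bigD1 u.1) //= eqxx mulr1 big1 ?addr0 => [|c /negPf->]; last first.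
    by rewrite mulr0 mul0r.
  have := mix_set_out i j p u.1; have := mix_set_in i j p u.1.
  set a' := set_col (mix i j) p u.1 => Ej Ei.
  have hE : h (e_ a') (mix j i) = (-1) ^+ bend (mix a' (mix j i)) (mix (mix j i) a')
      * f (e_ (mix a' (mix j i))) (mix (mix j i) a').
    by rewrite fh mulrA -signr_addb addbb mul1r !mixK.
  rewrite hE Ei Ej; have [pr|pr] := ltnP p r.
    have -> : bend (set_col i p u.1) j = bend i j.
      have := odd_right_set i p u.1; rewrite leqNgt pr !mul0n !addn0.
      by rewrite /bend => ->.
    rewrite [koszul e (mix i j) p * _]mulrCA signrMK.
    congr (_ ^+ (_ && _) * _); apply: eq_bigr => q qp.
    by rewrite ffunE (ltn_trans qp pr).
  have [ij|/f0->] := eqVneq (mi_parity i) (mi_parity (set_col j p u.1)); last first.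
    by rewrite !mulr0.
  have jp : j p = u.2 by move: ap; rewrite ffunE ltnNge pr.
  have := bend_out pr jp ij; rewrite /koszul -/e.
  move: (f _ _) => g; case: (bend _ _); case: (bend _ _); case: (e && _); case: (e && _);
    by case: (e && _) => //= _; rewrite !(mulr1, mul1r, mulrN, mulNr, opprK).
rewrite /in_term; have [bp|bp] := eqVneq (mix j i p) u.1; last first.
  by rewrite big1 ?mulr0 // => c _; rewrite mulr0 mul0r.
rewrite (bigD1 u.2) //= eqxx mulr1 big1 ?addr0 => [|c /negPf->]; last first.
  by rewrite mulr0 mul0r.
have := mix_set_out j i p u.2; have := mix_set_in j i p u.2.
set b' := set_col (mix j i) p u.2 => Ei Ej.
have hE : h (e_ (mix i j)) b' = (-1) ^+ bend (mix (mix i j) b') (mix b' (mix i j))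
    * f (e_ (mix (mix i j) b')) (mix b' (mix i j)).
  by rewrite fh mulrA -signr_addb addbb mul1r !mixK.
rewrite hE Ei Ej; have [pr|pr] := ltnP p r.
  have -> : bend i (set_col j p u.2) = bend i j.
    have := odd_right_set j p u.2; rewrite leqNgt pr !mul0n !addn0.
    by rewrite /bend => ->.
  rewrite [koszul e (mix j i) p * _]mulrCA signrMK.
  congr (_ ^+ (_ && _) * _); apply: eq_bigr => q qp.
  by rewrite ffunE (ltn_trans qp pr).
have [ij|/f0->] := eqVneq (mi_parity (set_col i p u.2)) (mi_parity j); last first.
  by rewrite !mulr0.
have ip : i p = u.1 by move: bp; rewrite ffunE ltnNge pr.
have := bend_in pr ip ij; rewrite /koszul -/e.
move: (f _ _) => g; case: (bend _ _); case: (bend _ _); case: (e && _); case: (e && _);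
  by case: (e && _) => //= _; rewrite !(mulr1, mul1r, mulrN, mulNr, opprK).
Qed.

End GlAction.

(** * The image and the kernel *)

Section Psi.
Variables (F : numFieldType) (m n r s : nat).
Local Notation T := 'I_(r + s).
Local Notation C := 'I_(m + n).
Local Notation col := (multi_index m n r s).
Local Notation tens := (mixed_tensor F m n r s).
Local Notation par := (@parity m n).
Local Notation e_ := (basis_vec F).
Local Notation PsiF := (Psi F m n r s).
Implicit Types (i j a b : col) (p : T) (c : C) (u : C * C) (w : tens) (e : bool).
Implicit Types (f h : 'End(tens)) (d : diagram r s) (x : wb_alg F r s).

Lemma coord_ext f h : (forall i j, f (e_ i) j = h (e_ i) j) -> f = h.
Proof. by move=> fh; apply/lfunP; apply: basis_ext => i; apply/ffunP. Qed.

Lemma diagram_act_coord d i j : diagram_act F m n d (e_ i) j = wt F i d j.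
Proof.
rewrite /diagram_act lin_ext_basis sum_ffunE (bigD1 j) //= big1 ?addr0.
  by rewrite !ffunE eqxx [LHS]mulr1.
by move=> b /negPf bj; rewrite !ffunE eq_sym bj [LHS]mulr0.
Qed.

Lemma PsiE x w : PsiF x w = \sum_d x d *: diagram_act F m n d w.
Proof.
rewrite /Psi [x in LHS]ffun_basis linear_sum sum_lfunE; apply: eq_bigr => d _.
by rewrite linearZ /= lin_ext_basis scale_lfunE.
Qed.

Lemma Psi_coord x i j : PsiF x (e_ i) j = \sum_d x d * wt F i d j.
Proof.
by rewrite PsiE sum_ffunE; apply: eq_bigr => d _; rewrite ffunE diagram_act_coord.
Qed.

Definition perm_alg x : {ffun {perm T} -> F^o} := [ffun t => x (perm_diag t)].

Definition diag_alg (y : {ffun {perm T} -> F^o}) : wb_alg F r s :=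
  [ffun d => y (diag_perm d)].

Lemma diag_algK y : perm_alg (diag_alg y) = y.
Proof. by apply/ffunP => t; rewrite !ffunE perm_diagK. Qed.

Lemma perm_algK x : diag_alg (perm_alg x) = x.
Proof. by apply/ffunP => d; rewrite !ffunE diag_permK. Qed.

Lemma Psi_coord_perm x i j : PsiF x (e_ i) j = (-1) ^+ bend i j *
  \sum_t perm_alg x t * signed_perm F t (mix i j) (mix j i).
Proof.
have bij : bijective (@perm_diag r s).
  by exists (@diag_perm r s); [exact: perm_diagK | exact: diag_permK].
rewrite Psi_coord mulr_sumr (reindex _ (onW_bij predT bij)) /=.
by apply: eq_bigr => t _; rewrite wt_signed_perm perm_diagK ffunE mulrCA.
Qed.

Lemma Psi_bent x : bent (PsiF x) (group_rep F m n (r + s) (perm_alg x)).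
Proof.
move=> i j; rewrite Psi_coord_perm group_repE sum_ffunE; congr (_ * _).
by apply: eq_bigr => t _; rewrite -rho_coef [RHS]ffunE.
Qed.

Lemma group_rep_unit_sum y u w :
  group_rep F m n (r + s) y (unit_sum F r s u w)
  = unit_sum F r s u (group_rep F m n (r + s) y w).
Proof.
rewrite !group_repE linear_sum; apply: eq_bigr => t _; rewrite linearZ /=.
congr (_ *: _); rewrite !sum_lfunE linear_sum [RHS](reindex_inj (@perm_inj _ t)).
by apply: eq_bigr => p _; rewrite /= rho_unit_op.
Qed.

Lemma mi_parity_mix i j :
  mi_parity (mix i j) (+) mi_parity (mix j i) = mi_parity i (+) mi_parity j.
Proof.
rewrite /mi_parity -!oddD -!big_split; congr odd; apply: eq_bigr => p _.
by rewrite !ffunE; case: (p < r)%N => //; apply: addnC.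
Qed.

Lemma Psi_even x : end_homog false (PsiF x).
Proof.
move=> j i; rewrite Psi_coord => ne0; rewrite addbC -mi_parity_mix.
have [d] : exists d, wt F i d j != 0.
  apply/existsP; apply: contraNT ne0 => /existsPn d0; rewrite big1 // => d _.
  by have /negPn/eqP-> := d0 d; rewrite mulr0.
rewrite wt_signed_perm mulf_eq0 negb_or signed_perm_neq0 => /andP[_ /forallP H].
suff -> : mi_parity (mix i j) = mi_parity (mix j i) by rewrite addbb.
rewrite /mi_parity [in RHS](reindex_inj (@perm_inj _ (diag_perm d))); congr odd.
by apply: eq_bigr => p _; rewrite (eqP (H p)).
Qed.

Lemma gl_act_units e (x : 'M[F]_(m + n)) w : gl_act r s e x w
  = \sum_k \sum_l x k l *: gl_act r s e (gl_unit F (k, l)) w.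
Proof.
transitivity ((\sum_k \sum_l x k l *: gl_act r s e (gl_unit F (k, l)))%VF w); last first.
  rewrite sum_lfunE; apply: eq_bigr => k _; rewrite sum_lfunE.
  by apply: eq_bigr => l _; rewrite scale_lfunE.
move: w; apply: basis_ext => i; rewrite sum_lfunE.
under eq_bigr => k _ do rewrite sum_lfunE.
under eq_bigr => k _ do under eq_bigr => l _ do
  rewrite scale_lfunE gl_act_basis scaler_sumr.
under eq_bigr => k _ do rewrite exchange_big.
rewrite exchange_big gl_act_basis; apply: eq_bigr => p _ /=.
pose g k l c := gl_coef e (gl_unit F (k, l)) p c (i p).
have E k l : x k l *: (koszul F e i p *: \sum_c g k l c *: e_ (set_col i p c))
    = koszul F e i p *: \sum_c (x k l * g k l c) *: e_ (set_col i p c).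
  transitivity (koszul F e i p *: (x k l *: \sum_c g k l c *: e_ (set_col i p c))).
    by rewrite !scalerA mulrC.
  by congr (_ *: _); rewrite scaler_sumr; apply: eq_bigr => c _; rewrite scalerA.
rewrite [RHS](eq_bigr (fun k => koszul F e i p *:
    \sum_c (\sum_l x k l * g k l c) *: e_ (set_col i p c))); last first.
  move=> k _; rewrite (eq_bigr _ (fun l _ => E k l)) -scaler_sumr exchange_big.
  by congr (_ *: _); apply: eq_bigr => c _; rewrite -scaler_suml.
rewrite -scaler_sumr exchange_big; congr (_ *: _); apply: eq_bigr => c _ /=.
rewrite -scaler_suml; congr (_ *: _); rewrite gl_coefE /g.
have [pr|/negPf pr] := boolP (p < r)%N.
  under eq_bigr => k _ do under eq_bigr => l _ do rewrite gl_coefE pr gl_unitE /=.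
  rewrite (bigD1 c) //= (bigD1 (i p)) //= !eqxx mulr1 !big1 ?addr0 //.
    by move=> k /negPf kc; rewrite big1 // => l _; rewrite eq_sym kc mulr0.
  by move=> l /negPf li; rewrite eq_sym li mulr0.
under eq_bigr => k _ do under eq_bigr => l _ do rewrite gl_coefE pr gl_unitE /=.
rewrite (bigD1 (i p)) //= (bigD1 c) //= !eqxx mulr1 !big1 ?addr0.
- by rewrite mulrN mulrC.
- by move=> k /negPf kc; rewrite big1 // => l _; rewrite eq_sym kc mulr0 oppr0 mulr0.
by move=> l /negPf li; rewrite eq_sym li andbF mulr0 oppr0 mulr0.
Qed.

Lemma Psi_supercommutes x : supercommutes (PsiF x).
Proof.
exists (fun e => if e then 0 else PsiF x); split=> [|[]|e e' y w y_e].
- by rewrite addr0.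
- by move=> i j; rewrite zero_lfunE ffunE eqxx.
- exact: Psi_even.
case: e'; first by rewrite !zero_lfunE linear0 scaler0.
rewrite andbF expr0 scale1r !gl_act_units linear_sum; apply: eq_bigr => k _.
rewrite linear_sum; apply: eq_bigr => l _; rewrite linearZ /=.
have [->|/y_e ekl] := eqVneq (y k l) 0; first by rewrite !scale0r.
congr (_ *: _); rewrite -!comp_lfunE; move: w; apply/lfunP/coord_ext => i j.
apply/eqP; rewrite eq_sym -subr_eq0 !comp_lfunE gl_unit_commutator -ekl.
rewrite (bent_commutator (k, l) _ _ (Psi_bent x) (@Psi_even x)).
by rewrite group_rep_unit_sum subrr mulr0.
Qed.

(** The diagonal matrix units show that an operator commuting with them preserves
    the number of vertices of each colour, in particular the parity. *)
Lemma odd_commuting0 f : end_homog true f ->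
  (forall c w, gl_act r s false (gl_unit F (c, c)) (f w)
               = f (gl_act r s false (gl_unit F (c, c)) w)) -> f = 0.
Proof.
move=> f_odd fC; apply: coord_ext => i j; rewrite zero_lfunE ffunE.
apply/eqP; apply: contraT => fij.
pose cnt a c := (\sum_p (a p == c))%N.
have cntE c : cnt (mix i j) c = cnt (mix j i) c.
  have := gl_unit_commutator f false (c, c) i j; rewrite fC subrr => /esym/eqP.
  have setc a p : a p = c -> set_col a p c = a.
    by move=> ap; apply/ffunP => q; rewrite ffunE; case: eqP => // ->.
  have -> : \sum_p out_term f false (c, c) i j p = f (e_ i) j *+ cnt (mix i j) c.
    rewrite -sumrMnr; apply: eq_bigr => p _; rewrite /out_term /koszul /= !mul1r.
    by have [|//] := eqVneq (mix i j p) c; rewrite ffunE; case: ifP => _ /setc->.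
  have -> : \sum_p in_term f false (c, c) i j p = f (e_ i) j *+ cnt (mix j i) c.
    rewrite -sumrMnr; apply: eq_bigr => p _; rewrite /in_term /koszul /= !mul1r.
    by have [|//] := eqVneq (mix j i p) c; rewrite ffunE; case: ifP => _ /setc->.
  rewrite subr_eq0 -[_ *+ cnt _ _]mulr_natr -[X in _ == X]mulr_natr => /eqP/(mulfI fij)/eqP.
  by rewrite eqr_nat => /eqP.
have parE a : (\sum_p par (a p) = \sum_c par c * cnt a c)%N.
  under [RHS]eq_bigr => c _ do rewrite /cnt big_distrr.
  rewrite exchange_big; apply: eq_bigr => p _ /=.
  rewrite (bigD1 (a p)) //= eqxx muln1 big1 ?addn0 // => c /negPf cp.
  by rewrite eq_sym cp muln0.
have := mi_parity_mix i j; rewrite /mi_parity !parE.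
under eq_bigr => c _ do rewrite cntE.
by rewrite addbb -!parE -!/(mi_parity _) addbC (f_odd _ _ fij).
Qed.

(** Bent back, the even component of [f] commutes with the matrix units acting on
    the tensor power of [V]. *)
Theorem Psi_surjective f : supercommutes f -> exists x, PsiF x = f.
Proof.
case=> g [-> g_homog gC].
have -> : g true = 0.
  apply: odd_commuting0 => [|c w]; first exact: g_homog.
  rewrite gC ?expr0 ?scale1r // => k l; rewrite gl_unitE.
  by case: (eqVneq k c) => [->|]; case: (eqVneq l c) => [->|]; rewrite ?eqxx // addbb.
rewrite addr0; set f0 := g false; have f_even : end_homog false f0 := g_homog false.
pose h : 'End(tens) := lin_ext (fun a => \sum_b
  ((-1) ^+ bend (mix a b) (mix b a) * f0 (e_ (mix a b)) (mix b a)) *: e_ b).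
have h_bent : bent f0 h.
  move=> i j; rewrite lin_ext_basis sum_ffunE (bigD1 (mix j i)) //= big1 ?addr0.
    by rewrite !ffunE eqxx [X in _ * X]mulr1 !mixK signrMK.
  by move=> b /negPf bj; rewrite !ffunE eq_sym bj [LHS]mulr0.
have hC u w : h (\sum_p unit_op F u p w) = \sum_p unit_op F u p (h w).
  rewrite -!sum_lfunE -!comp_lfunE; move: w; apply/lfunP/coord_ext => a b.
  rewrite !comp_lfunE; apply/eqP; rewrite -subr_eq0.
  have /= := bent_commutator u (mix a b) (mix b a) h_bent f_even.
  rewrite -gl_unit_commutator gC ?expr0 ?scale1r; last first.
    move=> k l; rewrite gl_unitE.
    by have [->|_] := eqVneq k u.1; have [->|_] := eqVneq l u.2; rewrite //= eqxx.
  rewrite andbF expr0 scale1r subrr !mixK => /esym/eqP.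
  by rewrite mulf_eq0 signr_eq0.
have [y hy] := commutant_span hC.
exists (diag_alg y); apply: coord_ext => i j.
by rewrite Psi_bent diag_algK -hy -h_bent.
Qed.

(** Bending only changes signs, so the kernel consists of the relations between
    signed permutations. *)
Theorem Psi_injective : injective PsiF <-> (r + s < (m + 1) * (n + 1))%N.
Proof.
rewrite !addn1; split=> [Psi_inj | rs_lt]; last first.
  move=> x x' /eqP; rewrite -subr_eq0 -linearB => /eqP xx'; apply/eqP.
  rewrite -subr_eq0 -[x - x']perm_algK; apply/eqP.
  suff -> : perm_alg (x - x') = 0 by apply/ffunP => d; rewrite !ffunE.
  apply: (perm_relation0 rs_lt) => a b; apply/eqP.
  have := Psi_coord_perm (x - x') (mix [ffun p => a p] [ffun p => b p])
                                  (mix [ffun p => b p] [ffun p => a p]).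
  rewrite xx' zero_lfunE ffunE => /esym/eqP; rewrite mulf_eq0 signr_eq0 /=.
  rewrite !mixK; congr (_ == 0); apply: eq_bigr => t _; congr (_ * _).
  by apply: eq_perm_kernel => p; rewrite ffunE.
rewrite ltnNge; apply/negP => /perm_relation_nz-/(_ F)[y Ky /eqP y0].
apply: y0; rewrite -[y]diag_algK.
suff -> : diag_alg y = 0 by apply/ffunP => t; rewrite !ffunE.
apply: Psi_inj; rewrite linear0; apply: coord_ext => i j.
by rewrite Psi_coord_perm diag_algK Ky mulr0 zero_lfunE ffunE.
Qed.

End Psi.

(** * Contracting a signed permutation *)

Section Contraction.
Variables (F : numFieldType) (X : finType) (f : X -> nat).
Hypothesis f_inj : injective f.
Implicit Types (x y z : X) (M : {set X}) (t : {perm X}).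

Definition update (C : Type) (a : X -> C) z v : X -> C :=
  fun x => if x == z then v else a x.

Definition reset (C : Type) M (a0 a : X -> C) : X -> C :=
  fun x => if x \in M then a0 x else a x.

(** If the last points, from [z] on, are fixed, then no inversion involves [z]. *)
Lemma inv_parity_last (o o' : X -> bool) t z :
  (forall x, x != z -> o x = o' x) -> t z = z ->
  (forall x, (f z < f x)%N -> t x = x) ->
  inv_parity f o t = inv_parity f o' t.
Proof.
move=> oo tz tlast; apply: eq_pair_parity => x y xy.
have below u : (f u < f z)%N -> (f (t u) < f z)%N.
  move=> uz; rewrite ltn_neqAle (inj_eq f_inj) leqNgt; apply/andP; split.
    by apply: contraTneq uz => tu; rewrite -(perm_inj (etrans tu (esym tz))) ltnn.
  apply: contraL uz => tuz; rewrite -leqNgt.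
  by rewrite -(perm_inj (tlast _ tuz)) ltnW.
have [xz|xz] := eqVneq x z.
  move: xy; rewrite xz tz => zy; rewrite (tlast y zy).
  by rewrite [(f y < f z)%N]ltnNge (ltnW zy) !andbF.
have [yz|yz] := eqVneq y z; last by rewrite !oo.
move: xy; rewrite yz tz => /below xz'.
by rewrite [(f z < _)%N]ltnNge (ltnW xz') !andbF.
Qed.

Section OnePoint.
Variables (C : finType) (par : C -> bool).
Local Notation K := (perm_kernel F f par).
Let delta : F := \sum_(c : C) (-1) ^+ par c.

(** The strands ending and starting at [z] are joined; if they are one strand, it
    becomes a circle, which contributes the superdimension. *)
Lemma contract_last t z (a b : X -> C) v0 : (forall x, (f z < f x)%N -> t x = x) ->
  \sum_v (-1) ^+ par v * K t (update a z v) (update b z v)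
  = delta ^+ (t z == z)
    * K (tperm (t^-1%g z) z * t)%g (update a z v0) (update b z v0).
Proof.
move=> tlast; pose o v x := par (update a z v x).
have o_eq v v' x : x != z -> o v x = o v' x.
  by rewrite /o /update => /negPf->.
have [tz|tz] := eqVneq (t z) z.
  have -> : (t^-1%g z) = z by rewrite -{1}tz permK.
  rewrite tperm1 mul1g expr1 /delta mulr_suml; apply: eq_bigr => v _; congr (_ * _).
  rewrite /perm_kernel (inv_parity_last (o' := o v0) _ tz) //; last exact: o_eq.
  congr (if _ then _ else _); apply: eq_forallb => x; rewrite /update.
  have -> : (t x == z) = (x == z) by rewrite -{1}tz (inj_eq perm_inj).
  by case: (eqVneq x z); rewrite ?eqxx.
rewrite expr0 mul1r; set w := t^-1%g z; have tw : t w = z by rewrite permKV.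
have wz : w != z by apply: contraNneq tz => wz; rewrite -{1}wz tw.
set t' := (tperm w z * t)%g.
have t'z : t' z = z by rewrite permM tpermR tw.
have t'last x : (f z < f x)%N -> t' x = x.
  move=> zx; rewrite permM; case: tpermP => [xw|xz|_ _]; last exact: tlast.
    by move: (tlast x zx); rewrite xw tw => zw; rewrite -zw eqxx in wz.
  by rewrite xz ltnn in zx.
rewrite (bigD1 (a w)) //= [X in _ + X]big1 ?addr0 => [|v va]; last first.
  rewrite /perm_kernel; case: ifP; rewrite ?mulr0 // => /forallP/(_ w).
  by rewrite /update tw eqxx (negPf wz) (negPf va).
have Kv0 : K t' (update a z v0) (update b z v0)
         = K t' (update a z (a w)) (update b z (a w)).
  rewrite /perm_kernel (inv_parity_last (o' := o (a w)) _ t'z t'last); last exact: o_eq.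
  congr (if _ then _ else _); apply: eq_forallb => x; rewrite /update.
  have -> : (t' x == z) = (x == z) by rewrite -{1}t'z (inj_eq perm_inj).
  by case: (eqVneq x z); rewrite ?eqxx.
rewrite Kv0 /t' perm_kernel_tperm //; last by rewrite /update eqxx (negPf wz).
by rewrite /update (negPf wz).
Qed.

(** The partial supertrace over [M] of a signed permutation. *)
Definition contraction M t (a b : X -> C) : F :=
  \sum_(c : {ffun X -> C} | [forall x in ~: M, c x == a x])
    (-1) ^+ (\big[addb/false]_(x in M) par (c x)) * K t c (reset M c b).

Lemma contractionD1 M t a b z v0 : z \in M ->
  contraction M t a b
  = \sum_(c : {ffun X -> C} | [forall x in ~: (M :\ z), c x == update a z v0 x])
    (-1) ^+ (\big[addb/false]_(x in M :\ z) par (c x)) *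
    \sum_v (-1) ^+ par v * K t (update c z v) (update (reset (M :\ z) c b) z v).
Proof.
move=> zM; rewrite /contraction.
under [RHS]eq_bigr => c _ do rewrite mulr_sumr.
rewrite exchange_big /= (partition_big (fun c : {ffun X -> C} => c z) predT) //=.
apply: eq_bigr => v _.
pose g (c : {ffun X -> C}) : {ffun X -> C} := [ffun x => if x == z then v else c x].
pose g' (c : {ffun X -> C}) : {ffun X -> C} := [ffun x => if x == z then v0 else c x].
rewrite (reindex_onto g g'); last first.
  move=> c /andP[_ /eqP cz]; apply/ffunP => x; rewrite !ffunE.
  by case: eqP => // ->.
apply: eq_big => c.
  apply/andP/forall_inP => [[/andP[/forall_inP H _] /eqP gc] x | H].
    rewrite inE in_setD1 negb_and negbK /update => /orP[/eqP->|xM].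
      by rewrite -gc ffunE !eqxx.
    have := H x; rewrite inE => /(_ xM); rewrite /g ffunE.
    by have [xz|//] := eqVneq x z; rewrite xz zM in xM.
  have cz : c z = v0 by have := H z; rewrite !inE /update !eqxx => /(_ isT)/eqP.
  split; last by apply/eqP/ffunP => x; rewrite !ffunE; case: eqP => // ->.
  have -> : g c z = v by rewrite ffunE eqxx.
  rewrite eqxx andbT; apply/forall_inP => x; rewrite inE => xM.
  have xz : x != z by apply: contraNneq xM => ->.
  by have := H x; rewrite !inE (negPf xM) andbF /update ffunE (negPf xz); apply.
case/andP=> _ /eqP gc; rewrite mulrA -signr_addb; congr (_ ^+ _ * _).
  rewrite (bigD1 z) //= ffunE eqxx addbC; congr addb.
  apply: eq_big => x; first by rewrite in_setD1 andbC.
  by move=> /andP[_ /negPf xz]; rewrite ffunE xz.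
apply: eq_perm_kernel => x; first by rewrite ffunE.
by rewrite /reset /update in_setD1 ffunE; case: eqP => //= ->; rewrite zM.
Qed.

End OnePoint.

(** The points of [M] come last, up to fixed points, and are contracted from the
    last one on.  The resulting permutation and number of circles do not depend on the colours. *)
Lemma contract M t : (forall z x, z \in M -> x \notin M -> (f z < f x)%N -> t x = x) ->
  exists n t', [/\ forall x, x \in M -> t' x = x, forall x, t x = x -> t' x = x &
    forall (C : finType) (par : C -> bool) (a b a0 : X -> C),
      contraction par M t a b = (\sum_(c : C) (-1) ^+ par c) ^+ n
        * perm_kernel F f par t' (reset M a0 a) (reset M a0 b)].
Proof.
move: {2}#|M| (erefl #|M|) => d; elim: d M t => [|d IHd] M t Md tM.
  have M0 : M = set0 by apply/eqP; rewrite -cards_eq0 Md.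
  exists 0%N, t; split=> // [x | C par a b a0]; first by rewrite M0 inE.
  pose c0 : {ffun X -> C} := [ffun x => a x].
  rewrite /contraction (big_pred1 c0) => [|c]; last first.
    apply/forall_inP/eqP => [H | -> x _]; last by rewrite ffunE.
    by apply/ffunP => x; have := H x; rewrite M0 !inE ffunE => /(_ isT)/eqP.
  rewrite M0 big_set0 expr0 !mul1r; apply: eq_perm_kernel => x.
    by rewrite ffunE /reset inE.
  by rewrite /reset inE.
have /card_gt0P[y yM] : (0 < #|M|)%N by rewrite Md.
have [z zM' zmax] := arg_maxnP f yM.
have {zM'}zM : z \in M := zM'.
have tlast x : (f z < f x)%N -> t x = x.
  move=> zx; apply: (tM z) => //; apply: contraL zx => /zmax.
  by rewrite -leqNgt.
set t1 := (tperm (t^-1%g z) z * t)%g.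
have t1z : t1 z = z by rewrite permM tpermR permKV.
have t1fix x : t x = x -> t1 x = x.
  move=> tx; rewrite permM; case: tpermP => [xw|xz|_ _] //.
    have xz : x = z by rewrite -[LHS]tx xw permKV.
    by rewrite -xz.
  by rewrite permKV.
have [|z' x /setD1P[_ z'M]|n [t' [t'M t'fix t'E]]] := IHd (M :\ z) t1.
- by move: Md; rewrite (cardsD1 z) zM => -[].
- rewrite in_setD1 negb_and negbK => /orP[/eqP-> _ //|xM] z'x.
  by apply: t1fix; apply: (tM z').
exists ((t z == z) + n)%N, t'; split=> [x xM | x tx | C par a b a0].
- have [->|xz] := eqVneq x z; first exact: t'fix.
  by apply: t'M; rewrite in_setD1 xz.
- by apply: t'fix; apply: t1fix.
rewrite (contractionD1 _ _ _ _ (a0 z) zM).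
transitivity ((\sum_(c : C) (-1) ^+ par c) ^+ (t z == z) *
    contraction par (M :\ z) t1 (update a z (a0 z)) (update b z (a0 z))).
  rewrite mulr_sumr; apply: eq_bigr => c /forall_inP cP.
  rewrite (contract_last _ _ _ (a0 z) tlast) mulrCA; congr (_ * (_ * _)).
  have cz : c z = a0 z.
    by have := cP z; rewrite !inE /update !eqxx => /(_ isT)/eqP.
  apply: eq_perm_kernel => x; rewrite /update; first by case: eqP => // ->.
  by rewrite /reset in_setD1; case: eqP.
rewrite (t'E _ _ _ _ a0) mulrA -exprD; congr (_ * _).
by apply: eq_perm_kernel => x; rewrite /reset /update in_setD1;
   case: eqP => [->|] //=; rewrite zM.
Qed.

End Contraction.

(** * Stacking two diagrams *)

Lemma pair_parity_product (X : finType) (f : X -> nat) (u v : X -> bool) :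
  (forall x y, u x -> v y -> (f x < f y)%N) ->
  pair_parity f (fun x y => u x && v y)
  = (\big[addb/false]_x u x) && (\big[addb/false]_x v x).
Proof.
move=> uv; rewrite big_distrlr pair_bigA /pair_parity big_mkcond /=.
apply: eq_bigr => -[x y] _ /=; case: ifPn => // xy.
by apply/esym/negbTE; apply: contra xy => /andP[/uv]; apply.
Qed.

(** Inversions with respect to another rank, after renaming the images by [g]:
    the pairs of letters before and after the permutation are reordered. *)
Lemma inv_parity_rank (X : finType) (f f0 : X -> nat) (o : X -> bool) (t g : {perm X}) :
  injective f -> injective f0 ->
  inv_parity f o (t * g) = inv_parity f0 o t
    (+) pair_parity f0 (fun x y => [&& o x, o y & (f y < f x)%N])
    (+) pair_parity f0 (fun x y =>
          [&& o (t^-1%g x), o (t^-1%g y) & (f (g y) < f (g x))%N]).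
Proof.
move=> fi f0i.
have swap (u v : X -> nat) x y : injective u -> injective v ->
    (u y < u x)%N (+) (v y < v x)%N = (u x < u y)%N (+) (v x < v y)%N.
  move=> ui vi; have [-> // | xy] := eqVneq x y.
  have := inj_eq ui x y; have := inj_eq vi x y; rewrite (negPf xy).
  by case: (ltngtP (u x)); case: (ltngtP (v x)).
have gi : injective (fun x => f (g x)) by move=> x y /fi/perm_inj.
have ti : injective (fun x => f0 (t x)) by move=> x y /f0i/perm_inj.
have gti : injective (fun x => f (g (t x))) by move=> x y /fi/perm_inj/perm_inj.
transitivity (pair_parity f0 (fun x y => [&& o x, o y &
    (f y < f x)%N (+) (f (g (t y)) < f (g (t x)))%N])).
  rewrite (pair_parity_rank (g := f)) //; last first.
    by move=> x y; rewrite (swap f (fun x => f (g (t x)))) // andbCA.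
  apply: eq_pair_parity => x y xy.
  by rewrite !permM [(f y < f x)%N]ltnNge (ltnW xy) addFb.
transitivity (pair_parity f0 (fun x y => [&& o x, o y & (f y < f x)%N])
   (+) pair_parity f0 (fun x y => [&& o x, o y & (f (g (t y)) < f (g (t x)))%N])).
  by rewrite -pair_parityD; apply: eq_pair_parity => x y _; case: (o x); case: (o y).
rewrite [RHS]addbAC [RHS]addbC; congr addb.
pose h x y := [&& o (t^-1%g x), o (t^-1%g y)
                & (f (g y) < f (g x))%N (+) (f0 y < f0 x)%N].
have hC x y : h x y = h y x.
  by rewrite /h (swap (fun x => f (g x)) f0) // andbCA.
transitivity (inv_parity f0 o t (+) pair_parity f0 (fun x y => h (t x) (t y))).
  rewrite -pair_parityD; apply: eq_pair_parity => x y _; rewrite /h !permK.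
  by case: (o x); case: (o y) => //=; rewrite addbCA addbb addbF.
congr addb; rewrite (pair_parity_rank (g := fun x => f0 (t x))) //.
rewrite (pair_parity_perm f0 h); apply: eq_pair_parity => x y xy.
by rewrite /h [(f0 y < f0 x)%N]ltnNge (ltnW xy) addbF.
Qed.

Section Stack.
Variables r s : nat.
Local Notation T := 'I_(r + s).
Local Notation X := (bool * T)%type.
Implicit Types (d : diagram r s) (p q : T) (x y : X).

(** The strands of two stacked diagrams, [false] for the lower one.  The order
    [rank0] keeps the diagrams apart, while [rank] takes first the strands whose
    out-vertex is outer, by position, and then those that start in the middle. *)
Definition middle : {set X} := [set x : X | x.1 == (x.2 < r)%N].

Definition rank0 x : nat := (x.1 * (r + s) + x.2)%N.

Definition rank x : nat := (if x \in middle then r + s + x.2 else x.2)%N.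

Lemma rank0_inj : injective rank0.
Proof.
move=> [e p] [e' q]; rewrite /rank0 /= => pq; have := ltn_ord p; have := ltn_ord q.
move: pq; case: e; case: e' => /= pq qk pk;
  by [congr (_, _); apply: ord_inj; lia | exfalso; lia].
Qed.

Lemma rank_inj : injective rank.
Proof.
move=> [e p] [e' q]; rewrite /rank !inE /=.
have := ltn_ord p; have := ltn_ord q => qk pk H.
have pq : p = q by apply: ord_inj; move: H; case: ifP => _; case: ifP => _; lia.
congr (_, _) => //; move: H; rewrite pq.
by case: e; case: e'; case: (q < r)%N => //=; lia.
Qed.

Definition both_fun (t1 t2 : {perm T}) x : X := (x.1, if x.1 then t2 x.2 else t1 x.2).

Lemma both_fun_inj t1 t2 : injective (both_fun t1 t2).
Proof. by move=> [[] p] [[] q] [] // /perm_inj->. Qed.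

Definition both t1 t2 : {perm X} := perm (@both_fun_inj t1 t2).

Lemma bothE t1 t2 e p : both t1 t2 (e, p) = (e, if e then t2 p else t1 p).
Proof. by rewrite permE. Qed.

(** The in-vertex of a strand in the middle is the out-vertex of a strand of the
    other diagram at the same position.  Renaming in-vertices accordingly, outer
    ones get the name of the outer out-vertex at the same position. *)
Definition glue_fun x : X := (~~ x.1, x.2).

Lemma glue_fun_inj : injective glue_fun.
Proof. by move=> [e p] [e' q] [/negb_inj-> ->]. Qed.

Definition glue : {perm X} := perm glue_fun_inj.

Lemma glueE e p : glue (e, p) = (~~ e, p).
Proof. by rewrite permE. Qed.

Definition stack_perm d1 d2 : {perm X} := (both (diag_perm d1) (diag_perm d2) * glue)%g.

Lemma big_X (h : X -> bool) : \big[addb/false]_x h x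
  = (\big[addb/false]_p h (true, p)) (+) (\big[addb/false]_p h (false, p)).
Proof.
rewrite -(big_bool _ (fun e => \big[addb/false]_p h (e, p))) pair_bigA.
by apply: eq_bigr => -[].
Qed.

Lemma inv_parity_both (o : X -> bool) t1 t2 : inv_parity rank0 o (both t1 t2)
  = inv_parity (@nat_of_ord (r + s)) (fun p => o (false, p)) t1
    (+) inv_parity (@nat_of_ord (r + s)) (fun p => o (true, p)) t2.
Proof.
have ppE (h : X -> X -> bool) : pair_parity rank0 h
    = \big[addb/false]_x \big[addb/false]_y ((rank0 x < rank0 y)%N && h x y).
  rewrite pair_bigA /pair_parity big_mkcond.
  by apply: eq_bigr => -[x y] _ /=; case: ifP.
have ppTE (h : T -> T -> bool) : pair_parity (@nat_of_ord (r + s)) h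
    = \big[addb/false]_(p : T) \big[addb/false]_(q : T) ((p < q)%N && h p q).
  rewrite pair_bigA /pair_parity big_mkcond.
  by apply: eq_bigr => -[x y] _ /=; case: ifP.
rewrite /inv_parity ppE !ppTE big_X addbC; congr addb; apply: eq_bigr => p _;
  rewrite big_X.
  rewrite [X in X (+) _]big1 ?addFb.
    by apply: eq_bigr => q _; rewrite !bothE /rank0 /= !mul0n !add0n.
  move=> q _; rewrite !bothE /rank0 /= mul0n !add0n mul1n.
  by rewrite [(_ + _ < _)%N]ltnNge (leq_trans (ltnW (ltn_ord _))) ?leq_addr ?andbF.
rewrite [X in _ (+) X]big1 ?addbF.
  by apply: eq_bigr => q _; rewrite !bothE /rank0 /= !mul1n !ltn_add2l.
move=> q _; rewrite /rank0 /= mul0n add0n mul1n.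
by rewrite [(_ + _ < _)%N]ltnNge (leq_trans (ltnW (ltn_ord _))) ?leq_addr.
Qed.

Section Colours.
Variables (F : numFieldType) (m n : nat).
Local Notation col := (multi_index m n r s).
Local Notation par := (@parity m n).
Implicit Types (i j k : col).

Definition out_colour i k j x := if x.1 then mix k j x.2 else mix i k x.2.

(** Colours of the in-vertices, under their names after glueing. *)
Definition in_colour i k j x := if x.1 then mix k i x.2 else mix j k x.2.

Definition par_right i := \big[addb/false]_(p : T | (r <= p)%N) par (i p).

Lemma odd_odd_right i : odd (odd_right i) = par_right i.
Proof. by rewrite /odd_right sum_parity; apply: eq_bigr => p _; rewrite oddb. Qed.

Definition in_block (o : X -> bool) (e left : bool) x :=
  [&& o x, x.1 == e & (x.2 < r)%N == left].

Lemma big_in_block (o : X -> bool) e left : \big[addb/false]_x in_block o e left x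
  = \big[addb/false]_(p : T | (p < r)%N == left) o (e, p).
Proof.
rewrite big_X [RHS]big_mkcond /in_block /=.
case: e => /=; [rewrite [X in _ (+) X]big1 ?addbF | rewrite [X in X (+) _]big1 ?addFb];
  try (by move=> p _; rewrite andbF);
  by apply: eq_bigr => p _; case: ifP => _; rewrite ?andbT ?andbF.
Qed.

Lemma big_left (h : T -> bool) : \big[addb/false]_(p : T | (p < r)%N == true) h p
  = \big[addb/false]_(p : T | (p < r)%N) h p.
Proof. by apply: eq_bigl => p; rewrite eqb_id. Qed.

Lemma big_right (h : T -> bool) : \big[addb/false]_(p : T | (p < r)%N == false) h p
  = \big[addb/false]_(p : T | (r <= p)%N) h p.
Proof. by apply: eq_bigl => p; rewrite eqbF_neg -leqNgt. Qed.

Lemma out_order (o : X -> bool) x y : (rank0 x < rank0 y)%N ->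
  [&& o x, o y & (rank y < rank x)%N]
  = (in_block o false false x && in_block o true true y)
    (+) (in_block o false false x && in_block o true false y)
    (+) (in_block o true true x && in_block o true false y).
Proof.
case: x y => [e p] [e' q]; rewrite /rank0 /rank /in_block !inE /=.
case: (o (e, p)); case: (o (e', q)); rewrite ?andbF //=.
have := ltn_ord p; have := ltn_ord q.
case: e; case: e' => /=; case: (ltnP p r) => pr; case: (ltnP q r) => qr qk pk pq /=;
  rewrite ?(eqxx, eqbF_neg) /=;
  first [by apply/idP; lia | by apply/negbTE; rewrite -leqNgt; lia].
Qed.

Lemma in_order (o : X -> bool) x y : (rank0 x < rank0 y)%N ->
  [&& o x, o y & (rank (glue y) < rank (glue x))%N]
  = (in_block o false true x && in_block o false false y)
    (+) (in_block o false true x && in_block o true true y)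
    (+) (in_block o false false x && in_block o true true y).
Proof.
case: x y => [e p] [e' q]; rewrite !glueE /rank0 /rank /in_block !inE /=.
case: (o (e, p)); case: (o (e', q)); rewrite ?andbF //=.
have := ltn_ord p; have := ltn_ord q.
case: e; case: e' => /=; case: (ltnP p r) => pr; case: (ltnP q r) => qr qk pk pq /=;
  rewrite ?(eqxx, eqbF_neg) /=;
  first [by apply/idP; lia | by apply/negbTE; rewrite -leqNgt; lia].
Qed.

Lemma block_lt (o o' : X -> bool) (e l e' l' : bool) x y :
  (~~ e && e') || (e == e') && (l && ~~ l') ->
  in_block o e l x -> in_block o' e' l' y -> (rank0 x < rank0 y)%N.
Proof.
case: x y => [c p] [c' q] H /and3P[_ /eqP /= -> /eqP pr] /and3P[_ /eqP /= -> /eqP qr].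
move: H pr qr; rewrite /rank0 /=; have := ltn_ord p; have := ltn_ord q.
case: e; case: e'; case: l; case: l' => //= qk pk _; lia.
Qed.

Lemma mixL i j p : (p < r)%N -> mix i j p = i p.
Proof. by rewrite ffunE => ->. Qed.

Lemma mixR i j p : (r <= p)%N -> mix i j p = j p.
Proof. by rewrite ffunE ltnNge => ->. Qed.

(** With [x_L], [x_R] the parities of the numbers of odd
    colours of the row [x] on the left and on the right, renaming the strands
    reorders [k_R k_L + k_L j_R + k_R j_R] pairs of odd out-vertices and
    [k_L i_R + k_L j_L + i_R j_L] of odd in-vertices, and both diagrams impose
    a balance between their rows. *)
Lemma wt_stack d1 d2 i k j : wt F i d1 k * wt F k d2 j
  = (-1) ^+ bend i j * ((-1) ^+ (\big[addb/false]_(x in middle) par (out_colour i k j x))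
      * perm_kernel F rank par (stack_perm d1 d2) (out_colour i k j) (in_colour i k j)).
Proof.
rewrite !wt_signed_perm mulrACA -signr_addb /signed_perm /perm_kernel.
set t1 := diag_perm d1; set t2 := diag_perm d2.
have stackE e p : stack_perm d1 d2 (e, p) = (~~ e, if e then t2 p else t1 p).
  by rewrite permM bothE glueE.
have -> : [forall x, in_colour i k j (stack_perm d1 d2 x) == out_colour i k j x]
  = [forall p, mix k i (t1 p) == mix i k p] && [forall p, mix j k (t2 p) == mix k j p].
  apply/forallP/andP => [H | [/forallP H1 /forallP H2] [[] p]].
  - by split; apply/forallP => p; [have := H (false, p) | have := H (true, p)];
       rewrite stackE.
  - by rewrite stackE /in_colour /out_colour /=; apply: H2.
  by rewrite stackE /in_colour /out_colour /=; apply: H1.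
case: (boolP [forall p, mix k i (t1 p) == _]) => [/forallP c1|_]; last first.
  by rewrite mul0r !mulr0.
case: (boolP [forall p, mix j k (t2 p) == _]) => [/forallP c2|_]; last first.
  by rewrite !mulr0.
rewrite -!signr_addb; congr (_ ^+ _).
pose oa x := par (out_colour i k j x).
pose ob x := oa ((both t1 t2)^-1%g x).
have obE e p : ob (e, p) = par (if e then mix j k p else mix k i p).
  rewrite /ob /oa.
  have -> : (both t1 t2)^-1%g (e, p) = (e, if e then t2^-1%g p else t1^-1%g p).
    by apply: (@perm_inj _ (both t1 t2)); rewrite permKV bothE; case: e; rewrite permKV.
  rewrite /out_colour; case: e => /=.
    by rewrite -(eqP (c2 _)) permKV.
  by rewrite -(eqP (c1 _)) permKV.
rewrite (@inv_parity_rank _ rank rank0); [|exact: rank_inj | exact: rank0_inj].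
rewrite inv_parity_both.
rewrite (eq_pair_parity (out_order oa)) (eq_pair_parity (in_order ob)) !pair_parityD.
rewrite !pair_parity_product;
  try (by move=> x y; apply: block_lt).
rewrite !big_in_block !(big_left, big_right).
have aFF : \big[addb/false]_(p : T | (r <= p)%N) oa (false, p) = par_right k.
  by apply: eq_bigr => p rp; rewrite /oa /out_colour /= mixR.
have aTT : \big[addb/false]_(p : T | (p < r)%N) oa (true, p) = par_left k.
  by apply: eq_bigr => p rp; rewrite /oa /out_colour /= mixL.
have aTF : \big[addb/false]_(p : T | (r <= p)%N) oa (true, p) = par_right j.
  by apply: eq_bigr => p rp; rewrite /oa /out_colour /= mixR.
have bFT : \big[addb/false]_(p : T | (p < r)%N) ob (false, p) = par_left k.
  by apply: eq_bigr => p rp; rewrite obE mixL.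
have bFF : \big[addb/false]_(p : T | (r <= p)%N) ob (false, p) = par_right i.
  by apply: eq_bigr => p rp; rewrite obE mixR.
have bTT : \big[addb/false]_(p : T | (p < r)%N) ob (true, p) = par_left j.
  by apply: eq_bigr => p rp; rewrite obE mixL.
rewrite aFF aTT aTF bFT bFF bTT.
have -> : \big[addb/false]_(x in middle) par (out_colour i k j x)
          = par_left k (+) par_right k.
  rewrite big_mkcond big_X; congr addb.
    rewrite -aTT [RHS]big_mkcond; apply: eq_bigr => p _.
    by rewrite inE /=; case: (p < r)%N.
  rewrite -aFF [RHS]big_mkcond; apply: eq_bigr => p _.
  by rewrite inE /= [(r <= p)%N]leqNgt; case: (p < r)%N.
have bal (t : {perm T}) (x y : col) : (forall p, mix y x (t p) == mix x y p) ->
    par_left x (+) par_right y = par_left y (+) par_right x.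
  move=> c; have split_mix z w :
      par_left z (+) par_right w = \big[addb/false]_p par (mix z w p).
    rewrite [RHS](bigID (fun p : T => p < r)%N) /=; congr addb.
      by apply: eq_bigr => p pr; rewrite mixL.
    apply: eq_big => p; first by rewrite -leqNgt.
    by move=> pr; rewrite mixR.
  rewrite !split_mix [RHS](reindex_inj (@perm_inj _ t)); apply: eq_bigr => p _.
  by rewrite (eqP (c p)).
have := bal _ _ _ c1; have := bal _ _ _ c2.
rewrite /bend !triD !odd_odd_right -/oa.
move: (inv_parity _ _ t1) (inv_parity _ _ t2) (tri _) (tri _) (tri _) => v1 v2 z1 z2 z3.
move: (par_left i) (par_left j) (par_left k) (par_right i) (par_right j) (par_right k).
by case: v1; case: v2; case: z1; case: z2; case: z3; do 6!case.
Qed.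

End Colours.

End Stack.

Section StackedDiagram.
Variables (F : numFieldType) (r s : nat).
Local Notation T := 'I_(r + s).
Local Notation X := (bool * T)%type.
Local Notation col m n := (multi_index m n r s).
Implicit Types (d : diagram r s) (p q : T).

Definition outer p : X := ((r <= p)%N, p).

Lemma outer_middle p : outer p \notin middle r s.
Proof. by rewrite inE /outer /=; case: leqP. Qed.

Lemma outerE x : x \notin middle r s -> x = outer x.2.
Proof.
by case: x => e p; rewrite inE /outer /=; case: leqP => _; case: e.
Qed.

Lemma rank_outer p : rank (outer p) = p.
Proof. by rewrite /rank (negPf (outer_middle p)). Qed.

Lemma rank_middle x : x \in middle r s -> (r + s <= rank x)%N.
Proof. by rewrite /rank => ->; apply: leq_addr. Qed.

Lemma big_outer (h : X -> bool) : (forall x, x \in middle r s -> h x = false) ->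
  \big[addb/false]_x h x = \big[addb/false]_p h (outer p).
Proof.
move=> h0; rewrite big_X -big_split; apply: eq_bigr => p _ /=.
have := h0 (true, p); have := h0 (false, p); rewrite !inE /outer /=.
by case: leqP => _ /= => [/(_ isT)-> _ | _ /(_ isT)->]; rewrite ?addbF.
Qed.

Lemma sum_sign m n : \sum_(c : 'I_(m + n)) (-1) ^+ parity c = m%:R - n%:R :> F.
Proof.
rewrite big_split_ord /=; congr (_ + _).
  rewrite (eq_bigr (fun=> 1)) ?sumr_const ?card_ord // => c _.
  by rewrite /parity /= leqNgt ltn_ord.
rewrite (eq_bigr (fun=> -1)) => [|c _].
  by rewrite sumr_const card_ord mulNrn.
by rewrite /parity /= leq_addr.
Qed.

(** The strands that start in the middle are contracted.  The others, followed to
    the next outer vertex, are the strands of a third diagram, which like the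
    number of circles does not depend on [m] and [n]. *)
Lemma stack_contract d1 d2 : exists N (t : {perm T}), forall m n (i j : col m n),
  \sum_k wt F i d1 k * wt F k d2 j
  = (m%:R - n%:R) ^+ N * wt F i (perm_diag t) j.
Proof.
have [|N [t [tM _ tE]]] := @contract F _ (@rank r s) (@rank_inj r s) (middle r s)
  (stack_perm d1 d2).
  move=> z x zM /outerE->; rewrite rank_outer => zp; exfalso.
  by have := leq_trans (rank_middle zM) (ltnW zp); rewrite leqNgt ltn_ord.
have tO p : t (outer p) \notin middle r s.
  apply: contra (outer_middle p) => tp; have := tM _ tp => /perm_inj tp'.
  by rewrite -tp'.
have t0i : injective (fun p => (t (outer p)).2).
  move=> p q pq; have : t (outer p) = t (outer q).
    by rewrite (outerE (tO p)) pq -(outerE (tO q)).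
  by move/perm_inj => [].
pose t0 := perm t0i; have t0E p : t (outer p) = outer (t0 p).
  by rewrite permE -(outerE (tO p)).
exists N, t0 => m n i j.
pose a (x : X) := mix i j x.2; pose b (x : X) := mix j i x.2.
transitivity ((-1) ^+ bend i j
    * contraction F (@rank r s) (@parity m n) (middle r s) (stack_perm d1 d2) a b).
  rewrite /contraction mulr_sumr.
  pose ck (k : col m n) : {ffun X -> 'I_(m + n)} :=
    [ffun x => if x \in middle r s then k x.2 else a x].
  pose kc (c : {ffun X -> 'I_(m + n)}) : col m n := [ffun p : T => c ((p < r)%N, p)].
  rewrite (reindex_onto ck kc) => [|c /forall_inP cP]; last first.
    apply/ffunP => x; rewrite !ffunE; case: ifPn => xM; last first.
      by apply/esym/eqP/cP; rewrite inE.
    by move: xM; rewrite inE; case: x => e p /= /eqP<-.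
  rewrite [RHS](eq_bigl predT) => [|k]; last first.
    apply/andP; split.
      by apply/forall_inP => x; rewrite inE => /negPf xM; rewrite ffunE xM.
    by apply/eqP/ffunP => p; rewrite !ffunE inE /= eqxx.
  apply: eq_bigr => k _; rewrite wt_stack.
  have ocE x : out_colour i k j x = ck k x.
    rewrite ffunE inE /out_colour /a; case: x => -[] p /=; rewrite !ffunE;
      by case: (p < r)%N.
  congr (_ * (_ * _)).
    by congr (_ ^+ nat_of_bool _); apply: eq_bigr => x _; rewrite ocE.
  apply: eq_perm_kernel => x; first exact: ocE.
  rewrite /reset ffunE inE /in_colour /b; case: x => -[] p /=; rewrite !ffunE;
    by case: (p < r)%N.
rewrite (tE _ _ _ _ a) sum_sign wt_signed_perm mulrCA perm_diagK.
congr (_ * (_ * _)); rewrite /signed_perm /perm_kernel.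
have -> : [forall x, reset (middle r s) a b (t x) == reset (middle r s) a a x]
        = [forall p, mix j i (t0 p) == mix i j p].
  apply/forallP/forallP => [H p | H x].
    have := H (outer p); rewrite t0E /reset !(negPf (outer_middle _)).
    exact.
  have [xM|xM] := boolP (x \in middle r s); first by rewrite tM // /reset xM.
  by rewrite (outerE xM) t0E /reset !(negPf (outer_middle _)); apply: H.
case: ifP => // _; congr (_ ^+ nat_of_bool _).
have ppE (Y : finType) (f : Y -> nat) (h : Y -> Y -> bool) : pair_parity f h
    = \big[addb/false]_x \big[addb/false]_y ((f x < f y)%N && h x y).
  rewrite pair_bigA /pair_parity big_mkcond.
  by apply: eq_bigr => -[x y] _ /=; case: ifP.
rewrite /inv_parity !ppE big_outer => [|x xM].
  apply: eq_bigr => p _; rewrite big_outer => [|y yM].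
    apply: eq_bigr => q _; rewrite !t0E !rank_outer /reset.
    by rewrite !(negPf (outer_middle _)).
  rewrite t0E !rank_outer (tM y) // [(rank y < _)%N]ltnNge.
  by rewrite (leq_trans (ltnW (ltn_ord _)) (rank_middle yM)) !andbF.
rewrite big1 // => y _; rewrite (tM x) //.
have [yM|/outerE->] := boolP (y \in middle r s).
  by rewrite (tM y) //; case: ltngtP; rewrite ?andbF.
rewrite rank_outer [(rank x < _)%N]ltnNge.
by rewrite (leq_trans (ltnW (ltn_ord _)) (rank_middle xM)).
Qed.

(** ** The stacked graph *)

Lemma wt_even m (i j : col m 0) d : wt F i d j = (matching i d j)%:R.
Proof.
rewrite /wt -/(matching i d j); case: ifP => // _.
have par0 (c : 'I_(m + 0)) : parity c = false.
  by rewrite /parity leqNgt -{2}[m]addn0 ltn_ord.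
rewrite !big1 ?mulr1 // => [v | vw] _; by rewrite par0 // expr0.
Qed.

(** Without odd colours weights are 0 or 1, so [stack_contract] counts colourings. *)
Lemma stack_count d1 d2 N t : (forall m n (i j : col m n),
    \sum_k wt F i d1 k * wt F k d2 j = (m%:R - n%:R) ^+ N * wt F i (perm_diag t) j) ->
  forall m (i j : col m 0), #|[set k | matching i d1 k && matching k d2 j]|
    = (m ^ N * matching i (perm_diag t) j)%N.
Proof.
move=> H m i j; apply/eqP; rewrite -(eqr_nat F) natrM natrX; apply/eqP.
have := H m 0%N i j; rewrite subr0 wt_even => <-.
rewrite -sum1_card natr_sum big_mkcond; apply: eq_bigr => k _.
by rewrite inE !wt_even -natrM mulnb; case: (_ && _).
Qed.

Lemma row_neq : [/\ (inord 1 == inord 0 :> 'I_3) = false,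
  (inord 2 == inord 0 :> 'I_3) = false & (inord 2 == inord 1 :> 'I_3) = false].
Proof. by split; rewrite -val_eqE /= !inordK. Qed.

Lemma row_cases (x : row_point r s) :
  [\/ x = (inord 0, x.2), x = (inord 1, x.2) | x = (inord 2, x.2)].
Proof.
case: x => -[[|[|[|l]]] lr] p //=; [constructor 1 | constructor 2 | constructor 3];
  by congr (_, _); apply: val_inj; rewrite /= inordK.
Qed.

Definition row_colour m n (i k j : col m n) (x : row_point r s) :=
  if x.1 == inord 0 then i x.2 else if x.1 == inord 1 then k x.2 else j x.2.

Lemma row_colour_lower m n (i k j : col m n) v :
  row_colour i k j (lower_point v) = colour i k v.
Proof.
have [n10 n20 n21] := row_neq.
by case: v => -[] p; rewrite /row_colour /colour /= ?eqxx ?n10.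
Qed.

Lemma row_colour_upper m n (i k j : col m n) v :
  row_colour i k j (upper_point v) = colour k j v.
Proof.
have [n10 n20 n21] := row_neq.
by case: v => -[] p; rewrite /row_colour /colour /= ?n10 ?n20 ?n21 ?eqxx.
Qed.

Lemma row_colour_outer m n (i k j : col m n) v :
  row_colour i k j (outer_point v) = colour i j v.
Proof.
have [n10 n20 n21] := row_neq.
by case: v => -[] p; rewrite /row_colour /colour /= ?n20 ?n21 ?eqxx.
Qed.

Variables (d1 d2 : diagram r s).
Implicit Types (x y : row_point r s).
Local Notation edge := (stack_rel d1 d2).

Lemma stack_sym : connect_sym edge.
Proof.
apply: sym_connect_sym => x y; rewrite /stack_rel; congr orb.
  by apply/existsP/existsP => -[v /andP[/eqP-> /eqP->]];
     exists (strand d1 v); rewrite strandK !eqxx.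
by apply/existsP/existsP => -[v /andP[/eqP-> /eqP->]];
   exists (strand d2 v); rewrite strandK !eqxx.
Qed.

Lemma matching_edge m n (i k j : col m n) :
  reflect (forall x y, edge x y -> row_colour i k j x = row_colour i k j y)
          (matching i d1 k && matching k d2 j).
Proof.
apply: (iffP andP) => [[/forallP M1 /forallP M2] x y | H].
  case/orP => /existsP[v /andP[/eqP-> /eqP->]].
    by rewrite !row_colour_lower; apply/eqP.
  by rewrite !row_colour_upper; apply/eqP.
split; apply/forallP => v; apply/eqP.
  rewrite -!(row_colour_lower i k j); apply: H; apply/orP; left.
  by apply/existsP; exists v; rewrite !eqxx.
rewrite -!(row_colour_upper i k j); apply: H; apply/orP; right.
by apply/existsP; exists v; rewrite !eqxx.
Qed.

Lemma matching_connect m n (i k j : col m n) x y :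
  matching i d1 k && matching k d2 j -> connect edge x y ->
  row_colour i k j x = row_colour i k j y.
Proof.
move=> /matching_edge H xy.
have cl : closed edge [pred z | row_colour i k j z == row_colour i k j x].
  by move=> z z' /H zz'; rewrite !inE zz'.
by have := closed_connect cl xy; rewrite !inE eqxx => /esym/eqP->.
Qed.

Section Count.
Variables (N : nat) (t : {perm T}).
Hypothesis count : forall m (i j : col m 0),
  #|[set k | matching i d1 k && matching k d2 j]|
  = (m ^ N * matching i (perm_diag t) j)%N.

Definition row_of m (c : row_point r s -> 'I_(m + 0)) (l : 'I_3) : col m 0 :=
  [ffun p : T => c (l, p)].

Lemma row_ofK m (c : row_point r s -> 'I_(m + 0)) :
  row_colour (row_of c (inord 0)) (row_of c (inord 1)) (row_of c (inord 2)) =1 c.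
Proof.
have [n10 n20 n21] := row_neq.
by move=> x; case: (row_cases x) => ->; rewrite /row_colour /= ?n10 ?n20 ?n21 ?eqxx ffunE.
Qed.

(** Colouring the component of an outer point differently from the rest gives
    matching colours, so the count is not zero and the other end of the strand of
    the third diagram is in the component.  Conversely, with sufficiently many
    colours the outer points of the same component are recognised. *)
Lemma is_stackE d : is_stack d1 d2 d = (d == perm_diag t).
Proof.
apply/forallP/eqP => [dS | -> v].
  rewrite -[d]diag_permK; congr perm_diag; apply/permP => p.
  pose a : col (r + s).+1 0 := [ffun p : T => lshift 0 (widen_ord (leqnSn _) p)].
  pose b : col (r + s).+1 0 := [ffun p : T => a (t^-1%g p)].
  have ai : injective a.
    by move=> q q'; rewrite !ffunE => /lshift_inj/(congr1 val)/= /ord_inj.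
  have : (0 < #|[set k | matching (mix a b) d1 k && matching k d2 (mix b a)]|)%N.
    rewrite count matchingE !mixK perm_diagK muln_gt0 expn_gt0 /= lt0b.
    by apply/forallP => q; rewrite [b _]ffunE permK.
  case/card_gt0P => k; rewrite inE => kM.
  have := matching_connect kM (dS (out_vertex p)).
  rewrite !row_colour_outer strand_outE colour_out colour_in !mixK [b _]ffunE.
  by move/ai => {2}->; rewrite permKV.
apply: contraT => nv; pose c x : 'I_(2 + 0) :=
  if connect edge (outer_point v) x then ord_max else ord0.
have cM : matching (row_of c (inord 0)) d1 (row_of c (inord 1))
          && matching (row_of c (inord 1)) d2 (row_of c (inord 2)).
  apply/matching_edge => x y xy; rewrite !row_ofK /c.
  by rewrite (same_connect_r stack_sym (connect1 xy)).
have : (0 < #|[set k | matching (row_of c (inord 0)) d1 k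
                       && matching k d2 (row_of c (inord 2))]|)%N.
  by apply/card_gt0P; exists (row_of c (inord 1)); rewrite inE.
rewrite count muln_gt0 lt0b => /andP[_ /forallP/(_ v)].
rewrite -!(row_colour_outer _ (row_of c (inord 1))) !row_ofK /c connect0.
by rewrite (negPf nv).
Qed.

(** For two colours, the outer points all having the first one, the matching
    colours of the middle row are given by the circles of the second colour. *)
Lemma internal_circlesE : internal_circles d1 d2 = N.
Proof.
have [n10 n20 n21] := row_neq.
pose z : col 2 0 := [ffun _ => ord0].
have zM d : matching z d z.
  by rewrite matchingE; apply/forallP => p; rewrite !ffunE !if_same.
have := count z z; rewrite zM muln1.
pose circ : pred (row_point r s) :=
  [pred x | [forall y, connect edge x y ==> (y.1 == inord 1)]].
pose R := [set x | roots edge x && circ x].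
have RE : internal_circles d1 d2 = #|R|.
  by rewrite /internal_circles /n_comp_mem; apply: eq_card => x; rewrite !inE.
pose psi (S : {set row_point r s}) : col 2 0 :=
  [ffun p : T => if fingraph.root edge (inord 1, p) \in S then ord_max else ord0].
have circP x : ~~ circ (fingraph.root edge x) ->
    exists2 y, connect edge x y & y.1 != inord 1.
  case/forallPn => y; rewrite negb_imply => /andP[xy y1]; exists y => //.
  exact: connect_trans (connect_root _ x) xy.
have circ1 x : circ (fingraph.root edge x) -> x.1 = inord 1.
  by move/forallP/(_ x); rewrite (stack_sym (fingraph.root _ x)) connect_root => /eqP.
have psiC (S : {set row_point r s}) x : S \subset R ->
    row_colour z (psi S) z x = if fingraph.root edge x \in S then ord_max else ord0.
  move=> /subsetP SR.
  have out p l : (l == inord 1) = false -> (fingraph.root edge (l, p) \in S) = false.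
    move=> l1; apply: contraFF l1 => /SR; rewrite inE => /andP[_ /circ1 /= ->].
    by rewrite eqxx.
  case: (row_cases x) => ->; rewrite /row_colour /= ?n10 ?n20 ?n21 ?eqxx ffunE //.
    by rewrite out // eq_sym n10.
  by rewrite out.
suff -> : [set k | matching z d1 k && matching k d2 z] = psi @: powerset R.
  rewrite card_in_imset ?card_powerset => [/eqP|S S'].
    by rewrite eqn_exp2l // -RE => /eqP.
  rewrite !inE => SR SR' psiS.
  have E x : (x \in S) = (x \in S').
    have [xR|xR] := boolP (x \in R); last first.
      by rewrite (contraNF (subsetP SR x) xR) (contraNF (subsetP SR' x) xR).
    have rx : fingraph.root edge x = x by move: xR; rewrite inE => /andP[/eqP].
    have := psiC S x SR; rewrite psiS psiC // rx.
    by case: ifP; case: ifP.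
  exact/setP.
apply/setP => k; rewrite inE; apply/idP/imsetP => [kM | [S]]; last first.
  rewrite inE => SR ->; apply/matching_edge => x y xy; rewrite !psiC //.
  by rewrite (fingraph.rootP stack_sym (connect1 xy)).
exists [set x in R | k x.2 == ord_max].
  by rewrite inE; apply/subsetP => x; rewrite inE => /andP[].
apply/ffunP => p; rewrite ffunE.
have kp : k p = row_colour z k z (inord 1, p) by rewrite /row_colour /= n10 eqxx.
have krt : row_colour z k z (inord 1, p)
           = row_colour z k z (fingraph.root edge (inord 1, p)).
  by apply: matching_connect => //; apply: connect_root.
have two (c : 'I_(2 + 0)) : c = if c == ord_max then ord_max else ord0.
  by case: eqP => // cm; apply: val_inj; move: c cm => [[|[|l]] lt] //= []; apply: val_inj.
rewrite inE [_ \in R]inE roots_root /=; last exact: stack_sym.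
have [cr|/circP[y xy y1]] := boolP (circ _); last first.
  rewrite kp (matching_connect kM xy).
  case: (row_cases y) y1 => ->; rewrite /= ?eqxx // => _.
    by rewrite /row_colour /= eqxx ffunE.
  by rewrite /row_colour /= n20 n21 ffunE.
have r1 : (fingraph.root edge (inord 1, p)).1 = inord 1.
  by apply: circ1; rewrite root_root //; apply: stack_sym.
rewrite {1}kp krt [LHS]two {1}/row_colour r1 n10 eqxx.
by [].
Qed.

End Count.

End StackedDiagram.

(** * The homomorphism *)

Section PsiMorphism.
Variables (F : numFieldType) (m n r s : nat).
Local Notation col := (multi_index m n r s).
Local Notation PsiF := (Psi F m n r s).
Local Notation e_ := (basis_vec F).
Implicit Types (i j k : col) (x y : wb_alg F r s).

Lemma Psi_one : PsiF (wb_one F r s) = \1%VF.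
Proof.
apply: coord_ext => i j; rewrite /wb_one /Psi lin_ext_basis diagram_act_coord.
rewrite wt_signed_perm id_lfunE ffunE.
have -> : diag_perm (id_diagram r s) = 1%g.
  by apply/permP => p; rewrite permE perm1 /strand /= ffunE.
rewrite /signed_perm perm_kernel1.
have -> : [forall p, mix j i p == mix i j p] = (j == i).
  apply/forallP/eqP => [H | -> p //]; apply/ffunP => p.
  by have /eqP := H p; rewrite !ffunE; case: ifP.
case: eqP => [-> | _]; last by rewrite mulr0.
by rewrite /bend addnn tri_double addbb expr0 mulr1.
Qed.

Lemma wt_mul_stack (d1 d2 : diagram r s) i j :
  \sum_k wt F i d1 k * wt F k d2 j = \sum_(d | is_stack d1 d2 d)
    (m%:R - n%:R) ^+ internal_circles d1 d2 * wt F i d j.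
Proof.
have [N [t H]] := stack_contract F d1 d2; have count := stack_count H.
rewrite (internal_circlesE count) H.
by rewrite (big_pred1 (perm_diag t)) // => d; apply: is_stackE count d.
Qed.

Lemma Psi_mul x y : PsiF (wb_mul (m%:R - n%:R) x y) = (PsiF y \o PsiF x)%VF.
Proof.
apply: coord_ext => i j; rewrite comp_lfunE [PsiF x (e_ i)]ffun_basis.
rewrite [in RHS]linear_sum [in RHS]sum_ffunE.
transitivity (\sum_d1 \sum_d2 \sum_k x d1 * wt F i d1 k * (y d2 * wt F k d2 j)).
  rewrite Psi_coord /wb_mul.
  transitivity (\sum_d1 \sum_d2 \sum_(d | is_stack d1 d2 d)
    x d1 * y d2 * (m%:R - n%:R) ^+ internal_circles d1 d2 * wt F i d j).
    under eq_bigr => d _ do rewrite sum_ffunE mulr_suml.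
    rewrite exchange_big; apply: eq_bigr => d1 _ /=.
    under eq_bigr => d _ do rewrite sum_ffunE mulr_suml.
    rewrite exchange_big; apply: eq_bigr => d2 _ /=.
    under eq_bigr => d _ do rewrite sum_ffunE mulr_suml.
    rewrite exchange_big; apply: eq_bigr => d _ /=.
    rewrite (bigD1 d) //= big1 ?addr0 => [|d' /negPf dd'].
      by rewrite !ffunE eqxx [X in X * _]mulr1.
    by rewrite !ffunE dd' [X in X * _]mulr0 mul0r.
  apply: eq_bigr => d1 _; apply: eq_bigr => d2 _.
  under eq_bigr => d _ do rewrite -mulrA.
  rewrite -mulr_sumr -wt_mul_stack mulr_sumr; apply: eq_bigr => k _.
  by rewrite mulrACA.
rewrite exchange_big /=; under eq_bigr => d2 _ do rewrite exchange_big.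
rewrite exchange_big; apply: eq_bigr => k _ /=.
rewrite linearZ /= ffunE !Psi_coord [RHS]mulr_suml.
rewrite exchange_big; apply: eq_bigr => d1 _ /=.
by rewrite mulr_sumr.
Qed.

End PsiMorphism.

(* The first three clauses say that Psi, which is linear by its type, is an
   algebra homomorphism to End_g(...)^op, where the product is reversed
   composition; the last two are surjectivity and the injectivity criterion. *)
Theorem theorem7p8 (R : realType) (m n r s : nat) :
  let delta : R[i] := m%:R - n%:R in
  let psi := Psi R[i] m n r s in
  [/\ [/\ forall a, supercommutes (psi a),
          psi (wb_one R[i] r s) = \1%VF &
          forall a b, psi (wb_mul delta a b) = (psi b \o psi a)%VF],
      forall f, supercommutes f -> exists a, psi a = f &
      injective psi <-> (r + s < (m + 1) * (n + 1))%N].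
Proof.
move=> delta psi; split; [split | |].
- exact: Psi_supercommutes.
- exact: Psi_one.
- exact: Psi_mul.
- exact: Psi_surjective.
exact: Psi_injective.
Qed.
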